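(* Let $\Psi$ be an Orlicz function and $\phi\colon\mathbb D\to\mathbb D$ analytic. If $C_\phi\colon H^\Psi\to H^\Psi$ is order bounded (into $L^\Psi(\mathbb T)$), then there is $A>0$ with $m(1-|\phi^*|<\lambda)=O\big(1/\chi_A(1/\lambda)\big)$ as $\lambda\to0$; if it is order bounded into $M^\Psi(\mathbb T)$, then $m(1-|\phi^*|<\lambda)=O\big(1/\chi_A(1/\lambda)\big)$ as $\lambda\to0$ for every $A>0$. If moreover $\Psi$ satisfies $\Delta^1$, the converses hold: the first condition (for some $A$) implies order boundedness, and the second (for every $A$) implies order boundedness into $M^\Psi(\mathbb T)$.
   Context: An Orlicz function is a continuous, strictly convex, increasing $\Psi\colon[0,\infty)\to[0,\infty)$ with $\Psi(0)=0$ and $\Psi(x)/x\to\infty$. On $\mathbb T$ with normalized measure $m$: $\|g\|_\Psi=\inf\{C>0:\int\Psi(|g|/C)\,dm\le1\}$, $L^\Psi(\mathbb T)$ its space, $M^\Psi(\mathbb T)$ the subspace with $\int\Psi(|g|/C)\,dm<\infty$ for all $C>0$. $H^\Psi$ = analytic $f$ on $\mathbb D$ with $\sup_{r<1}\|f(re^{i\cdot})\|_\Psi<\infty$, normed by its boundary function $f^*$. $C_\phi f=f\circ\phi$. $C_\phi$ is order bounded (resp. into $M^\Psi(\mathbb T)$) if there is $g\ge0$ in $L^\Psi(\mathbb T)$ (resp. $M^\Psi(\mathbb T)$) with $|(f\circ\phi)^*|\le g$ a.e. for every $f$ in the unit ball of $H^\Psi$. $\chi_A(x)=\Psi(A\Psi^{-1}(x))$.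 $\Delta^1$: there is $\beta>1$ with $x\Psi(x)\le\Psi(\beta x)$ for all large $x$. *)

(* Defs.v *)
From HB Require Import structures.
From mathcomp Require Import all_boot all_order all_algebra.
From mathcomp Require Import all_classical all_reals all_analysis.
From mathcomp Require Export complex.
Export numFieldNormedType.Exports.

Set Implicit Arguments.
Unset Strict Implicit.
Unset Printing Implicit Defensive.

Import Order.TTheory GRing.Theory Num.Theory.
Local Open Scope ring_scope.
Local Open Scope classical_set_scope.

(* R[i] as a normed module over itself (so that [derivable f z 1] is
   complex differentiability). *)
Section ComplexNormed.
Variable R : rcfType.
HB.instance Definition _ := NormedModule.copy (complex R) (complex R)^o.
End ComplexNormed.

Section Orlicz.
Variable R : realType.

Definition cabs (z : R[i]) : R := complex.Re `|z|.

Definition expi (t : R) : R[i] := (cos t +i* sin t)%C.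

Definition polar (r t : R) : R[i] := (r%:C)%C * expi t.

Definition disc : set R[i] := [set z | `|z| < 1].

Definition holo_on (D : set R[i]) (f : R[i] -> R[i]) :=
  forall z, D z -> derivable f z 1.

(* Orlicz function: only its restriction to [0, +oo) matters *)
Definition Orlicz (Psi : R -> R) : Prop :=
  [/\ {within [set x : R | 0 <= x], continuous Psi},
      (forall x y : R, 0 <= x -> x <= y -> Psi x <= Psi y),
      (forall x y t : R, 0 <= x -> 0 <= y -> x != y -> 0 < t < 1 ->
          Psi (t * x + (1 - t) * y) < t * Psi x + (1 - t) * Psi y),
      Psi 0 = 0
    & (Psi x / x) @[x --> +oo] --> +oo].

Definition Psi_inv (Psi : R -> R) (y : R) : R :=
  xget 0 [set x : R | 0 <= x /\ Psi x = y].

Definition chi (Psi : R -> R) (A : R) (x : R) : R := Psi (A * Psi_inv Psi x).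

Definition Delta1 (Psi : R -> R) : Prop :=
  exists2 beta : R, 1 < beta & \forall x \near +oo, x * Psi x <= Psi (beta * x).

(* the circle T is parametrized by t in [0, 2 pi[ ; normalized measure m *)
Definition Tpar : set R := `[0, 2 * pi[%classic.

Definition mT (A : set R) : \bar R :=
  ((2 * pi)^-1)%:E * (lebesgue_measure (A `&` Tpar))%E.

Definition intT (f : R -> \bar R) : \bar R :=
  ((2 * pi)^-1)%:E * (\int[lebesgue_measure]_(t in Tpar) f t)%E.

Definition modular (Psi : R -> R) (g : R -> R) (C : R) : \bar R :=
  intT (fun t => (Psi (`|g t| / C))%:E).

Definition orlicz_norm (Psi : R -> R) (g : R -> R) : \bar R :=
  ereal_inf [set C%:E | C in [set C : R | 0 < C /\ (modular Psi g C <= 1)%E]].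

Definition in_LPsi (Psi : R -> R) (g : R -> R) : Prop :=
  measurable_fun Tpar g /\ (orlicz_norm Psi g < +oo)%E.

Definition in_MPsi (Psi : R -> R) (g : R -> R) : Prop :=
  measurable_fun Tpar g /\ forall C : R, 0 < C -> (modular Psi g C < +oo)%E.

Definition bnd (f : R[i] -> R[i]) (t : R) : R[i] :=
  lim (f (polar r t) @[r --> (1 : R)^'-]).

Definition in_HPsi (Psi : R -> R) (f : R[i] -> R[i]) : Prop :=
  holo_on disc f /\
  exists M : R, forall r : R, 0 <= r < 1 ->
    (orlicz_norm Psi (fun t => cabs (f (polar r t))) <= M%:E)%E.

Definition HPsi_norm (Psi : R -> R) (f : R[i] -> R[i]) : \bar R :=
  orlicz_norm Psi (fun t => cabs (bnd f t)).

Definition order_bounded_into (S : (R -> R) -> Prop) (Psi : R -> R)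
    (phi : R[i] -> R[i]) : Prop :=
  exists g : R -> R, [/\ S g, (forall t, 0 <= g t) &
    forall f, in_HPsi Psi f -> (HPsi_norm Psi f <= 1)%E ->
      {ae lebesgue_measure, forall t, Tpar t -> cabs (bnd (f \o phi) t) <= g t}].

Definition order_bounded Psi phi := order_bounded_into (in_LPsi Psi) Psi phi.
Definition order_bounded_M Psi phi := order_bounded_into (in_MPsi Psi) Psi phi.

Definition bigO_cond (Psi : R -> R) (phi : R[i] -> R[i]) (A : R) : Prop :=
  exists K : R, \forall l \near (0 : R)^'+,
    (mT [set t | (1 - cabs (bnd phi t) < l)%R] <= (K / chi Psi A l^-1)%R%:E)%E.

End Orlicz.
Arguments disc {R}.

(* Main.v *)
(** Evaluation at [z] has norm comparable to [Psi^-1(1/(1-|z|))] on the unit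
    ball of [H^Psi], so order boundedness says that [Psi^-1(1/(1-|phi^*|))] lies
    in [L^Psi] (resp. [M^Psi]). Markov's inequality then gives the tail estimate,
    the lower bound on the evaluations being attained, at scale [l], by multiples
    of [l^2 (1 - conj a z)^-2] with [a] in a countable grid. Conversely, under
    [Delta^1] the layers [2^k < Psi^-1(1/(1-|phi^*|)) <= 2^(k+1)] contribute a
    geometric series to the modular.

    The upper bound on evaluations rests on Fatou's theorem for [H^2]. Goursat's
    bisection along the homotopy [z + e^s (e^(it) - z)] yields the Poisson
    formula, as well as [<f_r, f_s> = ||f_sqrt(rs)||^2] for the dilates [f_r] of
    [f]; hence [s |-> ||f_(e^s)||^2] is midpoint convex and bounded, so the
    dilates are Cauchy in mean. The Hardy-Littlewood maximal inequality upgrades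
    this to radial convergence almost everywhere. *)
Require Import Defs.
From HB Require Import structures.
From mathcomp Require Import all_boot all_order all_algebra.
From mathcomp Require Import all_classical all_reals all_analysis.
From mathcomp Require Import measurable_realfun complex ring lra.
Import numFieldNormedType.Exports.
Import Order.TTheory GRing.Theory Num.Theory.
Set Implicit Arguments.
Unset Strict Implicit.
Unset Printing Implicit Defensive.
Local Open Scope ring_scope.
Local Open Scope classical_set_scope.

(** * Complex plane *)

(** Order boundedness provides one exceptional null set for each function, whereas the test function
    suited to a point [t] depends on [phi^*(t)]; hence the countable family in the necessity half.
    [Delta1] enters the converse twice: it makes the layers summable, and it gives
    [y^2 <= K + K Psi y], that is, H^Psi inside H^2, where radial limits are available; [phi] is
    bounded, hence in H^2 directly. The unit ball is normed by boundary values, while [bnd] is a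
    [lim] whose value is arbitrary where no limit exists. A bound on [f z] must therefore travel
    from interior circles to the boundary: almost everywhere convergence identifies the limit, and
    convergence in mean carries the Poisson integral over. Absolute constants such as 12 and 36 are
    not optimized: a factor in the size of the evaluations only rescales [A], because [chi Psi A]
    evaluates [Psi] at a multiple of [Psi_inv]. *)

Section ComplexPlane.
Variable R : realType.
Implicit Types (x y r t e : R) (z w u : R[i]).

Lemma normr_cabs z : `|z| = ((cabs z)%:C)%C.
Proof. by []. Qed.

Lemma cabsE z : cabs z = Num.sqrt (complex.Re z ^+ 2 + complex.Im z ^+ 2).
Proof. by case: z. Qed.

Lemma cabs_ge0 z : 0 <= cabs z.
Proof. by rewrite cabsE sqrtr_ge0. Qed.

Lemma cabs0 : cabs (0 : R[i]) = 0.
Proof. exact: Normc.normc0. Qed.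

Lemma cabs1 : cabs (1 : R[i]) = 1.
Proof. exact: Normc.normc1. Qed.

Lemma cabs_eq0 z : (cabs z == 0) = (z == 0).
Proof. 
apply/eqP/eqP => [/Normc.eq0_normc//|->]; exact: cabs0.
Qed.

Lemma cabs_gt0 z : (0 < cabs z) = (z != 0).
Proof. by rewrite lt_def cabs_ge0 andbT cabs_eq0. Qed.

Lemma cabsM z w : cabs (z * w) = cabs z * cabs w.
Proof. exact: Normc.normcM. Qed.

Lemma cabsV z : cabs z^-1 = (cabs z)^-1.
Proof. exact: Normc.normcV. Qed.

Lemma cabsN z : cabs (- z) = cabs z.
Proof. exact: normcN. Qed.

Lemma cabsX z n : cabs (z ^+ n) = cabs z ^+ n.
Proof. by elim: n => [|n IH]; rewrite ?cabs1// !exprS cabsM IH. Qed.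

Lemma ler_cabsD z w : cabs (z + w) <= cabs z + cabs w.
Proof. exact: le_normcD. Qed.

Lemma ler_cabsB z w : cabs (z - w) <= cabs z + cabs w.
Proof. by rewrite -(cabsN w) ler_cabsD. Qed.

Lemma cabsBC z w : cabs (z - w) = cabs (w - z).
Proof. by rewrite -cabsN opprB. Qed.

Lemma ler_dist_cabs z w : `|cabs z - cabs w| <= cabs (z - w).
Proof.
have h (a b : R[i]) : cabs a <= cabs (a - b) + cabs b by have := ler_cabsD (a - b) b; rewrite subrK.
have := h z w; have := h w z; rewrite (cabsBC w z) => h1 h2.
by rewrite ler_norml; apply/andP; split; lra.
Qed.

Lemma cabs_real r : cabs (r%:C)%C = `|r|.
Proof. by rewrite cabsE /= expr0n addr0 sqrtr_sqr. Qed.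

Lemma ler_Re_cabs z : `|complex.Re z| <= cabs z.
Proof.
rewrite cabsE -sqrtr_sqr ler_sqrt ?lerDl ?sqr_ge0//.
by rewrite addr_ge0 ?sqr_ge0.
Qed.

Lemma ler_Im_cabs z : `|complex.Im z| <= cabs z.
Proof.
rewrite cabsE -sqrtr_sqr ler_sqrt ?lerDr ?sqr_ge0//.
by rewrite addr_ge0 ?sqr_ge0.
Qed.

Lemma cabs_sqr z : cabs z ^+ 2 = complex.Re z ^+ 2 + complex.Im z ^+ 2.
Proof. by rewrite cabsE sqr_sqrtr// addr_ge0 ?sqr_ge0. Qed.

Lemma ler_cabs_ReIm z : cabs z <= `|complex.Re z| + `|complex.Im z|.
Proof.
rewrite -(@ler_pXn2r _ 2%N) ?nnegrE ?cabs_ge0 ?addr_ge0//.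
rewrite cabs_sqr sqrrD !real_normK ?num_real//.
by rewrite lerD2r lerDl mulrn_wge0 ?mulr_ge0.
Qed.

Lemma cabsJ z : cabs (z^*)%C = cabs z.
Proof. by rewrite !cabsE; case: z => a b /=; rewrite sqrrN. Qed.

Lemma mulcJ z : z * (z^*)%C = ((cabs z ^+ 2)%:C)%C.
Proof.
rewrite cabs_sqr; case: z => a b.
by apply/eqP; rewrite eq_complex /=; apply/andP; split; apply/eqP; ring.
Qed.

Lemma discE z : disc z <-> cabs z < 1.
Proof. by rewrite /disc /= normr_cabs -[1]/((1 : R)%:C)%C ltcR. Qed.

Lemma cabs_expi t : cabs (expi t) = 1.
Proof. by rewrite cabsE /= cos2Dsin2 sqrtr1. Qed.

Lemma expi_neq0 t : expi t != 0.
Proof. by rewrite -cabs_gt0 cabs_expi. Qed.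

Lemma conj_expi t : ((expi t)^*)%C = (expi t)^-1.
Proof.
apply: (mulfI (expi_neq0 t)); rewrite mulcJ cabs_expi expr1n divff //.
exact: expi_neq0.
Qed.

Lemma expi_periodic t : expi (t + 2 * pi) = expi t.
Proof. by rewrite /expi mulr_natl cosD2pi sinD2pi. Qed.

Lemma cabs_polar r t : 0 <= r -> cabs (polar r t) = r.
Proof. by move=> r0; rewrite cabsM cabs_real cabs_expi mulr1 ger0_norm. Qed.

Lemma polarM r s t : polar (r * s) t = (r%:C)%C * polar s t.
Proof. by rewrite /polar rmorphM mulrA. Qed.

(** The norm of [R[i]] takes its values in [R[i]], so neighbourhoods come with complex radii. A
    positive complex number is real, which allows real [e] from here on. *)
Lemma cvg_cabsP T (F : set_system T) {FF : Filter F} (f : T -> R[i]) z :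
  f @ F --> z <-> forall e, 0 < e -> \forall x \near F, cabs (f x - z) < e.
Proof.
split.
  move=> /cvgrPdist_lt h e e0.
  have e0' : 0 < (e%:C)%C :> R[i] by rewrite -[0]/((0 : R)%:C)%C ltcR.
  have := h _ e0'; apply: filterS => x; rewrite normr_cabs ltcR.
  by rewrite cabsBC.
move=> h; apply/cvgrPdist_lt => e e0.
have ee : e = ((complex.Re e)%:C)%C by rewrite RRe_real// gtr0_real.
have re0 : 0 < complex.Re e by rewrite -ltcR -ee.
apply: filterS (h _ re0) => x; rewrite ee normr_cabs ltcR.
by rewrite cabsBC.
Qed.

Lemma nbhs_cabsP (P : set R[i]) z :
  (\forall w \near z, P w) <-> exists2 e, 0 < e & forall w, cabs (w - z) < e -> P w.
Proof.
split.
  move=> /nbhs_ballP[e /= e0 h].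
  have ee : e = ((complex.Re e)%:C)%C by rewrite RRe_real// gtr0_real.
  have re0 : 0 < complex.Re e by rewrite -ltcR -ee.
  exists (complex.Re e) => // w hw; apply: h.
  by rewrite -ball_normE /= ee normr_cabs ltcR cabsBC.
move=> [e e0 h]; apply/nbhs_ballP; exists (e%:C)%C => /=.
  by rewrite -[0]/((0 : R)%:C)%C ltcR.
move=> w; rewrite -ball_normE /= normr_cabs ltcR cabsBC; exact: h.
Qed.

(** The difference quotient is multiplied out, so that [w = z] is allowed and the definition reads
    as the first-order expansion on which Goursat's estimate relies. *)
Definition cdiff (f : R[i] -> R[i]) z := exists d : R[i], forall e, 0 < e ->
  exists2 dl, 0 < dl & forall w, cabs (w - z) < dl ->
    cabs (f w - f z - d * (w - z)) <= e * cabs (w - z).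

Lemma derivable_cdiff f z : derivable f z 1 <-> cdiff f z.
Proof.
split.
  move=> /cvg_ex[d] /cvg_cabsP hd; exists d => e e0.
  have := hd e e0.
  move=> /nbhs_cabsP[dl dl0 h].
  exists dl => // w wz; have [->|wz0] := eqVneq w z.
    by rewrite !subrr mulr0 subr0 cabs0 mulr0.
  have hz : w - z != 0 by rewrite subr_eq0.
  have := h (w - z); rewrite subr0 => /(_ wz hz).
  rewrite /= scaler1 subrK => hh.
  have -> : f w - f z - d * (w - z) = ((w - z)^-1 *: (f w - f z) - d) * (w - z).
    rewrite mulrBl; congr (_ - _).
    have -> : forall a b : R[i], a *: b = a * b by [].
    by rewrite mulrAC mulVf ?mul1r.
  by rewrite cabsM ler_wpM2r ?cabs_ge0// ltW.
move=> [d hd]; apply/cvg_ex; exists d; apply/cvg_cabsP => e e0.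
have [|dl dl0 h] := hd (e/2); first by rewrite divr_gt0.
apply/nbhs_cabsP; exists dl => // w; rewrite subr0 => wdl w0.
have := h (w + z); rewrite addrK => /(_ wdl) hh.
rewrite /= scaler1.
have -> : w^-1 *: (f (w + z) - f z) - d = (f (w + z) - f z - d * w) * w^-1.
  rewrite mulrBl mulfK//; congr (_ - _).
  have -> : forall a b : R[i], a *: b = a * b by [].
  by rewrite mulrC.
rewrite cabsM cabsV ltr_pdivrMr ?cabs_gt0//.
apply: (le_lt_trans hh).
by rewrite ltr_pM2r ?cabs_gt0//; lra.
Qed.

Lemma cdiff_cst c z : cdiff (fun _ => c) z.
Proof.
exists 0 => e e0; exists 1 => // w _.
by rewrite subrr mul0r subr0 cabs0 mulr_ge0 ?cabs_ge0 ?ltW.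
Qed.

Lemma cdiff_id z : cdiff id z.
Proof.
exists 1 => e e0; exists 1 => // w _.
by rewrite mul1r subrr cabs0 mulr_ge0 ?cabs_ge0 ?ltW.
Qed.

Lemma cdiff_continuous f z : cdiff f z -> forall e, 0 < e ->
  exists2 dl, 0 < dl & forall w, cabs (w - z) < dl -> cabs (f w - f z) < e.
Proof.
move=> [d hd] e e0; have [dl dl0 h] := hd 1 ltr01.
have D0 : 0 < cabs d + 1 by rewrite ltr_wpDl ?cabs_ge0.
exists (Num.min dl (e / (cabs d + 1))); first by rewrite lt_min dl0 divr_gt0.
move=> w; rewrite lt_min => /andP[w1]; rewrite ltr_pdivlMr// => w2.
have := h w w1; rewrite mul1r => hh.
have -> : f w - f z = (f w - f z - d * (w - z)) + d * (w - z) by rewrite subrK.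
apply: (le_lt_trans (ler_cabsD _ _)); rewrite cabsM.
apply: le_lt_trans w2; rewrite [leRHS]mulrDr mulr1 addrC (mulrC (cabs d)).
by rewrite lerD2l.
Qed.

Lemma cdiffD f g z : cdiff f z -> cdiff g z -> cdiff (fun w => f w + g w) z.
Proof.
move=> /derivable_cdiff hf /derivable_cdiff hg; apply/derivable_cdiff.
exact: derivableD.
Qed.

Lemma cdiffN f z : cdiff f z -> cdiff (fun w => - f w) z.
Proof.
move=> /derivable_cdiff hf; apply/derivable_cdiff.
exact: derivableN.
Qed.

Lemma cdiffB f g z : cdiff f z -> cdiff g z -> cdiff (fun w => f w - g w) z.
Proof. by move=> hf hg; apply: cdiffD => //; exact: cdiffN. Qed.

Lemma cdiffM f g z : cdiff f z -> cdiff g z -> cdiff (fun w => f w * g w) z.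
Proof.
move=> [d hf] cg; have cgc := cdiff_continuous cg; case: cg => d' hg.
exists (d * g z + f z * d') => e e0.
have G0 : 0 < cabs (g z) + 1 by rewrite ltr_wpDl ?cabs_ge0.
have F0 : 0 < cabs (f z) + 1 by rewrite ltr_wpDl ?cabs_ge0.
have D0 : 0 < cabs d + 1 by rewrite ltr_wpDl ?cabs_ge0.
have [|dl1 dl10 h1] := hf (e / 3 / (cabs (g z) + 1)); first by rewrite !divr_gt0.
have [|dl2 dl20 h2] := hg (e / 3 / (cabs (f z) + 1)); first by rewrite !divr_gt0.
have [|dl3 dl30 h3] := cgc (e / 3 / (cabs d + 1)); first by rewrite !divr_gt0.
have [dl4 dl40 h4] := cgc _ ltr01.
exists (Num.min (Num.min dl1 dl2) (Num.min dl3 dl4)).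
  by rewrite !lt_min dl10 dl20 dl30 dl40.
move=> w; rewrite !lt_min => /andP[/andP[w1 w2] /andP[w3 w4]].
have a1 := h1 _ w1; have a2 := h2 _ w2; have a3 := h3 _ w3; have a4 := h4 _ w4.
have gw : cabs (g w) <= cabs (g z) + 1.
  by have := ler_cabsD (g w - g z) (g z); rewrite subrK; lra.
have -> : f w * g w - f z * g z - (d * g z + f z * d') * (w - z) =
  (f w - f z - d * (w - z)) * g w + f z * (g w - g z - d' * (w - z))
   + d * (w - z) * (g w - g z) by ring.
apply: (le_trans (ler_cabsD _ _)).
apply: (le_trans (lerD (ler_cabsD _ _) (lexx _))); rewrite !cabsM.
have key (K X Y Z : R) : 0 <= X -> 0 <= Y -> 0 <= Z -> 0 < K -> Y <= K ->
    X <= e / 3 / K * Z -> X * Y <= e / 3 * Z.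
  move=> X0 Y0 Z0 K0 YK XK; apply: (@le_trans _ _ (e / 3 / K * Z * K)).
    exact: ler_pM.
  by rewrite mulrAC divfK ?gt_eqF.
have -> : e = e / 3 + e / 3 + e / 3 by lra.
rewrite !mulrDl; apply: lerD; first apply: lerD.
- by apply: key a1; rewrite ?cabs_ge0.
- by rewrite mulrC; apply: key a2; rewrite ?cabs_ge0// lerDl.
- have b : cabs (g w - g z) * cabs d <= e / 3.
    have := key (cabs d + 1) (cabs (g w - g z)) (cabs d) 1.
    by rewrite !mulr1; apply; rewrite ?cabs_ge0 ?lerDl// ltW.
  rewrite [leLHS](_ : _ = cabs (g w - g z) * cabs d * cabs (w - z)); last by ring.
  by rewrite ler_wpM2r ?cabs_ge0.
Qed.

Lemma cdiff_inv z : z != 0 -> cdiff GRing.inv z.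
Proof.
move=> z0; exists (- (z ^+ 2)^-1) => e e0.
have Z0 : 0 < cabs z by rewrite cabs_gt0.
have Z3 : 0 < cabs z ^+ 3 by rewrite exprn_gt0.
exists (Num.min (cabs z / 2) (e * cabs z ^+ 3 / 2)).
  by rewrite lt_min !divr_gt0// mulr_gt0.
move=> w; rewrite lt_min => /andP[w1 w2].
have W : cabs z / 2 <= cabs w.
  by have := ler_dist_cabs w z; rewrite ler_norml => /andP[+ _]; lra.
have W0 : 0 < cabs w by apply: lt_le_trans W; rewrite divr_gt0.
have w0 : w != 0 by rewrite -cabs_gt0.
have -> : w^-1 - z^-1 - - (z ^+ 2)^-1 * (w - z) = (w - z) * (w - z) / (w * z ^+ 2).
  by field; rewrite z0 w0.
rewrite !cabsM cabsV cabsM cabsX mulrAC ler_wpM2r ?cabs_ge0//.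
rewrite ler_pdivrMr ?mulr_gt0 ?exprn_gt0//.
apply: (le_trans (ltW w2)).
rewrite -mulrA ler_pM2l// exprS mulrAC ler_wpM2r//.
by rewrite exprn_ge0 ?cabs_ge0.
Qed.

Lemma cdiff_comp f g z : cdiff g z -> cdiff f (g z) -> cdiff (f \o g) z.
Proof.
move=> cg [d hf]; have cgc := cdiff_continuous cg; case: cg => d' hg.
exists (d * d') => e e0.
have K0 : 0 < cabs d' + 1 by rewrite ltr_wpDl ?cabs_ge0.
have L0 : 0 < cabs d + 1 by rewrite ltr_wpDl ?cabs_ge0.
have e1 : 0 < e / 2 / (cabs d' + 1) by rewrite !divr_gt0.
have e2 : 0 < e / 2 / (cabs d + 1) by rewrite !divr_gt0.
have [dl1 dl10 h1] := hf _ e1.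
have [dl2 dl20 h2] := hg _ e2.
have [dl3 dl30 h3] := hg _ ltr01.
have [dl4 dl40 h4] := cgc _ dl10.
exists (Num.min (Num.min dl2 dl3) dl4); first by rewrite !lt_min dl20 dl30 dl40.
move=> w; rewrite !lt_min => /andP[/andP[w2 w3] w4] /=.
have a1 := h1 _ (h4 _ w4).
have a2 := h2 _ w2.
have a3 := h3 _ w3.
have gb : cabs (g w - g z) <= (cabs d' + 1) * cabs (w - z).
  rewrite -(subrK (d' * (w - z)) (g w - g z)).
  apply: (le_trans (ler_cabsD _ _)); rewrite cabsM mulrDl addrC lerD2l.
  exact: a3.
have -> : f (g w) - f (g z) - d * d' * (w - z) =
  (f (g w) - f (g z) - d * (g w - g z)) + d * (g w - g z - d' * (w - z)) by ring.
apply: (le_trans (ler_cabsD _ _)); rewrite cabsM.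
have b1 : cabs (f (g w) - f (g z) - d * (g w - g z)) <= e / 2 * cabs (w - z).
  apply: (le_trans a1).
  apply: (@le_trans _ _ (e / 2 / (cabs d' + 1) * ((cabs d' + 1) * cabs (w - z)))).
    by rewrite ler_wpM2l// ltW.
  by rewrite mulrA divfK// gt_eqF.
have b2 : cabs d * cabs (g w - g z - d' * (w - z)) <= e / 2 * cabs (w - z).
  apply: (@le_trans _ _ ((cabs d + 1) * (e / 2 / (cabs d + 1) * cabs (w - z)))).
    apply: ler_pM; rewrite ?cabs_ge0//; first by rewrite lerDl.
  by rewrite mulrA (mulrC (cabs d + 1)) divfK// gt_eqF.
apply: (le_trans (lerD b1 b2)).
by rewrite -mulrDl -splitr.
Qed.

Lemma cdiffV f z : f z != 0 -> cdiff f z -> cdiff (fun w => (f w)^-1) z.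
Proof.
by move=> fz hf; apply: (@cdiff_comp GRing.inv f) => //; exact: cdiff_inv.
Qed.

(** Schwarz reflection; it lets the conjugate of [f] on a circle be rewritten as a holomorphic
    expression. *)
Lemma cdiff_conj f z : cdiff f (z^*)%C -> cdiff (fun w => ((f (w^*)%C)^*)%C) z.
Proof.
move=> [d hd]; exists (d^*)%C => e e0; have [dl dl0 h] := hd e e0.
exists dl => // w wz.
have hw : cabs ((w^*)%C - (z^*)%C) = cabs (w - z) by rewrite -rmorphB cabsJ.
have := h (w^*)%C; rewrite hw => /(_ wz).
rewrite -[X in X <= _ -> _]cabsJ !rmorphB /= rmorphM /= rmorphB /= !conjcK.
by [].
Qed.

End ComplexPlane.

(** * Goursat's theorem and the Poisson formula *)

Section Bisection.
Variable R : realType.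
Variable mu : R -> R -> R -> R -> R[i].
Variables A B C D : R.
Hypotheses (AB : A <= B) (CD : C <= D).
Hypothesis mu_split1 : forall a m b c d,
  A <= a -> a <= m -> m <= b -> b <= B -> C <= c -> c <= d -> d <= D ->
  mu a b c d = mu a m c d + mu m b c d.
Hypothesis mu_split2 : forall a b c m d,
  A <= a -> a <= b -> b <= B -> C <= c -> c <= m -> m <= d -> d <= D ->
  mu a b c d = mu a b c m + mu a b m d.
(** The bound is an arbitrarily small multiple of the squared semi-perimeter. Halving both sides
    divides that square by 4, exactly the factor lost when one quarter is kept. *)
Hypothesis mu_local : forall s0 t0 e, A <= s0 <= B -> C <= t0 <= D -> 0 < e ->
  exists2 dl, 0 < dl & forall a b c d,
    A <= a -> a <= s0 -> s0 <= b -> b <= B -> C <= c -> c <= t0 -> t0 <= d -> d <= D ->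
    b - a < dl -> d - c < dl ->
    cabs (mu a b c d) <= e * (b - a + (d - c)) ^+ 2.

Let rect : Type := (R * R * R * R)%type.
Let muq (q : rect) := let: (a, b, c, d) := q in cabs (mu a b c d).

(** The last quarter is taken untested: if each of the other three has less than a quarter of the
    total modulus, additivity and the triangle inequality force the fourth to have more. *)
Let step (q : rect) : rect := let: (a, b, c, d) := q in
  let m := (a + b) / 2 in let n := (c + d) / 2 in
  if muq q <= 4 * muq (a, m, c, n) then (a, m, c, n)
  else if muq q <= 4 * muq (a, m, n, d) then (a, m, n, d)
  else if muq q <= 4 * muq (m, b, c, n) then (m, b, c, n)
  else (m, b, n, d).

Let inside (q : rect) := let: (a, b, c, d) := q in
  [/\ A <= a, a <= b, b <= B, C <= c & c <= d /\ d <= D].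

Let step_ok (q : rect) : inside q ->
  [/\ inside (step q), muq q <= 4 * muq (step q) &
  let: (a, b, c, d) := q in let: (a', b', c', d') := step q in
  [/\ a <= a', b' <= b, c <= c' & [/\ d' <= d, b' - a' = (b - a) / 2 &
   d' - c' = (d - c) / 2]]].
Proof.
move: q => [[[a b] c] d] [Aa ab bB Cc [cd dD]].
rewrite /step.
set m := (a + b) / 2; set n := (c + d) / 2.
have am : a <= m by rewrite /m; lra.
have mb : m <= b by rewrite /m; lra.
have cn : c <= n by rewrite /n; lra.
have nd : n <= d by rewrite /n; lra.
have mB : m <= B by apply: le_trans bB.
have Am : A <= m by apply: le_trans am.
have nD : n <= D by apply: le_trans dD.
have Cn : C <= n by apply: le_trans cn.
case: ifPn => h1.
  split => //; split => //; split => //; rewrite /m /n; lra.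
case: ifPn => h2.
  split => //; split => //; split => //; rewrite /m /n; lra.
case: ifPn => h3.
  split => //; split => //; split => //; rewrite /m /n; lra.
split => //; last by split => //; split => //; rewrite /m /n; lra.
move: h1 h2 h3; rewrite -!ltNge /=.
rewrite (mu_split1 Aa am mb bB Cc cd dD).
rewrite (mu_split2 Aa am mB Cc cn nd dD) (mu_split2 Am mb bB Cc cn nd dD).
set x1 := mu a m c n; set x2 := mu a m n d; set x3 := mu m b c n; set x4 := mu m b n d.
have := ler_cabsD (x1 + x2) (x3 + x4).
have := ler_cabsD x1 x2; have := ler_cabsD x3 x4.
lra.
Qed.

(** If the value were nonzero, the nested quarters would keep at least [4^-n] of its modulus, while
    around their common point the local bound leaves less than that. *)
Lemma bisection_eq0 : mu A B C D = 0.
Proof.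
apply/eqP; rewrite -cabs_eq0 -[_ == _]negbK; apply/negP => mu0.
pose Q := fun n => iter n step (A, B, C, D).
pose qa n := (Q n).1.1.1; pose qb n := (Q n).1.1.2.
pose qc n := (Q n).1.2; pose qd n := (Q n).2.
have QE n : Q n = (qa n, qb n, qc n, qd n).
  by rewrite /qa /qb /qc /qd; case: (Q n) => [[[]]].
have inQ n : inside (Q n).
  by elim: n => [|n IH]; [split|have [] := step_ok IH].
have stepQ n : [/\ qa n <= qa n.+1, qb n.+1 <= qb n, qc n <= qc n.+1 &
    [/\ qd n.+1 <= qd n, qb n.+1 - qa n.+1 = (qb n - qa n) / 2 &
    qd n.+1 - qc n.+1 = (qd n - qc n) / 2]].
  have [_ _] := step_ok (inQ n).
  by rewrite {1}QE (_ : step (Q n) = Q n.+1)// (QE n.+1).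
have muQ n : muq (Q 0%N) <= 4 ^+ n * muq (Q n).
  elim: n => [|n IH]; first by rewrite expr0 mul1r.
  have [_ h _] := step_ok (inQ n).
  apply: (le_trans IH); rewrite exprSr -mulrA ler_wpM2l// exprn_ge0//.
have widQ n : qb n - qa n = (B - A) / 2 ^+ n /\ qd n - qc n = (D - C) / 2 ^+ n.
  elim: n => [|n [IH1 IH2]]; first by rewrite /qa /qb /qc /qd /= expr0 !divr1.
  have [_ _ _ [_ -> ->]] := stepQ n.
  by rewrite IH1 IH2 exprSr invfM !mulrA.
have na : {homo qa : m n / (m <= n)%N >-> m <= n}.
  by apply: homo_leq => [//|x y z|n]; [exact: le_trans|have [] := stepQ n].
have nb : {homo qb : m n / (m <= n)%N >-> n <= m}.
  apply: (@homo_leq _ qb (fun x y => y <= x)) => [//|x y z h1 h2|n].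
    exact: le_trans h2 h1.
  by have [] := stepQ n.
have nc : {homo qc : m n / (m <= n)%N >-> m <= n}.
  by apply: homo_leq => [//|x y z|n]; [exact: le_trans|have [] := stepQ n].
have nd : {homo qd : m n / (m <= n)%N >-> n <= m}.
  apply: (@homo_leq _ qd (fun x y => y <= x)) => [//|x y z h1 h2|n].
    exact: le_trans h2 h1.
  by have [_ _ _ []] := stepQ n.
have ab n : qa n <= qb n by have := inQ n; rewrite QE => -[].
have cd n : qc n <= qd n by have := inQ n; rewrite QE => -[_ _ _ _ []].
have abn m n : qa m <= qb n.
  apply: (le_trans (na _ _ (leq_maxl m n))); apply: (le_trans (ab _)).
  exact: nb (leq_maxr m n).
have cdn m n : qc m <= qd n.
  apply: (le_trans (nc _ _ (leq_maxl m n))); apply: (le_trans (cd _)).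
  exact: nd (leq_maxr m n).
have supP (u v : nat -> R) : (forall m n, u m <= v n) ->
    exists x, forall n, u n <= x <= v n.
  move=> uv; exists (sup (range u)) => n; apply/andP; split.
    apply: ub_le_sup; last by exists n.
    by exists (v 0%N) => _ [m _ <-].
  apply: ge_sup; first by exists (u 0%N), 0%N.
  by move=> _ [m _ <-].
have [s0 hs0] := supP _ _ abn.
have [t0 ht0] := supP _ _ cdn.
pose S := B - A + (D - C).
have eta0 : 0 < cabs (mu A B C D) by rewrite lt_def cabs_ge0 andbT.
have S0 : 0 <= S by rewrite /S addr_ge0 ?subr_ge0.
(* The [+ 1] covers [S = 0] and leaves a strict gap: the final inequality is
   [|mu| <= |mu| S^2 / (S^2 + 1)]. *)
have e0 : 0 < cabs (mu A B C D) / (S ^+ 2 + 1).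
  by rewrite divr_gt0// ltr_wpDl ?sqr_ge0.
have [] := mu_local (hs0 0%N) (ht0 0%N) e0.
move=> dl dl0 hloc.
have [n hn] : exists n, S / 2 ^+ n < dl.
  exists (Num.truncn (S / dl)).+1.
  rewrite ltr_pdivrMr ?exprn_gt0// -ltr_pdivrMl// mulrC.
  apply: (lt_le_trans (Num.Theory.truncnS_gt _)).
  by rewrite -natrX ler_nat ltnW// ltn_expl.
have pn : 0 < 2 ^+ n :> R by rewrite exprn_gt0.
have [w1 w2] := widQ n.
have [Aa _ bB Cc [_ dD]] : [/\ A <= qa n, qa n <= qb n, qb n <= B, C <= qc n & qc n <= qd n /\ qd n <= D].
  by have := inQ n; rewrite QE.
have /andP[h1 h2] := hs0 n; have /andP[h3 h4] := ht0 n.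
have wid1 : qb n - qa n < dl.
  by rewrite w1; apply: le_lt_trans hn; rewrite ler_pM2r ?invr_gt0// /S; lra.
have wid2 : qd n - qc n < dl.
  by rewrite w2; apply: le_lt_trans hn; rewrite ler_pM2r ?invr_gt0// /S; lra.
have := hloc _ _ _ _ Aa h1 h2 bB Cc h3 h4 dD wid1 wid2.
rewrite w1 w2 -mulrDl -/S => hmu.
have := muQ n; rewrite (QE n) /Q /= => hm.
have : cabs (mu A B C D) <= 4 ^+ n * (cabs (mu A B C D) / (S ^+ 2 + 1) * (S / 2 ^+ n) ^+ 2).
  by apply: (le_trans hm); rewrite ler_wpM2l// exprn_ge0.
have -> : (4 : R) ^+ n = (2 ^+ n) ^+ 2.
  by rewrite -exprM mulnC exprM; congr (_ ^+ _); ring.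
rewrite expr_div_n.
have p0 : (2 ^+ n) ^+ 2 != 0 :> R by rewrite expf_neq0// gt_eqF.
have q0 : S ^+ 2 + 1 != 0 by rewrite gt_eqF// ltr_wpDl ?sqr_ge0.
move: p0 q0; set p := (2 ^+ n) ^+ 2; set q := S ^+ 2 + 1 => p0 q0.
have -> : p * (cabs (mu A B C D) / q * (S ^+ 2 / p)) = cabs (mu A B C D) * (S ^+ 2 / q).
  by field; rewrite ?p0 ?q0.
rewrite /q.
rewrite -{1}(mulr1 (cabs (mu A B C D))) ler_pM2l// ler_pdivlMr ?mul1r; last first.
  by rewrite ltr_wpDl ?sqr_ge0.
lra.
Qed.

End Bisection.

(** * Continuity of complex-valued functions on segments *)

Section ComplexContinuity.
Variables (R : realType) (a b : R).
Implicit Types (f g : R -> R[i]) (h : R -> R).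

Definition ccts f := {within `[a, b], continuous f}.

Lemma cctsP f : ccts f <-> forall x, a <= x <= b -> forall e, 0 < e ->
  exists2 dl, 0 < dl & forall y, a <= y <= b -> `|y - x| < dl ->
    cabs (f y - f x) < e.
Proof.
split=> [/subspace_continuousP cf x xab e e0|cf].
  have /cvg_cabsP/(_ _ e0) : f @ within `[a, b] (nbhs x) --> f x.
    by apply: cf; rewrite /= in_itv.
  rewrite /within /= => /nbhs_ballP[dl /= dl0 h]; exists dl => // y yab yx.
  by apply: h => //=; rewrite /ball/= distrC.
apply/subspace_continuousP => x /=; rewrite in_itv/= => xab.
apply/cvg_cabsP => e e0; have [dl dl0 h] := cf x xab e e0.
apply/nbhs_ballP; exists dl => //= y; rewrite /ball/= distrC => yx.
by rewrite in_itv/= => yab; exact: h.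
Qed.

Lemma cctsD f g : ccts f -> ccts g -> ccts (fun x => f x + g x).
Proof. by move=> cf cg x; apply: cvgD; [exact: cf|exact: cg]. Qed.

Lemma cctsN f : ccts f -> ccts (fun x => - f x).
Proof. by move=> cf x; apply: cvgN; exact: cf. Qed.

Lemma cctsB f g : ccts f -> ccts g -> ccts (fun x => f x - g x).
Proof. by move=> cf cg; exact: (cctsD cf (cctsN cg)). Qed.

Lemma cctsM f g : ccts f -> ccts g -> ccts (fun x => f x * g x).
Proof. by move=> cf cg x; apply: cvgM; [exact: cf|exact: cg]. Qed.

Lemma ccts_cst (c : R[i]) : ccts (fun _ => c).
Proof. by move=> x; exact: cvg_cst. Qed.

Lemma ccts_comp (F : R[i] -> R[i]) f : ccts f ->
  (forall x, a <= x <= b -> cdiff F (f x)) -> ccts (F \o f).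
Proof.
move=> /cctsP cf cF; apply/cctsP => x xab e e0.
have [d1 d10 h1] := cdiff_continuous (cF x xab) e0.
have [d2 d20 h2] := cf x xab d1 d10.
by exists d2 => // y yab yx; apply: h1; exact: h2.
Qed.

Lemma ccts_Re f : ccts f -> {within `[a, b], continuous (fun x => complex.Re (f x))}.
Proof.
move=> /cctsP cf; apply/subspace_continuousP => x /=; rewrite in_itv/= => xab.
apply/cvgrPdist_lt => e e0; have [dl dl0 h] := cf x xab e e0.
apply/nbhs_ballP; exists dl => //= y; rewrite /ball/= distrC => yx.
rewrite in_itv/= => yab; rewrite distrC; apply: le_lt_trans (h y yab yx).
by rewrite -raddfB ler_Re_cabs.
Qed.

Lemma ccts_Im f : ccts f -> {within `[a, b], continuous (fun x => complex.Im (f x))}.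
Proof.
move=> /cctsP cf; apply/subspace_continuousP => x /=; rewrite in_itv/= => xab.
apply/cvgrPdist_lt => e e0; have [dl dl0 h] := cf x xab e e0.
apply/nbhs_ballP; exists dl => //= y; rewrite /ball/= distrC => yx.
rewrite in_itv/= => yab; rewrite distrC; apply: le_lt_trans (h y yab yx).
by rewrite -raddfB ler_Im_cabs.
Qed.

Lemma ccts_cabs f : ccts f -> {within `[a, b], continuous (fun x => cabs (f x))}.
Proof.
move=> /cctsP cf; apply/subspace_continuousP => x /=; rewrite in_itv/= => xab.
apply/cvgrPdist_lt => e e0; have [dl dl0 h] := cf x xab e e0.
apply/nbhs_ballP; exists dl => //= y; rewrite /ball/= distrC => yx.
rewrite in_itv/= => yab; rewrite distrC; apply: le_lt_trans (h y yab yx).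
exact: ler_dist_cabs.
Qed.

Lemma ccts_conj f : ccts f -> ccts (fun x => ((f x)^*)%C).
Proof.
move=> /cctsP cf; apply/cctsP => x xab e e0; have [dl dl0 h] := cf x xab e e0.
by exists dl => // y yab yx; rewrite -rmorphB cabsJ; exact: h.
Qed.

Lemma ccts_ReIm h1 h2 : {within `[a, b], continuous h1} -> {within `[a, b], continuous h2} ->
  ccts (fun x => (h1 x +i* h2 x)%C).
Proof.
move=> /subspace_continuousP c1 /subspace_continuousP c2; apply/subspace_continuousP => x xab.
apply/cvg_cabsP => e e0; have e2 : 0 < e / 2 by rewrite divr_gt0.
have /cvgrPdist_lt/(_ _ e2) h1x := c1 x xab.
have /cvgrPdist_lt/(_ _ e2) h2x := c2 x xab.
have FF : Filter (within `[a, b] (nbhs x)) by exact: within_filter.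
near=> y; apply: le_lt_trans (ler_cabs_ReIm _) _ => /=.
rewrite (splitr e) ltrD//.
  by rewrite distrC; near: y.
by rewrite distrC; near: y.
Unshelve. all: by end_near. Qed.

End ComplexContinuity.

(** * Lipschitz bounds for the exponentials *)

Section ExpCurve.
Variable R : realType.

Lemma expi_Lipschitz (s t : R) : cabs (expi s - expi t) <= 2 * `|s - t|.
Proof.
wlog st : s t / t < s.
  move=> H; case: (ltgtP s t) => [ts|ts|->]; last by rewrite !subrr cabs0 normr0 mulr0.
    by rewrite cabsBC distrC H.
  exact: H.
apply: (le_trans (ler_cabs_ReIm _)) => /=.
have -> : forall x : R, 2 * x = x + x by move=> x; ring.
apply: lerD.
  have [|c _ ->] := @MVT R cos (fun x => - sin x) t s st.
  - by apply: continuous_subspaceT => x; exact: continuous_cos.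
  rewrite normrM ler_piMl// normrN ler_norml.
  by rewrite sin_geN1 sin_le1.
have [|c _ ->] := @MVT R sin cos t s st.
- by apply: continuous_subspaceT => x; exact: continuous_sin.
by rewrite normrM ler_piMl// ler_norml cos_geN1 cos_le1.
Qed.

Lemma ccts_expi (a b : R) : ccts a b (@expi R).
Proof.
apply/cctsP => x _ e e0; exists (e / 2); first by rewrite divr_gt0.
move=> y _ yx; apply: (le_lt_trans (expi_Lipschitz _ _)).
by rewrite mulrC -ltr_pdivlMr.
Qed.

Lemma expR_Lipschitz (s t m : R) : s <= m -> t <= m -> `|expR s - expR t| <= expR m * `|s - t|.
Proof.
wlog st : s t / t < s.
  move=> H sm tm; case: (ltgtP s t) => [ts|ts|->]; last by rewrite !subrr normr0 mulr0.
    by rewrite distrC (distrC s) H.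
  exact: H.
move=> sm tm; have [|c + ->] := @MVT R expR expR t s st.
- by apply: continuous_subspaceT => x; exact: continuous_expR.
rewrite in_itv/= => /andP[tc cs].
rewrite normrM ler_wpM2r// ger0_norm ?expR_ge0// ler_expR.
by apply: le_trans sm; exact: ltW.
Qed.

End ExpCurve.

(** * Real and complex integrals over segments *)

Section Integrals.
Variable R : realType.
Implicit Types (a b c m M : R) (h g : R -> R) (F G : R -> R[i]).
Notation mu := (@lebesgue_measure R).

Definition rint a b h : R := \int[mu]_(t in `[a, b]) h t.

Definition cint a b F : R[i] :=
  (rint a b (fun t => complex.Re (F t)) +i* rint a b (fun t => complex.Im (F t)))%C.

Lemma cts_integrable a b h : {within `[a, b], continuous h} ->
  mu.-integrable `[a, b] (EFin \o h).
Proof.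
by move=> ch; apply: continuous_compact_integrable => //; exact: segment_compact.
Qed.

Lemma rintD a b h g : {within `[a, b], continuous h} -> {within `[a, b], continuous g} ->
  rint a b (fun t => h t + g t) = rint a b h + rint a b g.
Proof. by move=> ch cg; rewrite /rint RintegralD//; exact: cts_integrable. Qed.

Lemma rintB a b h g : {within `[a, b], continuous h} -> {within `[a, b], continuous g} ->
  rint a b (fun t => h t - g t) = rint a b h - rint a b g.
Proof. by move=> ch cg; rewrite /rint RintegralB//; exact: cts_integrable. Qed.

Lemma rintZ a b c h : {within `[a, b], continuous h} ->
  rint a b (fun t => c * h t) = c * rint a b h.
Proof. by move=> ch; rewrite /rint RintegralZl//; exact: cts_integrable. Qed.

Lemma rint_cst a b c : a <= b -> rint a b (fun _ => c) = c * (b - a).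
Proof.
move=> ab; rewrite /rint Rintegral_cst//= lebesgue_measure_itv/= lte_fin.
case: ltP => //= ba; have -> : a = b by apply/eqP; rewrite eq_le ab ba.
by rewrite subrr.
Qed.

Lemma eq_rint a b h g : (forall t, a <= t <= b -> h t = g t) -> rint a b h = rint a b g.
Proof.
move=> hg; apply: eq_Rintegral => t; rewrite inE/= in_itv/=; exact: hg.
Qed.

Lemma le_rint a b h g : {within `[a, b], continuous h} -> {within `[a, b], continuous g} ->
  (forall t, a <= t <= b -> h t <= g t) -> rint a b h <= rint a b g.
Proof.
move=> ch cg hg; apply: le_Rintegral.
- by [].
- exact: cts_integrable.
- exact: cts_integrable.
- by move=> t /=; rewrite in_itv/=; exact: hg.
Qed.

Lemma rint_ge0 a b h : (forall t, a <= t <= b -> 0 <= h t) -> 0 <= rint a b h.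
Proof. by move=> h0; apply: Rintegral_ge0 => t /=; rewrite in_itv/=; exact: h0. Qed.

Lemma ler_norm_rint a b h : {within `[a, b], continuous h} ->
  `|rint a b h| <= rint a b (fun t => `|h t|).
Proof. by move=> ch; apply: le_normr_Rintegral => //; exact: cts_integrable. Qed.

Lemma rint_split a m b h : {within `[a, b], continuous h} -> a <= m -> m <= b ->
  rint a b h = rint a m h + rint m b h.
Proof.
move=> ch am mb.
have := @Rintegral_itvB R h (BLeft a) (BRight b) m (cts_integrable ch).
rewrite !bnd_simp => /(_ am mb).
rewrite Rintegral_itv_obnd_cbnd; last first.
  apply: integrableS (cts_integrable ch) => //.
  by move=> x /=; rewrite !in_itv/= => /andP[mx ->]; rewrite (le_trans am (ltW mx)).
by rewrite /rint => <-; rewrite addrC subrK.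
Qed.

Lemma rint_FTC2 a b h (H : R -> R) : a <= b -> {within `[a, b], continuous h} ->
  (forall x : R, is_derive x (1 : R) H (h x)) -> rint a b h = H b - H a.
Proof.
rewrite le_eqVlt => /predU1P[-> _ _|ab ch dH].
  by rewrite subrr /rint set_itv1 Rintegral_set1.
rewrite /rint /Rintegral (@continuous_FTC2 _ _ H)//.
  split.
  - by move=> x _; apply: ex_derive.
  - apply: cvg_at_right_filter; apply: differentiable_continuous; apply/derivable1_diffP; exact: ex_derive.
  - apply: cvg_at_left_filter; apply: differentiable_continuous; apply/derivable1_diffP; exact: ex_derive.
by move=> x _; rewrite derive1E; exact: derive_val.
Qed.

Lemma eq_cint a b F G : (forall t, a <= t <= b -> F t = G t) -> cint a b F = cint a b G.
Proof.
by move=> FG; rewrite /cint; congr (_ +i* _)%C; apply: eq_rint => t tab; rewrite FG.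
Qed.

Lemma cintD a b F G : ccts a b F -> ccts a b G ->
  cint a b (fun t => F t + G t) = cint a b F + cint a b G.
Proof.
move=> cF cG; rewrite /cint.
under eq_rint do rewrite raddfD; under [X in (_ +i* X)%C]eq_rint do rewrite raddfD.
by rewrite !rintD//; [exact: ccts_Im|exact: ccts_Im|exact: ccts_Re|exact: ccts_Re].
Qed.

Lemma cintN a b F : ccts a b F -> cint a b (fun t => - F t) = - cint a b F.
Proof.
move=> cF; apply/eqP; rewrite -addr_eq0 -(cintD (cctsN cF) cF).
apply/eqP; rewrite (@eq_cint _ _ _ (fun _ => 0)); last by move=> t _; rewrite addNr.
by rewrite /cint /rint /Rintegral !integral0.
Qed.

Lemma cintB a b F G : ccts a b F -> ccts a b G ->
  cint a b (fun t => F t - G t) = cint a b F - cint a b G.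
Proof.
by move=> cF cG; rewrite (cintD cF (cctsN cG)) cintN.
Qed.

Lemma cintZ a b (k : R[i]) F : ccts a b F ->
  cint a b (fun t => k * F t) = k * cint a b F.
Proof.
move=> cF; have [cR cI] := (ccts_Re cF, ccts_Im cF); case: k => p q; rewrite /cint.
have cZ c h : {within `[a, b], continuous h} -> {within `[a, b], continuous (fun t => c * h t)}.
  by move=> ch x; apply: cvgM; [exact: cvg_cst|exact: ch].
rewrite (@eq_rint _ _ _ (fun t => p * complex.Re (F t) - q * complex.Im (F t))); last first.
  by move=> t _; case: (F t).
rewrite [X in (_ +i* X)%C](@eq_rint _ _ _ (fun t => p * complex.Im (F t) + q * complex.Re (F t))); last first.
  by move=> t _; case: (F t).
rewrite rintB ?rintD ?rintZ//; exact: cZ.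
Qed.

Lemma cint_split a m b F : ccts a b F -> a <= m -> m <= b ->
  cint a b F = cint a m F + cint m b F.
Proof.
move=> cF am mb; rewrite /cint (rint_split (ccts_Re cF) am mb).
by rewrite (rint_split (ccts_Im cF) am mb).
Qed.

Lemma cint_cst a b (k : R[i]) : a <= b -> cint a b (fun _ => k) = k * ((b - a)%:C)%C.
Proof.
move=> ab; rewrite /cint !rint_cst//; case: k => p q /=.
by apply/eqP; rewrite eq_complex/=; apply/andP; split; apply/eqP; ring.
Qed.

Lemma rint0 a b : rint a b (fun _ => 0) = 0.
Proof. by rewrite /rint /Rintegral integral0. Qed.

Lemma cint_real a b h : cint a b (fun t => (h t)%:C)%C = ((rint a b h)%:C)%C.
Proof. by rewrite /cint /= rint0. Qed.

Lemma cint_conj a b F : ccts a b F -> cint a b (fun t => (F t)^*)%C = ((cint a b F)^*)%C.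
Proof.
move=> cF; rewrite /cint /=.
rewrite (@eq_rint _ _ _ (fun t => complex.Re (F t))); last by move=> t _; case: (F t).
rewrite [X in (_ +i* X)%C](@eq_rint _ _ _ (fun t => -1 * complex.Im (F t))); last first.
  by move=> t _; rewrite mulN1r; case: (F t).
by rewrite rintZ ?mulN1r//; exact: ccts_Im.
Qed.

(** The modulus is at most the sum of the moduli of the two components, each bounded by the integral
    of [cabs (F t)]. This factor 2 is the reason for [pi] in place of [2 * pi] in
    [poisson_cabs_le]. *)
Lemma ler_cabs_cint a b F : ccts a b F ->
  cabs (cint a b F) <= 2 * rint a b (fun t => cabs (F t)).
Proof.
move=> cF; apply: (le_trans (ler_cabs_ReIm _)) => /=.
rewrite (_ : forall x : R, 2 * x = x + x); last by move=> x; ring.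
have cn h : {within `[a, b], continuous h} -> {within `[a, b], continuous (fun t => `|h t|)}.
  by move=> ch x; apply: cvg_norm; exact: ch.
have [[cR cI] cA] := (ccts_Re cF, ccts_Im cF, ccts_cabs cF).
apply: lerD.
  apply: (le_trans (ler_norm_rint cR)); apply: le_rint => //; first exact: cn.
  by move=> t _; exact: ler_Re_cabs.
apply: (le_trans (ler_norm_rint cI)); apply: le_rint => //; first exact: cn.
by move=> t _; exact: ler_Im_cabs.
Qed.

Lemma cint_bound a b F M : a <= b -> ccts a b F -> (forall t, a <= t <= b -> cabs (F t) <= M) ->
  cabs (cint a b F) <= 2 * M * (b - a).
Proof.
move=> ab cF FM; apply: (le_trans (ler_cabs_cint cF)).
rewrite -mulrA ler_pM2l// -rint_cst//; apply: le_rint => //; first exact: ccts_cabs.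
by move=> x; exact: cvg_cst.
Qed.

Lemma cint_expi c d : c <= d -> cint c d (fun t => 'i%C * expi t) = expi d - expi c.
Proof.
move=> cd; rewrite /cint.
rewrite (@eq_rint _ _ _ (fun t => - sin t)); last by move=> t _ /=; ring.
rewrite [X in (_ +i* X)%C](@eq_rint _ _ _ cos); last by move=> t _ /=; ring.
rewrite (@rint_FTC2 _ _ _ cos)//; last first.
  apply: continuous_subspaceT => x; apply: cvgN; exact: continuous_sin.
rewrite (@rint_FTC2 _ _ cos sin)//.
by apply: continuous_subspaceT => x; exact: continuous_cos.
Qed.

Lemma rint_expR a b : a <= b -> rint a b expR = expR b - expR a.
Proof.
move=> ab; rewrite (@rint_FTC2 _ _ _ expR)//.
by apply: continuous_subspaceT => x; exact: continuous_expR.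
Qed.

End Integrals.

(** * Goursat's theorem in exponential coordinates about an interior point *)

Section Goursat.
Variable R : realType.
Implicit Types (a b c d s t : R) (z : R[i]) (T : R[i] -> R[i]).

Definition gam z t : R[i] := expi t - z.
(** At [s = 0] this runs along the unit circle, and as [s] tends to [-oo] the curve shrinks to [z].
    In these coordinates [d zeta / (zeta - z)] is [ds] in the direction of [s] and [wt z t dt] in
    the direction of [t], so the pole at [z] disappears. *)
Definition Phi z s t : R[i] := z + ((expR s)%:C)%C * gam z t.
Definition wt z t : R[i] := 'i%C * expi t / gam z t.

Lemma gam_lb z t : 1 - cabs z <= cabs (gam z t).
Proof. by have := ler_cabsD (gam z t) z; rewrite subrK cabs_expi; lra. Qed.

Lemma gam_ub z t : cabs z < 1 -> cabs (gam z t) <= 2.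
Proof. by move=> z1; have := ler_cabsB (expi t) z; rewrite cabs_expi /gam; lra. Qed.

Lemma gam_neq0 z t : cabs z < 1 -> gam z t != 0.
Proof.
move=> z1; rewrite -cabs_gt0; apply: lt_le_trans (gam_lb z t).
by rewrite subr_gt0.
Qed.

Lemma cabs_i : cabs ('i%C : R[i]) = 1.
Proof. by rewrite cabsE /= expr0n add0r expr1n sqrtr1. Qed.

Lemma wt_ub z t : cabs z < 1 -> cabs (wt z t) <= (1 - cabs z)^-1.
Proof.
move=> z1; rewrite /wt !cabsM cabs_i cabs_expi !mul1r cabsV.
rewrite lef_pV2 ?gam_lb// posrE ?subr_gt0// cabs_gt0.
exact: gam_neq0.
Qed.

Lemma ccts_gam a b z : ccts a b (gam z).
Proof. by apply: cctsB; [exact: ccts_expi|exact: ccts_cst]. Qed.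

Lemma ccts_wt a b z : cabs z < 1 -> ccts a b (wt z).
Proof.
move=> z1; apply: cctsM; first by apply: cctsM; [exact: ccts_cst|exact: ccts_expi].
apply: (@ccts_comp _ _ _ GRing.inv (gam z)); first exact: ccts_gam.
by move=> t _; apply: cdiff_inv; exact: gam_neq0.
Qed.

Lemma Phi_Lipschitz z s t s' t' m : cabs z < 1 -> s <= m -> s' <= m ->
  cabs (Phi z s t - Phi z s' t') <= 2 * expR m * (`|s - s'| + `|t - t'|).
Proof.
move=> z1 sm sm'.
have -> : Phi z s t - Phi z s' t' =
    ((expR s - expR s')%:C)%C * gam z t + ((expR s')%:C)%C * (expi t - expi t').
  by rewrite /Phi /gam rmorphB; ring.
apply: (le_trans (ler_cabsD _ _)); rewrite !cabsM !cabs_real.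
rewrite mulrDr; apply: lerD.
  have h := expR_Lipschitz sm sm'.
  rewrite (_ : 2 * expR m * `|s - s'| = (expR m * `|s - s'|) * 2); last by ring.
  by apply: ler_pM => //; [exact: cabs_ge0|exact: gam_ub].
rewrite (_ : 2 * expR m * `|t - t'| = expR m * (2 * `|t - t'|)); last by ring.
apply: ler_pM => //; [exact: cabs_ge0| |exact: expi_Lipschitz].
by rewrite ger0_norm ?expR_ge0// ler_expR.
Qed.

Lemma ccts_Phi1 a b z t : cabs z < 1 -> ccts a b (fun s => Phi z s t).
Proof.
move=> z1; apply/cctsP => x /andP[_ xb] e e0; exists (e / (2 * expR b)).
  by rewrite divr_gt0// mulr_gt0// expR_gt0.
move=> y /andP[_ yb] yx; apply: (le_lt_trans (Phi_Lipschitz t t z1 yb xb)).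
by rewrite subrr normr0 addr0 mulrC -ltr_pdivlMr// mulr_gt0// expR_gt0.
Qed.

Lemma ccts_Phi2 a b z s : cabs z < 1 -> ccts a b (Phi z s).
Proof.
move=> z1; apply/cctsP => x _ e e0; exists (e / (2 * expR s)).
  by rewrite divr_gt0// mulr_gt0// expR_gt0.
move=> y _ yx; apply: (le_lt_trans (Phi_Lipschitz y x z1 (lexx s) (lexx s))).
by rewrite subrr normr0 add0r mulrC -ltr_pdivlMr// mulr_gt0// expR_gt0.
Qed.

(** The integral of [T(zeta) / (zeta - z)] along the image under [Phi z] of the boundary of [[a, b]
    x [c, d]], oriented counterclockwise in the [(s, t)] plane, with opposite sides grouped
    together. *)
Definition contour T z a b c d : R[i] :=
  cint a b (fun s => T (Phi z s c) - T (Phi z s d))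
  + cint c d (fun t => (T (Phi z b t) - T (Phi z a t)) * wt z t).

Section Contour.
Variables (T : R[i] -> R[i]) (z : R[i]) (A B C D : R).
Hypotheses (z1 : cabs z < 1) (AB : A <= B) (CD : C <= D).
Hypothesis dT : forall s t, A <= s <= B -> C <= t <= D -> cdiff T (Phi z s t).

Let cT1 a b t : A <= a -> b <= B -> C <= t <= D -> ccts a b (fun s => T (Phi z s t)).
Proof.
move=> Aa bB tCD; apply: (@ccts_comp _ _ _ T (fun s => Phi z s t)).
  exact: ccts_Phi1.
move=> s /andP[as_ sb]; apply: dT => //.
by rewrite (le_trans Aa as_) (le_trans sb bB).
Qed.

Let cT2 c d s : C <= c -> d <= D -> A <= s <= B -> ccts c d (fun t => T (Phi z s t)).
Proof.
move=> Cc dD sAB; apply: (@ccts_comp _ _ _ T (fun t => Phi z s t)).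
  exact: ccts_Phi2.
move=> t /andP[ct td]; apply: dT => //.
by rewrite (le_trans Cc ct) (le_trans td dD).
Qed.

Let cT2w c d s s' : C <= c -> d <= D -> A <= s <= B -> A <= s' <= B ->
  ccts c d (fun t => (T (Phi z s t) - T (Phi z s' t)) * wt z t).
Proof.
move=> Cc dD sAB sAB'; apply: cctsM; last exact: ccts_wt.
exact: (cctsB (cT2 Cc dD sAB) (cT2 Cc dD sAB')).
Qed.

Let split1 a m b c d :
  A <= a -> a <= m -> m <= b -> b <= B -> C <= c -> c <= d -> d <= D ->
  contour T z a b c d = contour T z a m c d + contour T z m b c d.
Proof.
move=> Aa am mb bB Cc cd dD; rewrite /contour.
have cCD : C <= c <= D by rewrite Cc (le_trans cd dD).
have dCD : C <= d <= D by rewrite dD (le_trans Cc cd).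
have aAB : A <= a <= B by rewrite Aa (le_trans am) ?(le_trans mb).
have mAB : A <= m <= B by rewrite (le_trans Aa am) (le_trans mb bB).
have bAB : A <= b <= B by rewrite bB (le_trans Aa) ?(le_trans am).
rewrite (cint_split (cctsB (cT1 Aa bB cCD) (cT1 Aa bB dCD)) am mb).
pose F t := (T (Phi z m t) - T (Phi z a t)) * wt z t.
pose G t := (T (Phi z b t) - T (Phi z m t)) * wt z t.
have cF : ccts c d F := cT2w Cc dD mAB aAB.
have cG : ccts c d G := cT2w Cc dD bAB mAB.
rewrite (@eq_cint _ c d _ (fun t => F t + G t)); last by move=> t _; rewrite /F /G; ring.
by rewrite (cintD cF cG) addrACA.
Qed.

Let split2 a b c m d :
  A <= a -> a <= b -> b <= B -> C <= c -> c <= m -> m <= d -> d <= D ->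
  contour T z a b c d = contour T z a b c m + contour T z a b m d.
Proof.
move=> Aa ab bB Cc cm md dD; rewrite /contour.
have cCD : C <= c <= D by rewrite Cc (le_trans cm) ?(le_trans md).
have mCD : C <= m <= D by rewrite (le_trans Cc cm) (le_trans md dD).
have dCD : C <= d <= D by rewrite dD (le_trans Cc) ?(le_trans cm).
have aAB : A <= a <= B by rewrite Aa (le_trans ab).
have bAB : A <= b <= B by rewrite bB (le_trans Aa).
rewrite (cint_split (cT2w Cc dD bAB aAB) cm md).
rewrite (@eq_cint _ a b _ (fun s => (T (Phi z s c) - T (Phi z s m))
   + (T (Phi z s m) - T (Phi z s d)))); last by move=> t _; ring.
rewrite (cintD (cctsB (cT1 Aa bB cCD) (cT1 Aa bB mCD)) (cctsB (cT1 Aa bB mCD) (cT1 Aa bB dCD))).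
ring.
Qed.

(** Subtract from [T] its first-order expansion at [Phi z s0 t0]. Its constant part drops out of
    each difference, the integrals of its linear part, [G1] and [G2], cancel exactly, and the
    remainder is a small multiple of the diameter integrated over sides of comparable length. *)
Let local s0 t0 e : A <= s0 <= B -> C <= t0 <= D -> 0 < e ->
  exists2 dl, 0 < dl & forall a b c d,
    A <= a -> a <= s0 -> s0 <= b -> b <= B -> C <= c -> c <= t0 -> t0 <= d -> d <= D ->
    b - a < dl -> d - c < dl ->
    cabs (contour T z a b c d) <= e * (b - a + (d - c)) ^+ 2.
Proof.
move=> sAB tCD e0.
pose L := 2 * expR B; pose W := (1 - cabs z)^-1.
have L0 : 0 < L by rewrite mulr_gt0// expR_gt0.
have W0 : 0 < W by rewrite invr_gt0 subr_gt0.
have W1 : 0 < 1 + W by apply: addr_gt0.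
have K0 : 0 < 4 * L * (1 + W) by apply: mulr_gt0 => //; apply: mulr_gt0.
have [k hk] := dT sAB tCD.
(* In [4 * L * (1 + W)], one factor 2 comes from the complex integral, another from the difference
   of two remainders, [L] from the Lipschitz bound on [Phi], and [1 + W] covers both the unweighted
   sides and those weighted by [wt]. *)
have [|dl dl0 {}hk] := hk (e / (4 * L * (1 + W))); first by rewrite divr_gt0.
set e' := e / (4 * L * (1 + W)) in hk.
have e'0 : 0 < e' by rewrite divr_gt0.
(* Two sides below [dl / (2 * L)] give [L * dd < dl], so the whole image stays where the expansion
   of [T] holds. *)
exists (dl / (2 * L)); first by rewrite divr_gt0// mulr_gt0.
move=> a b c d Aa as0 s0b bB Cc ct0 t0d dD wab wcd.
set ze := Phi z s0 t0 in hk.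
set dd := b - a + (d - c).
have cCD : C <= c <= D by rewrite Cc (le_trans ct0)//; case/andP: tCD.
have dCD : C <= d <= D by rewrite dD (le_trans _ t0d)//; case/andP: tCD.
have aAB : A <= a <= B by rewrite Aa (le_trans as0)//; case/andP: sAB.
have bAB : A <= b <= B by rewrite bB (le_trans _ s0b)//; case/andP: sAB.
have ab := le_trans as0 s0b; have cd := le_trans ct0 t0d.
have dd0 : 0 <= dd by rewrite addr_ge0 ?subr_ge0.
have rho s t : a <= s <= b -> c <= t <= d ->
    cabs (T (Phi z s t) - T ze - k * (Phi z s t - ze)) <= e' * (L * dd).
  move=> /andP[as_ sb] /andP[ct td].
  have near : cabs (Phi z s t - ze) <= L * dd.
    have sB : s <= B by apply: le_trans bB.
    have s0B : s0 <= B by case/andP: sAB.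
    apply: (le_trans (Phi_Lipschitz t t0 z1 sB s0B)).
    rewrite ler_pM2l// /dd; apply: lerD; rewrite ler_norml; apply/andP; split; lra.
  apply: (@le_trans _ _ (e' * cabs (Phi z s t - ze))); last by rewrite ler_pM2l.
  apply: hk; apply: (le_lt_trans near).
  rewrite mulrC -ltr_pdivlMr// /dd.
  have : dl / (2 * L) + dl / (2 * L) = dl / L by field; rewrite gt_eqF.
  lra.
have near2 (p q u v : R[i]) : cabs (p - u) <= e' * (L * dd) -> cabs (q - v) <= e' * (L * dd) ->
    cabs (p - q - (u - v)) <= 2 * (e' * (L * dd)).
  move=> h1 h2; have -> : p - q - (u - v) = (p - u) - (q - v) by ring.
  apply: (le_trans (ler_cabsB _ _)); lra.
pose F1 s := T (Phi z s c) - T (Phi z s d).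
pose G1 s := k * (expi c - expi d) * ((expR s)%:C)%C.
pose F2 t := (T (Phi z b t) - T (Phi z a t)) * wt z t.
pose G2 t := k * ((expR b - expR a)%:C)%C * ('i%C * expi t).
have cER : ccts a b (fun s => (expR s)%:C)%C.
  apply: ccts_ReIm; last by move=> x; exact: cvg_cst.
  by apply: continuous_subspaceT => x; exact: continuous_expR.
have cG1 : ccts a b G1 by apply: cctsM; [exact: ccts_cst|exact: cER].
have cI : ccts c d (fun t => 'i%C * expi t : R[i]).
  by apply: cctsM; [exact: ccts_cst|exact: ccts_expi].
have cG2 : ccts c d G2 by apply: cctsM; [exact: ccts_cst|exact: cI].
have i1 : cint a b G1 = k * (expi c - expi d) * ((expR b - expR a)%:C)%C.
  by rewrite /G1 (cintZ _ cER) cint_real rint_expR.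
have i2 : cint c d G2 = k * ((expR b - expR a)%:C)%C * (expi d - expi c).
  by rewrite /G2 (cintZ _ cI) cint_expi.
have cF1 : ccts a b F1 := cctsB (cT1 Aa bB cCD) (cT1 Aa bB dCD).
have cF2 : ccts c d F2 := cT2w Cc dD bAB aAB.
have -> : contour T z a b c d =
    cint a b (fun s => F1 s - G1 s) + cint c d (fun t => F2 t - G2 t).
  rewrite (cintB cF1 cG1) (cintB cF2 cG2) i1 i2 -[contour _ _ _ _ _ _]/(cint a b F1 + cint c d F2).
  by move: (cint _ _ _) (cint _ _ _) => p q; ring.
apply: (le_trans (ler_cabsD _ _)).
have b1 : cabs (cint a b (fun s => F1 s - G1 s)) <= 2 * (2 * (e' * (L * dd))) * (b - a).
  apply: (cint_bound ab (cctsB cF1 cG1)) => s sab.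
  have -> : F1 s - G1 s = T (Phi z s c) - T (Phi z s d) -
    ((T ze + k * (Phi z s c - ze)) - (T ze + k * (Phi z s d - ze))).
    by rewrite /F1 /G1 /Phi /gam; ring.
  by apply: near2; rewrite opprD addrA; apply: rho; rewrite // ?lexx cd.
have b2 : cabs (cint c d (fun t => F2 t - G2 t)) <= 2 * (2 * (e' * (L * dd)) * W) * (d - c).
  apply: (cint_bound cd (cctsB cF2 cG2)) => t tcd.
  have -> : F2 t - G2 t
    = (T (Phi z b t) - T (Phi z a t) - ((T ze + k * (Phi z b t - ze)) - (T ze + k * (Phi z a t - ze)))) * wt z t.
    by rewrite /F2 /G2 /Phi /wt rmorphB /=; field; exact: gam_neq0.
  rewrite cabsM; apply: ler_pM; rewrite ?cabs_ge0//; last exact: wt_ub.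
  by apply: near2; rewrite opprD addrA; apply: rho; rewrite // ?lexx ab.
apply: (le_trans (lerD b1 b2)).
have -> : e = e' * (4 * L * (1 + W)) by rewrite /e' divfK// gt_eqF.
rewrite -subr_ge0.
have -> : e' * (4 * L * (1 + W)) * dd ^+ 2 - (2 * (2 * (e' * (L * dd))) * (b - a) + 2 * (2 * (e' * (L * dd)) * W) * (d - c))
   = 4 * e' * L * dd * ((d - c) + W * (b - a)) by rewrite /dd; ring.
have e'L : 0 <= 4 * e' * L by apply: mulr_ge0; [apply: mulr_ge0|]; rewrite // ltW.
apply: mulr_ge0; first exact: mulr_ge0.
by apply: addr_ge0; rewrite ?subr_ge0//; apply: mulr_ge0; rewrite ?subr_ge0// ltW.
Qed.

Lemma contour_eq0 : contour T z A B C D = 0.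
Proof. exact: (bisection_eq0 AB CD split1 split2 local). Qed.

End Contour.

(** The sides [t = c] and [t = c + 2 * pi] have the same image and cancel; the vanishing contour
    integral then compares the two closed curves. *)
Lemma circle_mean_cst T z c a b : cabs z < 1 -> a <= b ->
  (forall s t, a <= s <= b -> cdiff T (Phi z s t)) ->
  cint c (c + 2 * pi) (fun t => T (Phi z a t) * wt z t) =
  cint c (c + 2 * pi) (fun t => T (Phi z b t) * wt z t).
Proof.
move=> z1 ab dT.
have pi0 : c <= c + 2 * pi by rewrite lerDl mulr_ge0// pi_ge0.
have h := @contour_eq0 T z a b c (c + 2 * pi) z1 ab pi0 (fun s t hs _ => dT s t hs).
have h1 : cint a b (fun s => T (Phi z s c) - T (Phi z s (c + 2 * pi))) = 0.
  rewrite (@eq_cint _ a b _ (fun _ => 0)); last first.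
    by move=> s _; rewrite /Phi /gam expi_periodic subrr.
  by rewrite /cint rint0.
pose F s t := T (Phi z s t) * wt z t.
have cT s : a <= s <= b -> ccts c (c + 2 * pi) (F s).
  move=> hs; apply: cctsM; last exact: ccts_wt.
  apply: (@ccts_comp _ _ _ T (Phi z s)); first exact: ccts_Phi2.
  by move=> t _; exact: dT.
have ha : a <= a <= b by rewrite ab lexx.
have hb : a <= b <= b by rewrite ab lexx.
have h2 : cint c (c + 2 * pi) (fun t => (T (Phi z b t) - T (Phi z a t)) * wt z t) =
    cint c (c + 2 * pi) (F b) - cint c (c + 2 * pi) (F a).
  rewrite -(cintB (cT b hb) (cT a ha)); apply: eq_cint => t _.
  by rewrite /F mulrBl.
have : 0 + (cint c (c + 2 * pi) (F b) - cint c (c + 2 * pi) (F a)) = 0.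
  by move: h; rewrite /contour h1 h2.
rewrite -/(F a) -/(F b); move: (cint _ _ (F b)) (cint _ _ (F a)) => p q.
by rewrite add0r => /eqP; rewrite subr_eq0 => /eqP.
Qed.

End Goursat.

(** * Cauchy's formula, the mean value property and Poisson's formula *)

Section Poisson.
Variable R : realType.
Implicit Types (a b c d s t : R) (z w : R[i]) (T f : R[i] -> R[i]).

Lemma conjcB z w : ((z - w)^*)%C = ((z^*)%C - (w^*)%C).
Proof. exact: rmorphB. Qed.

Lemma conjcM z w : ((z * w)^*)%C = ((z^*)%C * (w^*)%C).
Proof. exact: rmorphM. Qed.

Lemma Phi_disc z s t : cabs z < 1 -> s <= 0 -> cabs (Phi z s t) <= 1.
Proof.
move=> z1 s0; have e1 : expR s <= 1 by rewrite -expR0 ler_expR.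
have e0 : 0 <= expR s by exact: expR_ge0.
have -> : Phi z s t = ((1 - expR s)%:C)%C * z + ((expR s)%:C)%C * expi t.
  by rewrite /Phi /gam rmorphB rmorph1; ring.
apply: (le_trans (ler_cabsD _ _)); rewrite !cabsM !cabs_real cabs_expi mulr1.
rewrite !ger0_norm ?subr_ge0//.
have : (1 - expR s) * cabs z <= 1 - expR s by rewrite ler_piMr ?subr_ge0// ltW.
lra.
Qed.

Lemma Phi0 z t : Phi z 0 t = expi t.
Proof. by rewrite /Phi expR0 /gam mul1r addrC subrK. Qed.

Lemma cabs_Phi_sub z s t : cabs z < 1 -> cabs (Phi z s t - z) <= expR s * 2.
Proof.
move=> z1; rewrite /Phi addrAC subrr add0r cabsM cabs_real ger0_norm ?expR_ge0//.
by rewrite ler_wpM2l ?expR_ge0// gam_ub.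
Qed.

Lemma eq_of_cabs_le (u v : R[i]) : (forall e, 0 < e -> cabs (u - v) <= e) -> u = v.
Proof.
move=> h; apply/eqP; rewrite -subr_eq0 -cabs_eq0 eq_le cabs_ge0 andbT.
by apply/ler_addgt0Pr => e e0; rewrite add0r; exact: h.
Qed.

(** The weighted integral does not change when the unit circle is shrunk to the curve [Phi z s]; for
    very negative [s], continuity replaces [T] there by [T z] at an arbitrarily small cost. *)
Lemma cauchy_formula_wt T z c : cabs z < 1 -> (forall w, cabs w <= 1 -> cdiff T w) ->
  cint c (c + 2 * pi) (fun t => T (expi t) * wt z t) =
  T z * cint c (c + 2 * pi) (wt z).
Proof.
move=> z1 dT; apply: eq_of_cabs_le => e e0.
have cw : ccts c (c + 2 * pi) (wt z) by exact: ccts_wt.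
have pi2 : 0 < 2 * pi :> R by rewrite mulr_gt0// pi_gt0.
have cpi : c <= c + 2 * pi by rewrite lerDl ltW.
pose W := (1 - cabs z)^-1.
have W0 : 0 < W by rewrite invr_gt0 subr_gt0.
have e'0 : 0 < e / (2 * W * (2 * pi)) by rewrite divr_gt0// mulr_gt0// mulr_gt0.
have [dl dl0 hdl] := cdiff_continuous (dT z (ltW z1)) e'0.
(* [s <= 0] keeps the curve in the closed disc, and [expR s * 2 <= dl / 2] keeps it within [dl] of
   [z]. *)
pose s := Num.min 0 (ln (dl / 4)).
have s0 : s <= 0 by rewrite ge_min lexx.
have sdl : expR s * 2 < dl.
  have : expR s <= dl / 4.
    rewrite -[leRHS]lnK ?posrE ?divr_gt0// ler_expR.
    by rewrite ge_min lexx orbT.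
  lra.
pose F t := T (Phi z s t) * wt z t.
pose G t := T z * wt z t.
have cF : ccts c (c + 2 * pi) F.
  apply: cctsM; last exact: cw.
  apply: (@ccts_comp _ _ _ T (Phi z s)); first exact: ccts_Phi2.
  by move=> t _; apply: dT; exact: Phi_disc.
have cG : ccts c (c + 2 * pi) G by apply: cctsM; [exact: ccts_cst|exact: cw].
have -> : cint c (c + 2 * pi) (fun t => T (expi t) * wt z t) = cint c (c + 2 * pi) F.
  rewrite (@circle_mean_cst _ T z c s 0 z1 s0); last first.
    by move=> s' t /andP[_ h]; apply: dT; exact: Phi_disc.
  by apply: eq_cint => t _; rewrite Phi0.
rewrite -(cintZ _ cw) -(cintB cF cG).
apply: (le_trans (cint_bound cpi (cctsB cF cG) _ (M := e / (2 * W * (2 * pi)) * W))).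
  move=> t _; rewrite /F /G -mulrBl cabsM; apply: ler_pM; rewrite ?cabs_ge0//.
    apply/ltW/hdl; apply: le_lt_trans sdl; exact: cabs_Phi_sub.
  exact: wt_ub.
rewrite (_ : c + 2 * pi - c = 2 * pi); last by ring.
have W0' : W != 0 by rewrite gt_eqF.
have p0' : (pi : R) != 0 by rewrite gt_eqF ?pi_gt0.
rewrite le_eqVlt; apply/orP; left; apply/eqP.
by clear -W0' p0'; move: (W) (pi) W0' p0' => w p w0 p0; field; rewrite w0 p0.
Qed.

Lemma wt0 t : wt 0 t = 'i%C :> R[i].
Proof. by rewrite /wt /gam subr0 mulfK// expi_neq0. Qed.

Lemma i_neq0 : 'i%C != 0 :> R[i].
Proof. by rewrite -cabs_gt0 cabs_i. Qed.

Lemma ccts_circle T c d : (forall w, cabs w <= 1 -> cdiff T w) -> ccts c d (fun t => T (expi t)).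
Proof.
move=> dT; apply: (@ccts_comp _ _ _ T (@expi R)); first exact: ccts_expi.
by move=> t _; apply: dT; rewrite cabs_expi.
Qed.

Lemma mean_value T c : (forall w, cabs w <= 1 -> cdiff T w) ->
  cint c (c + 2 * pi) (fun t => T (expi t)) = T 0 * ((2 * pi)%:C)%C.
Proof.
move=> dT; have z1 : cabs (0 : R[i]) < 1 by rewrite cabs0.
have pi2 : 0 < 2 * pi :> R by rewrite mulr_gt0// pi_gt0.
have cpi : c <= c + 2 * pi by rewrite lerDl ltW.
have := cauchy_formula_wt c z1 dT.
rewrite (@eq_cint _ _ _ (wt 0) (fun _ => 'i%C)); last by move=> t _; exact: wt0.
rewrite cint_cst// (_ : c + 2 * pi - c = 2 * pi); last by ring.
rewrite (@eq_cint _ _ _ _ (fun t => 'i%C * T (expi t))); last first.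
  by move=> t _; rewrite wt0 mulrC.
rewrite (cintZ _ (@ccts_circle T c _ dT)) mulrCA.
exact: (mulfI i_neq0).
Qed.

Lemma cdiff_kernel z w : cabs z < 1 -> cabs w <= 1 ->
  cdiff (fun u => (1 - (z^*)%C * u)^-1) w.
Proof.
move=> z1 w1; apply: (@cdiffV _ (fun u => 1 - (z^*)%C * u)).
  apply/negP => /eqP /(congr1 (@cabs R)); rewrite cabs0 => h.
  have := ler_cabsD (1 - (z^*)%C * w) ((z^*)%C * w).
  rewrite subrK cabs1 h add0r cabsM cabsJ.
  have := cabs_ge0 z; have := cabs_ge0 w; nra.
apply: cdiffB; first exact: cdiff_cst.
by apply: cdiffM; [exact: cdiff_cst|exact: cdiff_id].
Qed.

(** No winding number is computed: on the circle [wt z] is [i] times the conjugate of the kernel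
    [1 / (1 - conj z w)], which is holomorphic on the closed disc with value 1 at [0], so the mean
    value property gives the integral. *)
Lemma cint_wt z c : cabs z < 1 ->
  cint c (c + 2 * pi) (wt z) = 'i%C * ((2 * pi)%:C)%C.
Proof.
move=> z1; have dT := fun w => @cdiff_kernel z w z1.
have cT := @ccts_circle _ c (c + 2 * pi) dT.
have := mean_value c dT; rewrite mulr0 subr0 invr1 mul1r => h.
rewrite (@eq_cint _ _ _ _ (fun t => 'i%C * (((1 - (z^*)%C * expi t)^-1)^*)%C)); last first.
  move=> t _; rewrite /wt /gam -mulrA; congr (_ * _).
  rewrite conjc_inv conjcB conjc1 conjcM conjcK conj_expi.
  have e0 := expi_neq0 t.
  have g0 := gam_neq0 t z1; rewrite /gam in g0.
  field; rewrite g0 e0.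
  by [].
by rewrite (cintZ _ (ccts_conj cT)) (cint_conj cT) h conjc_real.
Qed.

Definition pker z t : R := (1 - cabs z ^+ 2) / cabs (gam z t) ^+ 2.

Lemma pker_ge0 z t : cabs z < 1 -> 0 <= pker z t.
Proof.
move=> z1; rewrite divr_ge0 ?sqr_ge0// subr_ge0.
by rewrite expr_le1 ?cabs_ge0// ltW.
Qed.

Lemma cts_pker a b z : cabs z < 1 -> {within `[a, b], continuous (pker z)}.
Proof.
move=> z1; have cg := ccts_cabs (@ccts_gam R a b z).
move=> x; apply: cvgM; first exact: cvg_cst.
apply: cvgV; first by rewrite expf_neq0// cabs_eq0 gam_neq0.
by apply: cvgM; exact: cg.
Qed.

(** Cauchy's formula for [F w = T w / (1 - conj z w)]. At [z] the extra factor is [1 / (1 - |z|^2)],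
    and on the circle it turns the weight [wt z t] into [i / |gam z t|^2]. *)
Lemma poisson_formula T z c : cabs z < 1 -> (forall w, cabs w <= 1 -> cdiff T w) ->
  cint c (c + 2 * pi) (fun t => ((pker z t)%:C)%C * T (expi t)) = ((2 * pi)%:C)%C * T z.
Proof.
move=> z1 dT.
pose F w := T w * (1 - (z^*)%C * w)^-1.
have dF w : cabs w <= 1 -> cdiff F w.
  by move=> w1; apply: cdiffM; [exact: dT|exact: cdiff_kernel].
have h := cauchy_formula_wt c z1 dF.
have cF := @ccts_circle F c (c + 2 * pi) dF.
have q0 : 1 - cabs z ^+ 2 != 0.
  by apply: lt0r_neq0; rewrite subr_gt0 expr_lt1//; exact: cabs_ge0.
have q0' : ((1 - cabs z ^+ 2)%:C)%C != 0 by rewrite -cabs_gt0 cabs_real normr_gt0.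
have Fz : F z = T z / ((1 - cabs z ^+ 2)%:C)%C.
  rewrite /F (_ : ((1 - cabs z ^+ 2)%:C)%C = 1 - (z^*)%C * z)//.
  by rewrite mulrC mulcJ; exact: rmorphB.
have cFw : ccts c (c + 2 * pi) (fun t => F (expi t) * wt z t).
  by apply: cctsM; [exact: cF|exact: ccts_wt].
rewrite cint_wt// in h.
rewrite (@eq_cint _ _ _ _ (fun t => (- 'i%C * ((1 - cabs z ^+ 2)%:C)%C) * (F (expi t) * wt z t))).
  rewrite (cintZ _ cFw) h Fz.
  rewrite -[RHS]mul1r (_ : 1 = - ('i%C * 'i%C) :> R[i]); last by rewrite -expr2 sqr_i opprK.
  clear -q0'; move: q0'.
  move: (((1 - cabs z ^+ 2)%:C)%C) (((2 * pi)%:C)%C) (T z) ('i%C : R[i]) => q p u i q0.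
  by field; exact: q0.
move=> t _; rewrite /F /pker /wt.
have g0 := gam_neq0 t z1.
have e0 := expi_neq0 t.
have gJ : ((gam z t)^*)%C = (1 - (z^*)%C * expi t) / expi t.
  by rewrite /gam conjcB conj_expi mulrBl mul1r mulfK// expi_neq0.
have k0 : 1 - (z^*)%C * expi t != 0.
  apply: contra_neq g0 => k0; apply/eqP; rewrite -cabs_eq0 -cabsJ gJ k0.
  by rewrite mul0r cabs0.
rewrite fmorph_div /= -mulcJ gJ.
have ii : 'i%C * 'i%C = -1 :> R[i] by rewrite -expr2 sqr_i.
clear -g0 k0 e0 ii; move: g0 k0 e0 ii.
move: (gam z t) ((z^*)%C) (expi t) ('i%C : R[i]) (((1 - cabs z ^+ 2)%:C)%C) (T _).
move=> g k e i q u g0 k0 e0 ii.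
transitivity (- (i * i) * (q * u * e / ((1 - k * e) * g))).
  by rewrite ii opprK mul1r; field; rewrite g0 k0 e0.
by field; rewrite g0 k0.
Qed.

End Poisson.

(** * Dilates of a holomorphic function *)

Section Dilation.
Variable R : realType.
Implicit Types (a b c d s t r : R) (z w : R[i]) (f : R[i] -> R[i]).

Definition holo f := forall w, cabs w < 1 -> cdiff f w.

Lemma holo_dilate f r : 0 <= r < 1 -> holo f ->
  forall w, cabs w <= 1 -> cdiff (fun u => f ((r%:C)%C * u)) w.
Proof.
move=> /andP[r0 r1] hf w w1.
apply: (@cdiff_comp _ f (fun u => (r%:C)%C * u)).
  by apply: cdiffM; [exact: cdiff_cst|exact: cdiff_id].
apply: hf; rewrite cabsM cabs_real ger0_norm//.
by apply: le_lt_trans r1; rewrite ler_piMr.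
Qed.

Lemma ccts_polar f r c d : 0 <= r < 1 -> holo f -> ccts c d (fun t => f (polar r t)).
Proof. by move=> r01 hf; exact: (@ccts_circle _ _ c d (holo_dilate r01 hf)). Qed.

Arguments ccts_polar [f r] c d.

Lemma rint_pker z c : cabs z < 1 -> rint c (c + 2 * pi) (pker z) = 2 * pi.
Proof.
move=> z1; have := @poisson_formula R (fun _ => 1) z c z1 (fun w _ => cdiff_cst 1 w).
rewrite mulr1 (@eq_cint _ _ _ _ (fun t => ((pker z t)%:C)%C)); last by move=> t _; rewrite mulr1.
by rewrite cint_real => -[].
Qed.

Lemma poisson_cabs_le f r z c : 0 <= r < 1 -> cabs z < 1 -> holo f ->
  pi * cabs (f ((r%:C)%C * z)) <= rint c (c + 2 * pi) (fun t => pker z t * cabs (f (polar r t))).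
Proof.
move=> r01 z1 hf.
have h := poisson_formula c z1 (holo_dilate r01 hf).
have cf := ccts_polar c (c + 2 * pi) r01 hf.
pose F t := ((pker z t)%:C)%C * f (polar r t).
have cF : ccts c (c + 2 * pi) F.
  apply: cctsM; last exact: cf.
  apply: ccts_ReIm; first exact: cts_pker.
  by move=> x; exact: cvg_cst.
have := ler_cabs_cint cF.
rewrite (_ : cint _ _ F = ((2 * pi)%:C)%C * f ((r%:C)%C * z)); last exact: h.
rewrite cabsM cabs_real ger0_norm ?mulr_ge0 ?pi_ge0// -mulrA ler_pM2l//.
move=> /le_trans; apply; rewrite le_eqVlt; apply/orP; left; apply/eqP.
by apply: eq_rint => t _; rewrite /F cabsM cabs_real ger0_norm// pker_ge0.
Qed.

Lemma Phi_polar s t : Phi 0 s t = polar (expR s) t :> R[i].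
Proof. by rewrite /Phi /gam add0r subr0. Qed.

Lemma expR_lt1 s : s < 0 -> 0 <= expR s < 1.
Proof. by move=> s0; rewrite expR_ge0 -expR0 ltr_expR. Qed.

(** The logarithm of the radius is the parameter, so that the geometric mean of two radii becomes a
    midpoint. *)
Definition csq f c s := rint c (c + 2 * pi) (fun t => cabs (f (polar (expR s) t)) ^+ 2).

Lemma cabs_subsq z w : cabs (z - w) ^+ 2 =
  cabs z ^+ 2 + cabs w ^+ 2 - 2 * complex.Re (z * (w^*)%C).
Proof. by rewrite !cabs_sqr; case: z w => [p q] [u v] /=; ring. Qed.

Lemma Re_mulJ z : complex.Re (z * (z^*)%C) = cabs z ^+ 2.
Proof. by rewrite mulcJ. Qed.

(** With [P = e^(s1 + s2)], the function [T w = f w * g (P / w)] is holomorphic on an annulus. On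
    the circle of radius [e^s] it is [f] at radius [e^s] times the conjugate of [f] at radius
    [e^(s1 + s2 - s)]. Its mean is thus the same for [s = s1] and for the midpoint, where both radii
    agree. *)
Lemma circle_inner_cst f c s1 s2 : holo f -> s1 <= s2 -> s2 < 0 ->
  cint c (c + 2 * pi) (fun t => f (polar (expR s1) t) * ((f (polar (expR s2) t))^*)%C) =
  cint c (c + 2 * pi) (fun t => f (polar (expR ((s1 + s2) / 2)) t) *
     ((f (polar (expR ((s1 + s2) / 2)) t))^*)%C).
Proof.
move=> hf s12 s20.
pose P : R[i] := ((expR (s1 + s2))%:C)%C.
pose g w : R[i] := ((f (w^*)%C)^*)%C.
pose T w := f w * g (P * w^-1).
have gP s t : g (P * (Phi 0 s t)^-1) = ((f (polar (expR (s1 + s2 - s)) t))^*)%C.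
  rewrite /g; congr ((f _)^*)%C; rewrite Phi_polar /P /polar expRB.
  rewrite conjcM conjc_inv conjcM conj_expi !conjc_real fmorph_div /=.
  have e0 : ((expR s)%:C)%C != 0 by rewrite -cabs_gt0 cabs_real normr_gt0 gt_eqF ?expR_gt0.
  by rewrite invfM invrK mulrA.
have z0 : cabs (0 : R[i]) < 1 by rewrite cabs0.
have mid : s1 <= (s1 + s2) / 2 by lra.
have dT s t : s1 <= s <= (s1 + s2) / 2 -> cdiff T (Phi 0 s t).
  move=> /andP[h1 h2].
  have sl0 : s < 0 by lra.
  have Phi_n0 : Phi 0 s t != 0.
    by rewrite Phi_polar -cabs_gt0 cabs_polar ?expR_ge0 ?expR_gt0.
  apply: cdiffM.
    by apply: hf; rewrite Phi_polar cabs_polar ?expR_ge0//; case/andP: (expR_lt1 sl0).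
  apply: (@cdiff_comp _ g (fun w => P * w^-1)).
    by apply: cdiffM; [exact: cdiff_cst|exact: cdiff_inv].
  apply: cdiff_conj; apply: hf.
  rewrite cabsJ cabsM cabsV Phi_polar cabs_polar ?expR_ge0// cabs_real ger0_norm ?expR_ge0//.
  have : s1 + s2 - s < 0 by lra.
  by rewrite -expRB => /expR_lt1/andP[].
have := @circle_mean_cst _ T 0 c s1 _ z0 mid dT.
have inn s t : T (Phi 0 s t) * wt 0 t = 'i%C * (f (polar (expR s) t) * ((f (polar (expR (s1 + s2 - s)) t))^*)%C).
  by rewrite wt0 mulrC /T gP Phi_polar.
have cfp s s' : s < 0 -> s' < 0 -> ccts c (c + 2 * pi)
    (fun t => f (polar (expR s) t) * ((f (polar (expR s') t))^*)%C).
  move=> h h'; apply: cctsM; first exact: ccts_polar (expR_lt1 h) hf.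
  exact: ccts_conj (ccts_polar _ _ (expR_lt1 h') hf).
have s10 : s1 < 0 by lra.
have e1 : s1 + s2 - s1 = s2 by ring.
have e2 : s1 + s2 - (s1 + s2) / 2 = (s1 + s2) / 2 by field.
have m0 : (s1 + s2) / 2 < 0 by lra.
rewrite (eq_cint (fun t _ => inn s1 t)) (eq_cint (fun t _ => inn ((s1 + s2) / 2) t)).
rewrite e1 e2 (cintZ _ (cfp _ _ s10 s20)) (cintZ _ (cfp _ _ m0 m0)).
exact: (mulfI (@i_neq0 R)).
Qed.

Lemma csq_sub f c s1 s2 : holo f -> s1 <= s2 -> s2 < 0 ->
  rint c (c + 2 * pi) (fun t => cabs (f (polar (expR s1) t) - f (polar (expR s2) t)) ^+ 2) =
  csq f c s1 + csq f c s2 - 2 * csq f c ((s1 + s2) / 2).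
Proof.
move=> hf s12 s20; have s10 : s1 < 0 by lra.
have m0 : (s1 + s2) / 2 < 0 by lra.
have cf s (s0 : s < 0) := ccts_polar c (c + 2 * pi) (expR_lt1 s0) hf.
pose F1 t := f (polar (expR s1) t); pose F2 t := f (polar (expR s2) t).
pose F3 t := f (polar (expR ((s1 + s2) / 2)) t).
have c1 : ccts c (c + 2 * pi) F1 := cf _ s10.
have c2 : ccts c (c + 2 * pi) F2 := cf _ s20.
have cc : ccts c (c + 2 * pi) (fun t => F1 t * ((F2 t)^*)%C).
  by apply: cctsM; [exact: c1|exact: (ccts_conj c2)].
have sq F : ccts c (c + 2 * pi) F -> {within `[c, c + 2 * pi], continuous (fun t => cabs (F t) ^+ 2)}.
  by move=> /ccts_cabs cF x; apply: cvgM; exact: cF.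
have csum : {within `[c, c + 2 * pi], continuous (fun t => cabs (F1 t) ^+ 2 + cabs (F2 t) ^+ 2)}.
  by move=> x; apply: cvgD; [exact: (sq _ c1)|exact: (sq _ c2)].
have cR := ccts_Re cc.
rewrite (@eq_rint _ _ _ _ (fun t => (cabs (F1 t) ^+ 2 + cabs (F2 t) ^+ 2) - 2 * complex.Re (F1 t * ((F2 t)^*)%C))).
  rewrite rintB//; last by move=> x; apply: cvgM; [exact: cvg_cst|exact: cR].
  rewrite rintD; [|exact: (sq _ c1)|exact: (sq _ c2)].
  rewrite rintZ//; congr (_ - 2 * _).
  have := congr1 (@complex.Re R) (circle_inner_cst c hf s12 s20).
  rewrite /cint /= => ->; apply: eq_rint => t _; exact: Re_mulJ.
by move=> t _; exact: cabs_subsq.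
Qed.

End Dilation.

Arguments ccts_polar [R f r] c d.

(** * Bounded midpoint-convex functions on a half-line *)

Section MidConvex.
Variable R : realType.
Variables (k : R -> R) (M : R).
Hypothesis kM : forall s, s < 0 -> k s <= M.
Hypothesis kmid : forall s1 s2, s1 <= s2 -> s2 < 0 -> 2 * k ((s1 + s2) / 2) <= k s1 + k s2.

(** A drop from [a] to [b] propagates to the left: by midpoint convexity the increments of [k] along
    [b - n (b - a)] stay at least [k a - k b], so [k] would exceed [M] for large [n]. *)
Lemma midconvex_bounded_nd a b : a < b -> b < 0 -> k a <= k b.
Proof.
move=> ab b0; rewrite leNgt; apply/negP => kba.
pose x n := k (b - n%:R * (b - a)).
have neg n : b - n%:R * (b - a) < 0.
  have : 0 <= n%:R * (b - a) by rewrite mulr_ge0// subr_ge0 ltW.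
  lra.
have step n : x n.+1 - x n >= k a - k b.
  elim: n => [|n IH].
    by rewrite /x mul0r mul1r subr0 (_ : b - (b - a) = a)//; ring.
  have h : b - n.+2%:R * (b - a) <= b - n%:R * (b - a).
    by rewrite lerD2l lerN2 ler_pM2r ?subr_gt0// ler_nat leqW.
  have := kmid h (neg n).
  have -> : (b - n.+2%:R * (b - a) + (b - n%:R * (b - a))) / 2 = b - n.+1%:R * (b - a).
    by rewrite -!natr1; field.
  move: IH; rewrite -/(x n) -/(x n.+1) -/(x n.+2); lra.
have lin n : x n >= k b + n%:R * (k a - k b).
  elim: n => [|n IH]; first by rewrite mul0r addr0 /x mul0r subr0.
  have := step n; rewrite -natr1; lra.
have d0 : 0 < k a - k b by lra.
pose n := (Num.truncn ((`|M| + `|k b|) / (k a - k b))).+1.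
have : (`|M| + `|k b|) / (k a - k b) < n%:R by exact: Num.Theory.truncnS_gt.
rewrite ltr_pdivrMr// => hn.
have := lin n; have := kM (neg n); rewrite -/(x n).
have := ler_norm M; have := ler_norm (- k b); rewrite normrN.
lra.
Qed.

(** By monotonicity all values of [k] beyond some [s0] lie within [e / 2] of the supremum, and the
    second difference is at most twice that gap. *)
Lemma midconvex_bounded_cauchy e : 0 < e ->
  exists2 s0, s0 < 0 & forall s1 s2, s0 <= s1 -> s1 <= s2 -> s2 < 0 ->
    k s1 + k s2 - 2 * k ((s1 + s2) / 2) <= e.
Proof.
move=> e0; pose A := [set k s | s in [set s | s < 0]].
have hs : has_sup A.
  split; first by exists (k (-1)), (-1) => //=; rewrite oppr_lt0.
  by exists M => _ [s /= s0 <-]; exact: kM.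
have [|_ [s0 /= s00 <-] hk] := @sup_adherent _ A (e / 2) _ hs; first by rewrite divr_gt0.
have ub s : s < 0 -> k s <= sup A.
  by move=> sl0; apply: sup_upper_bound => //; exists s.
have lb s : s0 <= s -> s < 0 -> k s0 <= k s.
  by rewrite le_eqVlt => /predU1P[->//|h1 h2]; exact: midconvex_bounded_nd.
exists s0 => // s1 s2 h1 h2 h3.
have u1 : k s1 <= sup A by apply: ub; lra.
have u2 := ub _ h3.
have l : k s0 <= k ((s1 + s2) / 2) by apply: lb; lra.
lra.
Qed.

End MidConvex.

(** * Integrals of periodic functions over shifted windows *)

Section PeriodicIntegral.
Variable R : realType.
Implicit Types (a b c p : R) (q : R -> R).

Lemma rint_shift a b p q : a <= b -> continuous q ->
  rint (a + p) (b + p) q = rint a b (fun t => q (t + p)).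
Proof.
move=> ab cq; rewrite /rint /Rintegral; congr fine.
have dF (x : R) : is_derive x (1 : R) (fun t : R => t + p) 1.
  exact: is_derive_shift.
have dF1 : (fun t : R => t + p)^`() = fun _ => 1.
  by apply/funext => x; rewrite derive1E; exact: derive_val.
have cF : continuous (fun t : R => t + p).
  by move=> x; apply: cvgD; [exact: cvg_id|exact: cvg_cst].
have := @integration_by_substitution_increasing R (fun t => t + p) q a b ab.
rewrite dF1 => ->.
- by apply: eq_integral => x _ /=; rewrite mulr1.
- by move=> x y _ _; rewrite ltrD2r.
- by move=> x _; exact: cvg_cst.
- exact: is_cvg_cst.
- exact: is_cvg_cst.
- split=> [x _||].
  + exact: ex_derive.
  + by apply: cvg_at_right_filter; exact: cF.
  + by apply: cvg_at_left_filter; exact: cF.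
- exact: continuous_subspaceT.
Qed.

Lemma rint_periodic_window q : continuous q -> (forall t, q (t + 2 * pi) = q t) ->
  rint (- pi) (- pi + 2 * pi) q = rint 0 (2 * pi) q.
Proof.
move=> cq per; have p0 := pi_ge0 R.
have cw a b : {within `[a, b], continuous q} by exact: continuous_subspaceT.
rewrite (_ : - pi + 2 * pi = pi); last by ring.
have e1 : - pi <= (0 : R) by lra.
have e2 : pi <= 2 * pi :> R by lra.
rewrite (rint_split (cw _ _) e1 p0) (rint_split (cw _ _) p0 e2) addrC; congr (_ + _).
have := rint_shift (2 * pi) e1 cq.
rewrite (_ : - pi + 2 * pi = pi); last by ring.
rewrite add0r => ->; apply: eq_rint => t _; exact/esym/per.
Qed.

(** The window [[- pi, 3 * pi]] contains every interval of half-width at most [pi] centred in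
    [[0, 2 * pi]]; it transfers the maximal inequality on the line to the circle. *)
Lemma rint_periodic_double q : continuous q -> (forall t, q (t + 2 * pi) = q t) ->
  rint (- pi) (3 * pi) q = 2 * rint 0 (2 * pi) q.
Proof.
move=> cq per; have p0 := pi_ge0 R.
have cw a b : {within `[a, b], continuous q} by exact: continuous_subspaceT.
have e1 : - pi <= pi :> R by lra.
have e2 : pi <= 3 * pi :> R by lra.
rewrite (rint_split (cw _ _) e1 e2).
have h1 := rint_periodic_window cq per.
rewrite (_ : - pi + 2 * pi = pi) in h1; last by ring.
have h2 := rint_shift (2 * pi) e1 cq.
rewrite (_ : - pi + 2 * pi = pi) in h2; last by ring.
rewrite (_ : pi + 2 * pi = 3 * pi) in h2; last by ring.
rewrite h2 h1 (@eq_rint _ _ _ _ q) ?h1; last by move=> t _; exact: per.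
ring.
Qed.

End PeriodicIntegral.

(** * The dilates are Cauchy in mean *)

Section MeanCauchy.
Variable R : realType.
Implicit Types (a b c t r e : R) (f : R[i] -> R[i]).

Lemma within_continuousT (q : R -> R) : (forall a b, {within `[a, b], continuous q}) -> continuous q.
Proof.
move=> h x; have : {within `[x - 1, x + 1], continuous q} by exact: h.
move=> /continuous_within_itvP; rewrite ltrBlDr -addrA ltrDl addr_gt0// => /(_ isT) [+ _ _].
by apply; rewrite in_itv/= ltrBlDr !ltrDl ltr01.
Qed.

Lemma continuous_cabs_polar_sub f r1 r2 : holo f -> 0 <= r1 < 1 -> 0 <= r2 < 1 ->
  continuous (fun t => cabs (f (polar r1 t) - f (polar r2 t))).
Proof.
move=> hf h1 h2; apply: within_continuousT => a b.
pose F1 t := f (polar r1 t); pose F2 t := f (polar r2 t).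
have c1 : ccts a b F1 := ccts_polar a b h1 hf.
have c2 : ccts a b F2 := ccts_polar a b h2 hf.
by apply: (@ccts_cabs _ a b (fun t => F1 t - F2 t)); exact: (cctsB c1 c2).
Qed.

Lemma continuous_cabs_polar f r : holo f -> 0 <= r < 1 ->
  continuous (fun t => cabs (f (polar r t))).
Proof.
move=> hf h1; apply: within_continuousT => a b.
by apply: (@ccts_cabs _ a b (fun t => f (polar r t))); exact: ccts_polar.
Qed.

Lemma polar_periodic r t : polar r (t + 2 * pi) = polar r t.
Proof. by rewrite /polar expi_periodic. Qed.

Definition square_mean_bounded f := exists M, forall r, 0 <= r < 1 ->
  rint 0 (2 * pi) (fun t => cabs (f (polar r t)) ^+ 2) <= M.

Lemma circle_mean_cauchy f e : holo f -> square_mean_bounded f -> 0 < e ->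
  exists2 r0, 0 < r0 < 1 & forall r1 r2, r0 <= r1 < 1 -> r0 <= r2 < 1 ->
    rint 0 (2 * pi) (fun t => cabs (f (polar r1 t) - f (polar r2 t))) <= e.
Proof.
move=> hf [M hM] e0.
have pi0 : 0 < 2 * pi :> R by rewrite mulr_gt0// pi_gt0.
have sqE s : csq f 0 s = rint 0 (2 * pi) (fun t => cabs (f (polar (expR s) t)) ^+ 2).
  by rewrite /csq add0r.
have kM s : s < 0 -> csq f 0 s <= M.
  by move=> s0; rewrite sqE; apply: hM; exact: expR_lt1.
have csub r1 r2 (h1 : 0 <= r1 < 1) (h2 : 0 <= r2 < 1) := continuous_cabs_polar_sub hf h1 h2.
have cw r1 r2 (h1 : 0 <= r1 < 1) (h2 : 0 <= r2 < 1) :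
    {within `[0, 2 * pi], continuous (fun t => cabs (f (polar r1 t) - f (polar r2 t)))}.
  exact/continuous_subspaceT/csub.
have csq2 r1 r2 (h1 : 0 <= r1 < 1) (h2 : 0 <= r2 < 1) :
    {within `[0, 2 * pi], continuous (fun t => cabs (f (polar r1 t) - f (polar r2 t)) ^+ 2)}.
  by move=> x; apply: cvgM; exact: cw.
have kmid s1 s2 : s1 <= s2 -> s2 < 0 -> 2 * csq f 0 ((s1 + s2) / 2) <= csq f 0 s1 + csq f 0 s2.
  move=> s12 s20; rewrite -subr_ge0 -csq_sub//.
  by apply: rint_ge0 => t _; exact: sqr_ge0.
(* The inequality [x <= eta + x^2 / eta] passes from square means to means; with this [eta] each of
   the two terms contributes at most [e / 2]. *)
pose eta := e / (2 * (2 * pi)).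
have eta0 : 0 < eta by rewrite divr_gt0// mulr_gt0.
have [|s0 s00 hs] := midconvex_bounded_cauchy kM kmid (e := eta * (e / 2)).
  by rewrite mulr_gt0// divr_gt0.
exists (expR s0); first by rewrite expR_gt0/= -expR0 ltr_expR.
have key r1 r2 : expR s0 <= r1 -> r1 <= r2 -> r2 < 1 ->
    rint 0 (2 * pi) (fun t => cabs (f (polar r1 t) - f (polar r2 t))) <= e.
  move=> h1 h2 h3.
  have r10 : 0 < r1 by apply: lt_le_trans h1; exact: expR_gt0.
  have r20 : 0 < r2 by apply: lt_le_trans h2.
  have i1 : 0 <= r1 < 1 by rewrite ltW//= (le_lt_trans h2).
  have i2 : 0 <= r2 < 1 by rewrite ltW.
  have a1 : s0 <= ln r1 by rewrite -(expRK s0) ler_ln// posrE ?expR_gt0.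
  have a2 : ln r1 <= ln r2 by rewrite ler_ln.
  have a3 : ln r2 < 0 by rewrite ln_lt0// r20.
  have := hs _ _ a1 a2 a3; rewrite -csq_sub// add0r !lnK ?posrE// => hsq.
  apply: (@le_trans _ _ (rint 0 (2 * pi) (fun t => eta + eta^-1 * cabs (f (polar r1 t) - f (polar r2 t)) ^+ 2))).
    apply: le_rint; first exact: cw.
      move=> x; apply: cvgD; first exact: cvg_cst.
      by apply: cvgM; [exact: cvg_cst|exact: csq2].
    move=> t _; set x := cabs _.
    have x0 : 0 <= x by exact: cabs_ge0.
    have [xe|/ltW ex] := leP x eta.
      by rewrite ler_wpDr// mulr_ge0 ?sqr_ge0// invr_ge0 ltW.
    rewrite ler_wpDl ?(ltW eta0)// mulrC ler_pdivlMr// expr2 ler_wpM2l//.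
  have cc : {within `[0, 2 * pi], continuous (fun _ : R => eta)} by move=> x; exact: cvg_cst.
  rewrite rintD//; last by move=> x; apply: cvgM; [exact: cvg_cst|exact: csq2].
  rewrite (@rintZ _ _ _ eta^-1 _ (csq2 _ _ i1 i2)) (rint_cst _ (ltW pi0)) subr0.
  have -> : eta * (2 * pi) = e / 2.
    by rewrite /eta; move: (2 * pi : R) pi0 => p p0; field; rewrite gt_eqF.
  rewrite [leRHS](splitr e) lerD2l ler_pdivrMl//.
move=> r1 r2 /andP[h1 h2] /andP[h3 h4].
have [r12|/ltW r21] := leP r1 r2; first exact: key.
by rewrite (@eq_rint _ _ _ _ (fun t => cabs (f (polar r2 t) - f (polar r1 t)))) ?key// => t _; exact: cabsBC.
Qed.

End MeanCauchy.

(** * Radial limits *)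

Section KernelMaximal.
Variable R : realType.
Implicit Types (a b c r t u th H d : R) (v : R -> R).

(** If [cos u <= 1/2], then [u <= 4] suffices and fixes the constant 32. Otherwise
    [sin u >= u cos u >= u / 2], while [sin^2 u <= 2 (1 - cos u)]. *)
Lemma one_sub_cos_ge u : 0 <= u <= pi -> u ^+ 2 / 32 <= 1 - cos u.
Proof.
move=> /andP[u0 upi].
have u4 : u <= 4 by have := pihalf_lt2 R; lra.
have [c2|c2] := leP (cos u) (1 / 2).
  have : u ^+ 2 <= 16 by rewrite expr2; nra.
  lra.
have su : u * cos u <= sin u.
  move: u0; rewrite le_eqVlt => /predU1P[<-|u0]; first by rewrite mul0r sin0.
  have [|x] := @MVT R sin cos 0 u u0.
    by apply: continuous_subspaceT => x; exact: continuous_sin.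
  rewrite in_itv/= => /andP[x0 xu]; rewrite sin0 !subr0 => ->.
  rewrite mulrC ler_pM2r//; apply/ltW; rewrite ltr_cos// in_itv/= ?(ltW x0) ?(ltW u0) ?upi//.
  by rewrite (le_trans (ltW xu) upi).
have s2 : sin u ^+ 2 <= 2 * (1 - cos u).
  rewrite sin2cos2; have := cos_le1 u; have := cos_geN1 u; nra.
have : (u / 2) ^+ 2 <= sin u ^+ 2.
  rewrite ler_pXn2r ?nnegrE//; [|by rewrite divr_ge0|].
    by apply: le_trans su; rewrite ler_wpM2l// ltW// -[2^-1]div1r.
  apply: le_trans su; apply: mulr_ge0 => //; lra.
rewrite expr_div_n (_ : 2 ^+ 2 = 4 :> R); last by ring.
by have := sqr_ge0 u; lra.
Qed.

Lemma cabs_gam_polar r th t :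
  cabs (gam (polar r th) t) ^+ 2 = (1 - r) ^+ 2 + 2 * r * (1 - cos (t - th)).
Proof.
have -> : gam (polar r th) t = ((cos t - r * cos th) +i* (sin t - r * sin th))%C.
  by apply/eqP; rewrite eq_complex /=; apply/andP; split; apply/eqP; ring.
rewrite cabs_sqr /= cosB.
have := cos2Dsin2 t; have := cos2Dsin2 th.
move: (cos t) (sin t) (cos th) (sin th) => x y x' y' h h'.
rewrite (_ : (x - r * x') ^+ 2 + (y - r * y') ^+ 2 =
  (x ^+ 2 + y ^+ 2) + r ^+ 2 * (x' ^+ 2 + y' ^+ 2) - 2 * r * (x * x' + y * y')); last by ring.
by rewrite h h'; ring.
Qed.

Lemma pker_le_inv r th t : 2^-1 <= r < 1 -> pker (polar r th) t <= 2 / (1 - r).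
Proof.
move=> /andP[r2 r1]; have r0 : 0 <= r by apply: le_trans r2.
rewrite /pker cabs_polar// cabs_gam_polar.
have d0 : 0 < 1 - r by rewrite subr_gt0.
have h : 0 <= 2 * r * (1 - cos (t - th)).
  by rewrite !mulr_ge0// subr_ge0 cos_le1.
rewrite ler_pdivrMr; last by rewrite ltr_pwDl ?exprn_gt0.
rewrite mulrAC ler_pdivlMr//.
have : 0 <= 2 * (2 * r * (1 - cos (t - th))) by rewrite mulr_ge0.
have : 0 <= (1 - r) ^+ 2 * (1 - r) by rewrite mulr_ge0 ?sqr_ge0 ?ltW.
rewrite !expr2; nra.
Qed.

(** In [cabs_gam_polar] the cosine term alone is at least [b^2 / 32] because [2 r >= 1]; with
    [1 - r^2 <= 2 (1 - r)] this gives [64 = 2 * 32]. *)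
Lemma pker_le_far r th t b : 2^-1 <= r < 1 -> 0 < b -> b <= `|t - th| <= pi ->
  pker (polar r th) t <= 64 * (1 - r) / b ^+ 2.
Proof.
move=> /andP[r2 r1] b0 /andP[bu upi]; have r0 : 0 <= r by apply: le_trans r2.
rewrite /pker cabs_polar// cabs_gam_polar.
have d0 : 0 < 1 - r by rewrite subr_gt0.
have b20 : 0 < b ^+ 2 by rewrite exprn_gt0.
have hc : b ^+ 2 / 32 <= 1 - cos (t - th).
  rewrite -cos_norm.
  apply: (le_trans _ (one_sub_cos_ge _)); last by rewrite normr_ge0.
  by rewrite ler_pM2r ?invr_gt0// ler_pXn2r// nnegrE ltW.
have hd : b ^+ 2 / 32 <= (1 - r) ^+ 2 + 2 * r * (1 - cos (t - th)).
  apply: (le_trans hc); have : 0 <= 1 - cos (t - th) by rewrite subr_ge0 cos_le1.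
  have := sqr_ge0 (1 - r); nra.
have p0 : 0 < (1 - r) ^+ 2 + 2 * r * (1 - cos (t - th)).
  by apply: lt_le_trans hd; rewrite divr_gt0.
rewrite ler_pdivrMr// mulrAC ler_pdivlMr//.
have -> : 1 - r ^+ 2 = (1 - r) * (1 + r) by ring.
have h1 : b ^+ 2 <= 32 * ((1 - r) ^+ 2 + 2 * r * (1 - cos (t - th))) by lra.
apply: (@le_trans _ _ ((1 - r) * 2 * b ^+ 2)).
  by rewrite ler_pM2r// ler_pM2l//; lra.
apply: (@le_trans _ _ ((1 - r) * 2 * (32 * ((1 - r) ^+ 2 + 2 * r * (1 - cos (t - th)))))).
  by rewrite ler_pM2l// mulr_gt0.
by rewrite le_eqVlt; apply/orP; left; apply/eqP; ring.
Qed.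

(* Dyadic decomposition: the kernel is at most [64 d / b^2] off the window of
   half-width [b], so that doubling the window from [b] to [2 b] costs at most
   [256 d H / b], a geometric series along [b = 2^k d] with [d = 1 - r]. *)
Lemma rint_pker_le r th v H : 2^-1 <= r < 1 -> 0 <= H -> continuous v ->
  (forall t, 0 <= v t) ->
  (forall a, 0 < a <= pi -> rint (th - a) (th + a) v <= 2 * a * H) ->
  rint (th - pi) (th + pi) (fun t => pker (polar r th) t * v t) <= 1024 * H.
Proof.
move=> r21 H0 cv v0 hv; have /andP[r2 r1] := r21.
have z1 : cabs (polar r th) < 1 by rewrite cabs_polar//; apply: le_trans r2.
set z := polar r th in z1 *.
have d0 : 0 < 1 - r by rewrite subr_gt0.
have cvw a b : {within `[a, b], continuous v} by exact: continuous_subspaceT.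
have cpv a b : {within `[a, b], continuous (fun t => pker z t * v t)}.
  by move=> x; apply: cvgM; [exact: cts_pker|exact: cvw].
have ccv a b k : {within `[a, b], continuous (fun t => k * v t)}.
  by move=> x; apply: cvgM; [exact: cvg_cst|exact: cvw].
have bound k a b : (forall t, a <= t <= b -> pker z t <= k) ->
    rint a b (fun t => pker z t * v t) <= k * rint a b v.
  move=> hk; rewrite -rintZ//; apply: le_rint => // t tab.
  by rewrite ler_wpM2r// hk.
have claim (n : nat) : forall a, 0 < a <= pi -> a <= 2 ^+ n * (1 - r) ->
    rint (th - a) (th + a) (fun t => pker z t * v t) <= 512 * (2 - (2 ^+ n)^-1) * H.
  elim: n => [|n IH] a /andP[a0 api] an.
    rewrite expr0 mul1r in an; rewrite expr0 invr1.
    apply: (le_trans (bound (2 / (1 - r)) _ _ _)); first by move=> t _; exact: pker_le_inv.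
    apply: (@le_trans _ _ (2 / (1 - r) * (2 * a * H))).
      apply: ler_wpM2l; last by apply: hv; rewrite a0.
      by rewrite divr_ge0// ltW.
    rewrite mulrAC ler_pdivrMr//.
    have : 0 <= H * (1 - r) by rewrite mulr_ge0// ltW.
    have : a * H <= (1 - r) * H by rewrite ler_wpM2r.
    lra.
  set b := 2 ^+ n * (1 - r).
  have pn : 0 < 2 ^+ n :> R by rewrite exprn_gt0.
  have b0 : 0 < b by rewrite mulr_gt0.
  have iS : (2 ^+ n.+1)^-1 = (2 ^+ n)^-1 / 2 :> R by rewrite exprSr invfM.
  have i0 : 0 < (2 ^+ n)^-1 :> R by rewrite invr_gt0.
  have [ab|ba] := leP a b.
    apply: (le_trans (IH a _ ab)); first by rewrite a0.
    by apply: ler_wpM2r => //; rewrite iS; lra.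
  have bpi : 0 < b <= pi by rewrite b0 (le_trans (ltW ba)).
  have e1 : th - a <= th - b by lra.
  have e2 : th - b <= th + b by lra.
  have e3 : th + b <= th + a by lra.
  have e4 : th - b <= th + a by lra.
  have far t : b <= `|t - th| <= a -> pker z t <= 64 * (1 - r) / b ^+ 2.
    by move=> /andP[h1 h2]; apply: pker_le_far => //; rewrite h1 (le_trans h2).
  rewrite (rint_split (cpv _ _) e1 e4) (rint_split (cpv _ _) e2 e3).
  have K0 : 0 <= 64 * (1 - r) / b ^+ 2.
    by apply: divr_ge0; [apply: mulr_ge0 => //; exact: ltW|exact: sqr_ge0].
  have hl : rint (th - a) (th - b) (fun t => pker z t * v t) <= 64 * (1 - r) / b ^+ 2 * rint (th - a) (th - b) v.
    apply: bound => t /andP[t1 t2]; apply: far; rewrite distrC ger0_norm; last by lra.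
    by apply/andP; split; lra.
  have hr : rint (th + b) (th + a) (fun t => pker z t * v t) <= 64 * (1 - r) / b ^+ 2 * rint (th + b) (th + a) v.
    apply: bound => t /andP[t1 t2]; apply: far; rewrite ger0_norm; last by lra.
    by apply/andP; split; lra.
  have hs : rint (th - a) (th - b) v + rint (th + b) (th + a) v <= 2 * a * H.
    have h1 : 0 < a <= pi by rewrite a0.
    have := hv a h1.
    rewrite (rint_split (cvw _ _) e1 e4) (rint_split (cvw _ _) e2 e3).
    have : 0 <= rint (th - b) (th + b) v by exact: rint_ge0.
    lra.
  have hm := IH b bpi (lexx _).
  have tail : 64 * (1 - r) / b ^+ 2 * (rint (th - a) (th - b) v + rint (th + b) (th + a) v) <= 512 * (2 ^+ n)^-1 / 2 * H.
    apply: (@le_trans _ _ (64 * (1 - r) / b ^+ 2 * (2 * a * H))); first by rewrite ler_wpM2l.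
    apply: (@le_trans _ _ (64 * (1 - r) / b ^+ 2 * (2 * (2 * b) * H))).
      apply: ler_wpM2l => //; apply: ler_wpM2r => //.
      by move: an; rewrite exprSr -/b /b; lra.
    rewrite le_eqVlt; apply/orP; left; apply/eqP.
    rewrite /b; move: (2 ^+ n : R) pn (1 - r) d0 => p p0 d d0'.
    by field; rewrite !gt_eqF.
  rewrite mulrDr in tail.
  rewrite iS; move: hm hl hr tail; lra.
have [n hn] : exists n : nat, pi <= 2 ^+ n * (1 - r).
  exists (Num.truncn (pi / (1 - r))).+1.
  rewrite -ler_pdivrMr//; apply/ltW; apply: (lt_le_trans (Num.Theory.truncnS_gt _)).
  by rewrite -natrX ler_nat ltnW// ltn_expl.
have hpi : 0 < (pi : R) <= pi by rewrite pi_gt0 lexx.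
apply: (le_trans (claim n pi hpi hn)); rewrite ler_wpM2r//.
have : 0 <= (2 ^+ n)^-1 :> R by rewrite invr_ge0 exprn_ge0.
lra.
Qed.

End KernelMaximal.

(** * Fatou's theorem under bounded square means *)

Section RadialLimits.
Variable R : realType.
Implicit Types (a b c r t th e : R) (f D : R[i] -> R[i]).
Notation mu := (@lebesgue_measure R).

(** On arbitrary sets [lebesgue_measure] is an outer measure. The maximal sets and the tail sets of
    [bnd phi] are compared in this sense. *)
Lemma lebesgue_measure_le (A B : set R) : A `<=` B -> (mu A <= mu B)%E.
Proof.
move=> AB; rewrite /lebesgue_measure /lebesgue_stieltjes_measure /measure_extension.
exact: le_mu_ext.
Qed.

Lemma lebesgue_measureU_le (A B : set R) : (mu (A `|` B) <= mu A + mu B)%E.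
Proof.
rewrite /lebesgue_measure /lebesgue_stieltjes_measure /measure_extension.
exact: outer_measureU2.
Qed.

Lemma rintE a b (v : R -> R) : {within `[a, b], continuous v} ->
  (\int[mu]_(t in `[a, b]) (v t)%:E)%E = (rint a b v)%:E.
Proof.
move=> cv; rewrite /rint /Rintegral fineK//.
by apply: integrable_fin_num => //; exact: cts_integrable.
Qed.

Lemma open_gt_continuous e (q : R -> R) : continuous q -> open [set t | e < q t].
Proof.
move=> cq; rewrite (_ : [set t | e < q t] = q @^-1` `]e, +oo[%classic).
  by apply: open_comp; [move=> x _; exact: cq|exact: interval_open].
by apply/seteqP; split => t /=; rewrite in_itv/= andbT.
Qed.

(* Weak type (1,1) bound for the radial maximal function on the circle of
   radius [r], through the Hardy-Littlewood maximal function. *)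
Lemma radial_maximal_weak D r e : holo D -> 0 <= r < 1 -> 0 < e ->
  (mu [set th : R | (0 <= th <= 2 * pi)%R /\
     exists2 s : R, (2^-1 <= s < 1)%R & (e < cabs (D (polar (r * s) th)))%R]
   <= ((3072 / e) * rint (- pi) (3 * pi) (fun t => cabs (D (polar r t))))%R%:E)%E.
Proof.
move=> hD r01 e0.
pose v t := cabs (D (polar r t)).
have v0 t : 0 <= v t by exact: cabs_ge0.
have cv : continuous v by exact: continuous_cabs_polar.
have cvw a b : {within `[a, b], continuous v} by exact: continuous_subspaceT.
pose h := v \_ `[- pi, 3 * pi].
have lh : locally_integrable setT h.
  by apply: integrable_locally_restrict => //; exact: cts_integrable.
(* At this level of the maximal function the factor 1024 of [rint_pker_le] gives back [e]; the
   factor 3 of the maximal inequality then yields 3072. *)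
have c0 : 0 < e / 1024 by lra.
have pi0 := pi_gt0 R.
have := maximal_inequality lh c0.
have -> : (\int[mu]_(y in setT) `|(h y)%:E|)%E = (rint (- pi) (3 * pi) v)%:E.
  rewrite -rintE// [RHS]integral_mkcond; apply: eq_integral => x _.
  rewrite /h /patch/=; case: ifP => _; last by rewrite normr0.
  by rewrite ger0_norm.
rewrite -EFinM (_ : 3 / (e / 1024) = 3072 / e); last by field; rewrite gt_eqF.
apply: le_trans; apply: lebesgue_measure_le => th /= [/andP[th0 th2] [s s1 es]].
rewrite ltNge; apply/negP => HLle.
have hv a : 0 < a <= pi -> rint (th - a) (th + a) v <= 2 * a * (e / 1024).
  move=> /andP[a0 api].
  have : (iavg h (ball th a) <= (e / 1024)%:E)%E.
    apply: le_trans HLle; apply: ereal_sup_ubound; exists a => //=.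
    by rewrite in_itv/= a0.
  rewrite /iavg lebesgue_measure_ball ?(ltW a0)// ball_itv.
  have -> : (\int[mu]_(y in `](th - a)%R, (th + a)%R[) `|(h y)%:E|)%E = (rint (th - a) (th + a) v)%:E.
    rewrite -rintE//.
    transitivity (\int[mu]_(y in `](th - a)%R, (th + a)%R[) (v y)%:E)%E; last first.
      apply/esym/(@integral_itv_bndoo _ _ _ _ true false).
      apply/measurable_EFinP; apply: subspace_continuous_measurable_fun => //.
      exact: continuous_subspaceT.
    apply: eq_integral => x; rewrite inE/= in_itv/= => /andP[x1 x2].
    rewrite /h /patch/= mem_set/=; first by rewrite ger0_norm.
    by rewrite in_itv/=; apply/andP; split; lra.
  rewrite inver mulrn_eq0/= gt_eqF// -EFinM lee_fin.
  rewrite ler_pdivrMl ?mulrn_wgt0//.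
  by rewrite (_ : a *+ 2 = 2 * a) // mulr_natl.
have h1 := rint_pker_le s1 (ltW c0) cv v0 hv.
have s01 : 0 <= s < 1 by case/andP: s1 => s2 ->; rewrite andbT; apply: le_trans s2.
have z1 : cabs (polar s th) < 1.
  by case/andP: s01 => s0 s1'; rewrite cabs_polar.
have := poisson_cabs_le (th - pi) r01 z1 hD.
rewrite (_ : th - pi + 2 * pi = th + pi); last by ring.
move=> /le_trans => /(_ _ h1); rewrite -polarM.
have -> : 1024 * (e / 1024) = e by field.
have pi1 : 1 <= pi :> R by have := pi_ge2 R; lra.
have c1 := cabs_ge0 (D (polar (r * s) th)).
have : cabs (D (polar (r * s) th)) <= pi * cabs (D (polar (r * s) th)) by rewrite ler_peMl.
lra.
Qed.

(** Compare [f] with its dilate by [rho]. The difference [D] is small in mean, so the weak-type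
    bound keeps it at most [e] on the outer half of the radius, off a set of measure at most [eta];
    the dilate is continuous up to the circle. The oscillation of [f] is then at most [2 * e] from
    [D] plus [e] from the dilate. *)
Lemma radial_oscillation_small f e eta : holo f -> square_mean_bounded f ->
  0 < e -> 0 < eta ->
  exists E : set R, [/\ measurable E, (mu E <= eta%:E)%E &
    forall th, 0 <= th <= 2 * pi -> ~ E th ->
    exists2 r0, 0 < r0 < 1 & forall r1 r2, r0 <= r1 < 1 -> r0 <= r2 < 1 ->
      cabs (f (polar r1 th) - f (polar r2 th)) <= 3 * e].
Proof.
move=> hf fM e0 eta0.
(* [6144 = 2 * 3072]: the weak-type constant, doubled by the window of length [4 * pi]. *)
have [|r0 /andP[r00 r01] hr0] := circle_mean_cauchy hf fM (e := eta * e / 6144).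
  have : 0 < eta * e by rewrite mulr_gt0.
  by lra.
(* Since [rho * rho >= r0], both [sg n >= rho] and [rho * sg n] are radii at which the means are
   controlled. *)
pose rho := (1 + r0) / 2.
have rho0 : 0 < rho by rewrite /rho; lra.
have rho1 : rho < 1 by rewrite /rho; lra.
have rhor : r0 <= rho * rho.
  have := sqr_ge0 (1 - r0); rewrite /rho expr2; lra.
pose D w := f w - f ((rho%:C)%C * w).
have hD : holo D.
  move=> w w1; apply: cdiffB; first exact: hf.
  have rr : 0 <= rho < 1 by rewrite ltW.
  exact: (holo_dilate rr hf (ltW w1)).
have Dp r t : D (polar r t) = f (polar r t) - f (polar (rho * r) t) by rewrite /D -polarM.
pose sg (n : nat) : R := 1 - (1 - rho) / n.+1%:R.
have sg_bd n : rho <= sg n < 1.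
  have n1 : 1 <= n.+1%:R :> R by rewrite ler1n.
  have p1 : 0 < (1 - rho) / n.+1%:R by rewrite divr_gt0// subr_gt0.
  have p2 : (1 - rho) / n.+1%:R <= 1 - rho.
    by rewrite ler_pdivrMr ?ltr0n// ler_peMr// subr_ge0 ltW.
  rewrite /sg; move: p1 p2; set q := (1 - rho) / _ => p1 p2.
  by apply/andP; split; lra.
(* The weak-type bound needs a circle of radius below 1, so the radii are exhausted by [sg n],
   increasing to 1. Each [G n] is an open set cut by a segment, and the bound [eta] is uniform in
   [n]. *)
pose G n := [set th | 0 <= th <= 2 * pi] `&`
  \bigcup_(s in [set s : R | 2^-1 <= s < sg n]) [set th | e < cabs (D (polar s th))].
have mG n : measurable (G n).
  apply: measurableI.
    have -> : [set th : R | 0 <= th <= 2 * pi] = `[0, 2 * pi]%classic.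
      by apply/seteqP; split => t /=; rewrite in_itv.
    exact: measurable_itv.
  apply: open_measurable; apply: bigcup_open => s /= /andP[s1 s2].
  apply: open_gt_continuous; apply: continuous_cabs_polar => //.
  have /andP[_ h] := sg_bd n.
  by rewrite (le_trans _ s1)//= (lt_trans s2 h).
have nG : {homo G : n m / (n <= m)%N >-> n <= m}%O.
  move=> n m nm; apply/subsetPset; apply: setIS => th [s /= /andP[s1 s2] hs].
  exists s => //=; rewrite s1/=; apply: (lt_le_trans s2).
  rewrite /sg lerD2l lerN2 ler_pM2l ?subr_gt0// lef_pV2 ?posrE ?ltr0n//.
  by rewrite ler_nat.
have muG n : (mu (G n) <= eta%:E)%E.
  have /andP[sg1 sg2] := sg_bd n.
  have sg0 : 0 < sg n by apply: lt_le_trans sg1.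
  have sg01 : 0 <= sg n < 1 by rewrite ltW.
  have rs : 0 <= rho * sg n < 1.
    apply/andP; split; first by rewrite mulr_ge0// ltW.
    by rewrite mulr_ilt1// ltW.
  have i1 : r0 <= sg n < 1 by rewrite sg2 andbT (le_trans _ sg1)// /rho; lra.
  have i2 : r0 <= rho * sg n < 1.
    by case/andP: rs => _ ->; rewrite andbT (le_trans rhor)// ler_pM2l.
  have hw : (mu (G n) <= ((3072 / e) * rint (- pi) (3 * pi) (fun t => cabs (D (polar (sg n) t))))%R%:E)%E.
    apply: le_trans (radial_maximal_weak hD sg01 e0).
    apply: lebesgue_measure_le => th [/= th1 [s /= /andP[s1 s2] hs]].
    split => //; exists (s / sg n); last by rewrite mulrCA divff ?mulr1// gt_eqF.
    rewrite ltr_pdivrMr// mul1r s2 andbT ler_pdivlMr//.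
    by apply: (le_trans _ s1); rewrite ler_piMr// ltW.
  apply: (le_trans hw); rewrite lee_fin.
  have cq : continuous (fun t => cabs (D (polar (sg n) t))) by exact: continuous_cabs_polar.
  rewrite rint_periodic_double//; last by move=> t; rewrite polar_periodic.
  have -> : rint 0 (2 * pi) (fun t => cabs (D (polar (sg n) t))) =
     rint 0 (2 * pi) (fun t => cabs (f (polar (sg n) t) - f (polar (rho * sg n) t))).
    by apply: eq_rint => t _; rewrite Dp.
  have h3 := hr0 _ _ i1 i2.
  apply: (@le_trans _ _ (3072 / e * (2 * (eta * e / 6144)))).
    have h0 : 0 <= 3072 / e by apply: divr_ge0; [exact: ler0n|exact: ltW].
    by apply: (ler_wpM2l h0); apply: ler_wpM2l; [exact: ler0n|exact: h3].
  by rewrite le_eqVlt; apply/orP; left; apply/eqP; field; rewrite gt_eqF.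
have mU : measurable (\bigcup_n G n) by exact: bigcup_measurable.
exists (\bigcup_n G n); split => //.
  have cG := nondecreasing_cvg_mu mG mU nG (mu := mu).
  rewrite -(cvg_lim _ cG)//; apply: lime_le; first by apply/cvg_ex; exists (mu (\bigcup_n G n)).
  by apply: nearW => n; exact: muG.
move=> th th2 hE.
have hs s : 2^-1 <= s < 1 -> cabs (D (polar s th)) <= e.
  move=> /andP[s1 s2]; rewrite leNgt; apply/negP => hs; apply: hE.
  pose n := Num.truncn ((1 - rho) / (1 - s)).
  exists n => //; split => //; exists s => //=; rewrite s1/= /sg.
  have : (1 - rho) / (1 - s) < n.+1%:R by exact: Num.Theory.truncnS_gt.
  rewrite ltr_pdivrMr ?subr_gt0// mulrC -ltr_pdivrMr ?ltr0n//.
  by set q := (1 - rho) / _ => h; lra.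
have pd : cabs (polar rho th) < 1 by rewrite cabs_polar// ltW.
have e20 : 0 < e / 2 by rewrite divr_gt0.
have [dl dl0 hdl] := cdiff_continuous (hf _ pd) e20.
pose rr := Num.max 2^-1 (1 - dl / 2).
have rr0 : 2^-1 <= rr by rewrite le_max lexx.
have rr1 : rr < 1.
  rewrite gt_max; apply/andP; split; first by rewrite invf_lt1 ?ltr1n.
  by rewrite ltrBlDr ltrDl divr_gt0.
have rrdl : 1 - dl / 2 <= rr by rewrite le_max lexx orbT.
have hf2 r : rr <= r < 1 -> cabs (f (polar (rho * r) th) - f (polar rho th)) < e / 2.
  move=> /andP[r1 r2]; apply: hdl.
  rewrite /polar -mulrBl -rmorphB cabsM cabs_expi mulr1 cabs_real.
  have -> : rho * r - rho = rho * (r - 1) by ring.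
  rewrite normrM gtr0_norm// distrC ger0_norm; last by lra.
  apply: (@le_lt_trans _ _ (1 - r)); last by lra.
  by apply: ler_piMl; [lra|exact: ltW].
exists rr; first by rewrite rr1 andbT (lt_le_trans _ rr0)// invr_gt0.
move=> r1 r2 h1 h2.
have a1 := hf2 _ h1; have a2 := hf2 _ h2.
have b1 := hs r1; have b2 := hs r2.
have {}b1 : cabs (D (polar r1 th)) <= e.
  by apply: b1; case/andP: h1 => h1 ->; rewrite (le_trans rr0 h1).
have {}b2 : cabs (D (polar r2 th)) <= e.
  by apply: b2; case/andP: h2 => h2 ->; rewrite (le_trans rr0 h2).
have -> : f (polar r1 th) - f (polar r2 th) = (D (polar r1 th) - D (polar r2 th))
   + ((f (polar (rho * r1) th) - f (polar rho th)) - (f (polar (rho * r2) th) - f (polar rho th))).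
  by rewrite !Dp; ring.
apply: (le_trans (ler_cabsD _ _)).
have := ler_cabsB (D (polar r1 th)) (D (polar r2 th)).
have := ler_cabsB (f (polar (rho * r1) th) - f (polar rho th)) (f (polar (rho * r2) th) - f (polar rho th)).
lra.
Qed.

Definition radially_cauchy f th e := exists2 r0, 0 < r0 < 1 &
  forall r1 r2, r0 <= r1 < 1 -> r0 <= r2 < 1 ->
    cabs (f (polar r1 th) - f (polar r2 th)) <= e.

Lemma radially_cauchy_cvg f th : (forall e, 0 < e -> radially_cauchy f th e) ->
  cvg (f (polar r th) @[r --> (1 : R)^'-]).
Proof.
move=> h.
have near r0 : 0 < r0 < 1 -> \forall r \near (1 : R)^'-, r0 <= r < 1.
  move=> /andP[_ r01]; near=> r; apply/andP; split.
    by apply/ltW; near: r; exact: nbhs_left_gt.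
  by near: r; exact: nbhs_left_lt.
have real_cvg (g : R[i] -> R) : (forall z w, `|g z - g w| <= cabs (z - w)) ->
    cvg (g (f (polar r th)) @[r --> (1 : R)^'-]).
  move=> hg; apply: cauchy_cvg; apply: cauchy_exP => e e0.
  have [|r0 r01 hr] := h (e / 2); first by rewrite divr_gt0.
  exists (g (f (polar r0 th))).
  have : \forall r \near (1 : R)^'-, r0 <= r < 1 by exact: near.
  rewrite /nbhs /=; apply: filterS => r rr /=.
  rewrite -ball_normE /=; apply: (le_lt_trans (hg _ _)).
  apply: (@le_lt_trans _ _ (e / 2)); last by lra.
  by apply: hr => //; case/andP: r01 => _ ->; rewrite lexx.
have /cvg_ex[x hx] := real_cvg (@complex.Re R) (fun z w => eq_ind _ (fun u => `|u| <= _) (ler_Re_cabs (z - w)) _ (raddfB _ _ _)).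
have /cvg_ex[y hy] := real_cvg (@complex.Im R) (fun z w => eq_ind _ (fun u => `|u| <= _) (ler_Im_cabs (z - w)) _ (raddfB _ _ _)).
apply/cvg_ex; exists (x +i* y)%C; apply/cvg_cabsP => e e0.
have e2 : 0 < e / 2 by rewrite divr_gt0.
have /cvgrPdist_lt/(_ _ e2) h1 := hx.
have /cvgrPdist_lt/(_ _ e2) h2 := hy.
near=> r; apply: le_lt_trans (ler_cabs_ReIm _) _.
rewrite (splitr e) ltrD//.
  rewrite (_ : complex.Re _ = complex.Re (f (polar r th)) - x) 1?distrC; first by near: r.
  by case: (f _).
rewrite (_ : complex.Im _ = complex.Im (f (polar r th)) - y) 1?distrC; first by near: r.
by case: (f _).
Unshelve. all: by end_near. Qed.

(** For each threshold [3 / (k + 1)] the bad points lie in sets of measure at most [1 / (n + 1)] for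
    all [n], hence in a null set; outside the countable union over [k] the Cauchy criterion
    holds. *)
Theorem fatou_radial_limits f : holo f -> square_mean_bounded f ->
  {ae mu, forall th, 0 <= th <= 2 * pi -> cvg (f (polar r th) @[r --> (1 : R)^'-])}.
Proof.
move=> hf fM.
pose bad (k : nat) := [set th | 0 <= th <= 2 * pi /\ ~ radially_cauchy f th (3 / k.+1%:R)].
have nbad k : mu.-negligible (bad k).
  have k0 : 0 < k.+1%:R^-1 :> R by rewrite invr_gt0.
  have n0 (n : nat) : 0 < n.+1%:R^-1 :> R by rewrite invr_gt0.
  have /choice[E hE'] : forall n : nat, exists E : set R, [/\ measurable E, (mu E <= (n.+1%:R^-1)%:E)%E &
    forall th, 0 <= th <= 2 * pi -> ~ E th -> radially_cauchy f th (3 / k.+1%:R)].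
    by move=> n; have [E [? ? ?]] := radial_oscillation_small hf fM k0 (n0 n); exists E.
  have mE : measurable (\bigcap_n E n).
    by apply: bigcapT_measurable => n; have [] := hE' n.
  exists (\bigcap_n E n); split => //.
    apply/eqP; rewrite eq_le measure_ge0 andbT.
    apply/lee_addgt0Pr => e e0; rewrite add0e.
    pose n := Num.truncn e^-1.
    have [_ hn _] := hE' n.
    apply: (@le_trans _ _ (mu (E n))); first by apply: lebesgue_measure_le => x; exact.
    apply: (le_trans hn); rewrite lee_fin invf_ple ?posrE//.
    by apply/ltW; exact: Num.Theory.truncnS_gt.
  move=> th [th1 th2] n _; apply: contrapT => hn; apply: th2.
  by have [_ _ h] := hE' n; exact: h.
have : mu.-negligible (\bigcup_k bad k) by exact: negligible_bigcup.
apply: negligibleS => th /= hth.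
apply: contrapT => hn; apply: hth => th1; apply: radially_cauchy_cvg => e e0.
pose k := Num.truncn (3 / e).
have [r0 r01 hr] : radially_cauchy f th (3 / k.+1%:R).
  by apply: contrapT => hb; apply: hn; exists k.
exists r0 => // r1 r2 h1 h2; apply: (le_trans (hr _ _ h1 h2)).
have : 3 / e < k.+1%:R by exact: Num.Theory.truncnS_gt.
rewrite ltr_pdivrMr// => h.
by rewrite ler_pdivrMr ?ltr0n// mulrC ltW.
Qed.

End RadialLimits.

(** * Orlicz functions *)

Section OrliczFunction.
Variables (R : realType) (Psi : R -> R).
Hypothesis hPsi : Orlicz Psi.
Implicit Types (x y t L C : R).

Lemma Orlicz0 : Psi 0 = 0.
Proof. by case: hPsi. Qed.

Lemma Orlicz_le x y : 0 <= x -> x <= y -> Psi x <= Psi y.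
Proof. by case: hPsi => _ + _ _ _; apply. Qed.

Lemma Orlicz_ge0 x : 0 <= x -> 0 <= Psi x.
Proof. by move=> x0; rewrite -Orlicz0; exact: Orlicz_le. Qed.

(** Strict convexity between [x] and [0], where [Psi] vanishes. Positivity and strict growth follow
    from it, since [Orlicz] asks for weak monotonicity only. *)
Lemma Orlicz_scale_lt t x : 0 < t < 1 -> 0 < x -> Psi (t * x) < t * Psi x.
Proof.
move=> t01 x0; case: hPsi => _ _ conv _ _.
have xn : x != 0 by rewrite gt_eqF.
have := conv x 0 t (ltW x0) (lexx 0) xn t01.
by rewrite Orlicz0 !mulr0 !addr0.
Qed.

Lemma Orlicz_scale_le t x : 0 <= t <= 1 -> 0 <= x -> Psi (t * x) <= t * Psi x.
Proof.
move=> /andP[]; rewrite le_eqVlt => /predU1P[<- _ _|t0].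
  by rewrite !mul0r Orlicz0.
rewrite le_eqVlt => /predU1P[-> _|t1]; first by rewrite !mul1r.
rewrite le_eqVlt => /predU1P[<-|x0]; first by rewrite !mulr0 Orlicz0 mulr0.
by apply/ltW/Orlicz_scale_lt => //; rewrite t0.
Qed.

Lemma Orlicz_gt0 x : 0 < x -> 0 < Psi x.
Proof.
move=> x0; have h : 0 < (2^-1 : R) < 1 by rewrite invr_gt0 ltr0n/= invf_lt1 ?ltr1n.
have := Orlicz_scale_lt h x0.
have : 0 <= Psi (2^-1 * x) by apply: Orlicz_ge0; rewrite mulr_ge0// ltW.
move=> h1 h2; have := le_lt_trans h1 h2.
by rewrite pmulr_rgt0// invr_gt0.
Qed.

Lemma Orlicz_lt x y : 0 <= x -> x < y -> Psi x < Psi y.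
Proof.
rewrite le_eqVlt => /predU1P[<-|x0] xy; first by rewrite Orlicz0 Orlicz_gt0.
have y0 := lt_trans x0 xy.
have h : 0 < x / y < 1 by rewrite divr_gt0//= ltr_pdivrMr// mul1r.
have := Orlicz_scale_lt h y0; rewrite divfK ?gt_eqF// => /lt_trans; apply.
by rewrite gtr_pMl ?Orlicz_gt0//; case/andP: h.
Qed.

Lemma Orlicz_superlinear (M : R) : exists2 x0, 0 < x0 & forall x, x0 <= x -> M * x <= Psi x.
Proof.
case: hPsi => _ _ _ _ /cvgryPge/(_ M)[x0 [_ hx]].
exists (Num.max 1 (x0 + 1)); first by rewrite lt_max ltr01.
move=> x; rewrite ge_max => /andP[x1 x2].
have x00 : 0 < x by apply: lt_le_trans x1.
have : M <= Psi x / x by apply: hx; apply: lt_le_trans x2; rewrite ltrDl.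
by rewrite ler_pdivlMr.
Qed.

(** [Psi_inv] is an [xget] with default [0]. Superlinearity bounds the search to a segment on which
    the intermediate value theorem finds a preimage, so for [y >= 0] the default never
    interferes. *)
Lemma Psi_inv_spec y : 0 <= y -> 0 <= Psi_inv Psi y /\ Psi (Psi_inv Psi y) = y.
Proof.
move=> y0; have [x0 x00 hx] := Orlicz_superlinear 1.
pose b := Num.max x0 y.
have b0 : 0 <= b by rewrite le_max y0 orbT.
have yb : y <= Psi b.
  apply: (@le_trans _ _ b); first by rewrite le_max lexx orbT.
  by have := hx b; rewrite mul1r; apply; rewrite le_max lexx.
have cP : {within `[0, b], continuous Psi}.
  case: hPsi => cP _ _ _ _; apply: continuous_subspaceW cP => x /=.
  by rewrite in_itv/= => /andP[].
have [|c] := IVT b0 cP (v := y).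
  rewrite Orlicz0; apply/andP; split; first by rewrite ge_min y0.
  by rewrite le_max yb orbT.
rewrite in_itv/= => /andP[c0 _] cy.
by rewrite /Psi_inv; case: xgetP => [x _ //|/(_ c)]; case.
Qed.

Lemma Psi_inv_ge0 y : 0 <= y -> 0 <= Psi_inv Psi y.
Proof. by move=> /Psi_inv_spec[]. Qed.

Lemma Psi_invK y : 0 <= y -> Psi (Psi_inv Psi y) = y.
Proof. by move=> /Psi_inv_spec[]. Qed.

Lemma Psi_inv_le x y : 0 <= x -> 0 <= y -> (Psi_inv Psi y <= x) = (y <= Psi x).
Proof.
move=> x0 y0; apply/idP/idP => [h|h].
  by rewrite -(Psi_invK y0) Orlicz_le// Psi_inv_ge0.
rewrite leNgt; apply/negP => /(Orlicz_lt x0); rewrite Psi_invK// => h2.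
by have := lt_le_trans h2 h; rewrite ltxx.
Qed.

Lemma Psi_inv_gt0 y : 0 < y -> 0 < Psi_inv Psi y.
Proof.
move=> y0; rewrite lt_def Psi_inv_ge0 ?ltW// andbT; apply/eqP => h.
by have := Psi_invK (ltW y0); rewrite h Orlicz0 => h2; rewrite -h2 ltxx in y0.
Qed.

Lemma Psi_inv_nd x y : 0 <= x -> x <= y -> Psi_inv Psi x <= Psi_inv Psi y.
Proof.
move=> x0 xy; have y0 := le_trans x0 xy.
by rewrite Psi_inv_le// ?Psi_inv_ge0// Psi_invK.
Qed.

(* Since [Psi y / y] increases, [y] is dominated by [L Psi y / Psi L] past [L]. *)
Lemma Orlicz_split L y : 0 < L -> 0 <= y -> y <= L + L * (Psi y / Psi L).
Proof.
move=> L0 y0; have PL := Orlicz_gt0 L0.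
have [yL|/ltW Ly] := leP y L.
  apply: ler_wpDr => //; apply: mulr_ge0; first exact: ltW.
  by apply: divr_ge0; [exact: Orlicz_ge0|exact: ltW].
rewrite ler_wpDl ?(ltW L0)//.
have {}y0 : 0 < y by apply: lt_le_trans Ly.
have h : 0 <= L / y <= 1.
  by apply/andP; split; [exact/ltW/divr_gt0|rewrite ler_pdivrMr// mul1r].
have := Orlicz_scale_le h (ltW y0); rewrite divfK ?gt_eqF// => h2.
have : Psi L * y <= L * Psi y by move: h2; rewrite mulrAC ler_pdivlMr.
by rewrite mulrA ler_pdivlMr// mulrC.
Qed.

(** [Psi] is unconstrained on the negative half-line; precomposing with [max 0] gives a function
    monotone on the whole line, hence measurable. *)
Lemma measurable_Orlicz d (T : measurableType d) (D : set T) (g : T -> R) :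
  measurable D -> measurable_fun D g -> (forall t : T, 0 <= g t) ->
  measurable_fun D (fun t : T => Psi (g t)).
Proof.
move=> mD mg g0; pose P x := Psi (Num.max 0 x).
have mP : measurable_fun [set: R] P.
  apply: nondecreasing_measurable => // x y xy.
  apply: Orlicz_le; first by rewrite le_max lexx.
  by rewrite ge_max !le_max lexx xy orbT.
have -> : (fun t : T => Psi (g t)) = P \o g; last exact: measurableT_comp.
by apply/funext => t; rewrite /P /= max_r.
Qed.

End OrliczFunction.

(** * The modular and the Luxemburg norm *)

Section Modular.
Variable R : realType.
Notation mu := (@lebesgue_measure R).
Implicit Types (g h : R -> R) (x y C : R).

(* The integral of a nonnegative function is the supremum of the integrals of
   the simple functions below it. *)
Lemma ge0_integral_mono d (T : measurableType d) (nu : {measure set T -> \bar R})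
    (D : set T) (f1 f2 : T -> \bar R) :
  (forall x : T, D x -> (0 <= f1 x)%E) -> (forall x : T, D x -> (f1 x <= f2 x)%E) ->
  (\int[nu]_(x in D) f1 x <= \int[nu]_(x in D) f2 x)%E.
Proof.
move=> f10 f12.
have f20 (x : T) : D x -> (0 <= f2 x)%E by move=> Dx; exact: le_trans (f10 _ Dx) (f12 _ Dx).
rewrite !ge0_integralE//; apply: le_ereal_sup => r [h hf hr].
exists h => //= x; apply: (le_trans (hf x)).
by rewrite /patch; case: ifPn => // /set_mem; exact: f12.
Qed.

Lemma Tpar_measurable : measurable (@Tpar R).
Proof. exact: measurable_itv. Qed.

Lemma mu_Tpar : mu (@Tpar R) = (2 * pi)%:E.
Proof.
have p0 : 0 < 2 * pi :> R by rewrite mulr_gt0// pi_gt0.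
by rewrite /Tpar lebesgue_measure_itv/= lte_fin p0 sube0.
Qed.

Lemma twopi_gt0 : 0 < 2 * pi :> R.
Proof. by rewrite mulr_gt0// pi_gt0. Qed.

Lemma intT_le_iff (f : R -> \bar R) (K : R) : (forall t, (0 <= f t)%E) ->
  (intT f <= K%:E)%E = (\int[mu]_(t in @Tpar R) f t <= (2 * pi * K)%:E)%E.
Proof.
by move=> f0; rewrite /intT lee_pdivrMl ?twopi_gt0// -EFinM.
Qed.

Lemma intT_lty_iff (f : R -> \bar R) : (forall t, (0 <= f t)%E) ->
  (intT f < +oo)%E = (\int[mu]_(t in @Tpar R) f t < +oo)%E.
Proof.
move=> f0; rewrite /intT.
have : (0 <= \int[mu]_(t in @Tpar R) f t)%E by exact: integral_ge0.
have p0 : 0 < (2 * pi)^-1 :> R by rewrite invr_gt0 twopi_gt0.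
case: (\int[mu]_(t in _) f t)%E => [r _| _|//]; first by rewrite -EFinM !ltry.
by rewrite gt0_muley// lte_fin.
Qed.

Variable Psi : R -> R.
Hypothesis hPsi : Orlicz Psi.

Lemma modular_arg_ge0 g C t : 0 < C -> (0 <= (Psi (`|g t| / C))%:E)%E.
Proof. by move=> C0; rewrite lee_fin (Orlicz_ge0 hPsi)// divr_ge0// ltW. Qed.

Lemma modular_le_mono g h C C' : 0 < C -> C <= C' ->
  (forall t, Tpar t -> `|g t| <= `|h t|) -> (modular Psi g C' <= modular Psi h C)%E.
Proof.
move=> C0 CC gh; have C'0 := lt_le_trans C0 CC.
rewrite /modular /intT lee_pmul2l//; last by rewrite lte_fin invr_gt0 twopi_gt0.
apply: ge0_integral_mono => t Tt; first exact: modular_arg_ge0.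
rewrite lee_fin (Orlicz_le hPsi) ?divr_ge0 ?(ltW C'0)//.
apply: ler_pM => //; rewrite ?invr_ge0 ?(ltW C'0)// ?lef_pV2//.
exact: gh.
Qed.

Lemma orlicz_norm_le g C : 0 < C -> (modular Psi g C <= 1)%E -> (orlicz_norm Psi g <= C%:E)%E.
Proof. by move=> C0 h; apply: ereal_inf_lbound; exists C. Qed.

(** Strictness provides an admissible constant below [C], the norm being an infimum. For this reason
    a function of norm at most 1 is later tested at [C = 2]. *)
Lemma modular_of_norm_lt g C : (orlicz_norm Psi g < C%:E)%E -> (modular Psi g C <= 1)%E.
Proof.
move=> /ereal_inf_lt[_ [C' [C'0 hC'] <-]]; rewrite lte_fin => CC.
by apply: le_trans hC'; exact: modular_le_mono (ltW CC) _.
Qed.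

Lemma norm_lty_modular g : (orlicz_norm Psi g < +oo)%E ->
  exists2 C, 0 < C & (modular Psi g C <= 1)%E.
Proof. by move=> /ereal_inf_lt[_ [C [C0 hC] <-]] _; exists C. Qed.

End Modular.

(** * Point evaluations on the unit ball *)

Section PointEvaluation.
Variable R : realType.
Notation mu := (@lebesgue_measure R).
Implicit Types (a b c r t e : R) (f : R[i] -> R[i]) (z : R[i]).

(** A sequence of radii tending to 1, so that measurability of pointwise limits and Fatou's lemma
    become applicable. *)
Definition radius (k : nat) : R := 1 - k.+2%:R^-1.

Lemma radius_bd k : 0 <= radius k < 1.
Proof.
have k0 : 0 < k.+2%:R^-1 :> R by rewrite invr_gt0.
have k1 : k.+2%:R^-1 <= 1 :> R by rewrite invf_le1// ler1n.
rewrite /radius; move: (k.+2%:R^-1) k0 k1 => x k0 k1.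
by apply/andP; split; lra.
Qed.

Lemma radius_nd : {homo radius : m n / (m <= n)%N >-> m <= n}.
Proof.
move=> m n mn; rewrite /radius lerD2l lerN2 lef_pV2 ?posrE ?ltr0n//.
by rewrite ler_nat.
Qed.

Lemma radius_near e : 0 < e -> exists K : nat, forall k, (K <= k)%N -> 1 - e < radius k.
Proof.
move=> e0; exists (Num.truncn e^-1) => k Kk.
apply: (lt_le_trans _ (radius_nd Kk)); rewrite /radius ltrD2l ltrN2.
rewrite invf_plt ?posrE//; apply: (lt_le_trans (Num.Theory.truncnS_gt _)).
by rewrite ler_nat.
Qed.

Lemma cvg_radius : radius k @[k --> \oo] --> (1 : R)^'-.
Proof.
move=> P [e /= e0 hP]; have [K hK] := radius_near e0.
exists K => // k /= Kk; have /andP[k0 k1] := radius_bd k.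
apply: hP => //; rewrite /ball /= ger0_norm; first by have := hK k Kk; lra.
by rewrite subr_ge0 ltW.
Qed.

Lemma bnd_radius f t : cvg (f (polar r t) @[r --> (1 : R)^'-]) ->
  cabs (f (polar (radius k) t)) @[k --> \oo] --> cabs (bnd f t).
Proof.
move=> cf; have : f (polar (radius k) t) @[k --> \oo] --> bnd f t.
  exact: (@cvg_comp _ _ _ radius (fun r => f (polar r t)) _ _ _ cvg_radius cf).
move=> /cvg_cabsP h; apply/cvgrPdist_lt => e e0; near=> k.
rewrite distrC; apply: (le_lt_trans (ler_dist_cabs _ _)); near: k; exact: h.
Unshelve. all: by end_near. Qed.

Lemma integral_TparE (v : R -> R) : continuous v ->
  (\int[mu]_(t in @Tpar R) (v t)%:E)%E = (rint 0 (2 * pi) v)%:E.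
Proof.
move=> cv; rewrite -rintE; last exact: continuous_subspaceT.
apply: integral_itv_bndo_bndc; apply/measurable_EFinP.
by apply: measurable_funTS; exact: continuous_measurable_fun.
Qed.

Lemma limn_einf_le_cst (u : (\bar R)^nat) (M : \bar R) : (forall n, (u n <= M)%E) ->
  (limn_einf u <= M)%E.
Proof.
move=> uM; rewrite limn_einf_lim; apply: lime_le; first exact: is_cvg_einfs.
apply: nearW => n; apply: le_trans (uM n); apply: ereal_inf_lbound.
by exists n => //=.
Qed.

Lemma pker_ub z t : cabs z < 1 -> pker z t <= 2 * (1 - cabs z)^-1.
Proof.
move=> z1; have d0 : 0 < 1 - cabs z by rewrite subr_gt0.
have g := gam_lb z t; have z0 := cabs_ge0 z.
have g0 : 0 < cabs (gam z t) by apply: lt_le_trans g.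
have g2 : (1 - cabs z) ^+ 2 <= cabs (gam z t) ^+ 2.
  by rewrite ler_pXn2r// nnegrE ltW.
rewrite /pker ler_pdivrMr ?exprn_gt0//.
apply: (@le_trans _ _ (2 / (1 - cabs z) * (1 - cabs z) ^+ 2)).
  rewrite expr2 mulrA divfK ?gt_eqF//.
  by rewrite (_ : 1 - cabs z ^+ 2 = (1 + cabs z) * (1 - cabs z)); [rewrite ler_pM2r//; lra|ring].
by rewrite ler_wpM2l// divr_ge0// ltW.
Qed.

(** Off the null set [N] the boundary modulus is a limit of continuous functions. On [N] the value
    of [lim] is arbitrary, and the indicator sends both the sequence and its limit to [0], so that
    measurability follows from convergence at every point. *)
Lemma boundary_modulus_measurable f : holo f -> square_mean_bounded f ->
  exists N : set R, [/\ measurable N, mu N = 0,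
    forall t, Tpar t -> ~ N t -> cvg (f (polar r t) @[r --> (1 : R)^'-]),
    forall t, Tpar t -> cabs (f (polar (radius k) t)) * \1_(~` N) t @[k --> \oo]
      --> cabs (bnd f t) * \1_(~` N) t &
    measurable_fun (@Tpar R) (fun t => cabs (bnd f t) * \1_(~` N) t)].
Proof.
move=> hf fM; have [N [mN muN hN]] := fatou_radial_limits hf fM.
have cN t : Tpar t -> ~ N t -> cvg (f (polar r t) @[r --> (1 : R)^'-]).
  move=> Tt tN; apply: contrapT => hn; apply: tN; apply: hN => /= h; apply: hn; apply: h.
  by move: Tt; rewrite /Tpar /= in_itv /= => /andP[-> /ltW].
have gw t : Tpar t -> cabs (f (polar (radius k) t)) * \1_(~` N) t @[k --> \oo]
    --> cabs (bnd f t) * (\1_(~` N) t : R).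
  move=> Tt; rewrite indicE; have [tN|tN] := pselect (N t).
    rewrite memNset; last by rewrite /setC /=; apply.
    by rewrite mulr0; under eq_fun do rewrite mulr0; exact: cvg_cst.
  rewrite mem_set//= mulr1; under eq_fun do rewrite mulr1.
  by apply: bnd_radius; exact: cN.
exists N; split => //.
apply: (measurable_fun_cvg (h := fun k t => cabs (f (polar (radius k) t)) * \1_(~` N) t)) => // k.
apply: measurable_funM; last by apply: measurable_indic; exact: measurableC.
apply: measurable_funTS; apply: continuous_measurable_fun.
by apply: continuous_cabs_polar => //; exact: radius_bd.
Qed.

Variable Psi : R -> R.
Hypothesis hPsi : Orlicz Psi.

(** In the Poisson bound for the dilates, [g k] is replaced by the boundary modulus [G0] at a small
    cost in mean. As [Psi L = q], [Orlicz_split] gives [G0 <= 2 L + 2 L Psi (G0 / 2) / q]. The first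
    term is averaged by the kernel; in the second the kernel is at most [2 q], which cancels [q].
    They contribute [4 pi L] and [8 pi L], hence 12 after division by [pi]. *)
Theorem point_evaluation f z : holo f -> square_mean_bounded f ->
  (HPsi_norm Psi f <= 1)%E -> cabs z < 1 ->
  cabs (f z) <= 12 * Psi_inv Psi (1 - cabs z)^-1.
Proof.
move=> hf fM nf z1.
set q := (1 - cabs z)^-1; set L := Psi_inv Psi q.
have q0 : 0 < q by rewrite invr_gt0 subr_gt0.
have L0 : 0 < L by exact: Psi_inv_gt0.
have PL : Psi L = q by apply: Psi_invK => //; exact: ltW.
have [N [mN muN cN gw mG0]] := boundary_modulus_measurable hf fM.
pose w : R -> R := \1_(~` N).
have w01 t : w t = 0 \/ w t = 1.
  by rewrite /w indicE; case: (t \in _); [right|left].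
have w0 t : 0 <= w t by case: (w01 t) => ->.
have w1 t : w t <= 1 by case: (w01 t) => ->.
have mw : measurable_fun (@Tpar R) w.
  by apply: measurable_indic; exact: measurableC.
have mT := @Tpar_measurable R.
pose G t := cabs (bnd f t).
pose g k t := cabs (f (polar (radius k) t)).
pose G0 t := G t * w t.
have cg k : continuous (g k) by apply: continuous_cabs_polar => //; exact: radius_bd.
have mg k : measurable_fun (@Tpar R) (g k).
  by apply: measurable_funTS; exact: continuous_measurable_fun.
have G00 t : 0 <= G0 t by rewrite /G0 mulr_ge0 ?cabs_ge0.
have G0G t : G0 t <= G t by rewrite /G0 ler_piMr ?cabs_ge0.
have intPsi : (\int[mu]_(t in @Tpar R) (Psi (G0 t / 2))%:E <= (2 * pi)%:E)%E.
  have : (modular Psi G0 2 <= 1)%E.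
    apply: (@le_trans _ _ (modular Psi G 2)).
      apply: modular_le_mono => // t _.
      by rewrite !ger0_norm ?cabs_ge0.
    by apply: modular_of_norm_lt => //; apply: (le_lt_trans nf); rewrite lte_fin ltr1n.
  rewrite /modular (@intT_le_iff _ _ 1); last by move=> t; exact: modular_arg_ge0.
  rewrite mulr1; apply: le_trans; apply: ge0_integral_mono => t _.
    by rewrite lee_fin (Orlicz_ge0 hPsi)// divr_ge0.
  by rewrite ger0_norm.
have mPsi : measurable_fun (@Tpar R) (fun t => Psi (G0 t / 2)).
  apply: (measurable_Orlicz hPsi) => //; last by move=> t; rewrite divr_ge0.
  exact: measurable_funM.
(* Fatou's lemma in [j]: the mean distance between [g k] and [g (j + K)] is at most [e] for every
   [j], and [g (j + K)] tends to [G0] where [w] is 1. *)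
have dist e : 0 < e -> exists K : nat, forall k, (K <= k)%N ->
    (\int[mu]_(t in @Tpar R) (`|g k t - G0 t| * w t)%:E <= e%:E)%E.
  move=> e0; have [r0 /andP[r00 r01] hr] := circle_mean_cauchy hf fM e0.
  have r1 : 0 < 1 - r0 by rewrite subr_gt0.
  have [K hK] := radius_near r1; exists K => k Kk.
  have rK j : (K <= j)%N -> r0 <= radius j < 1.
    move=> Kj; case/andP: (radius_bd j) => _ ->; rewrite andbT.
    by have := hK j Kj; lra.
  pose u j t := (`|g k t - g (j + K)%N t| * w t)%:E.
  have mu_ j : measurable_fun (@Tpar R) (u j).
    apply/measurable_EFinP; apply: measurable_funM => //.
    by apply: measurableT_comp => //; exact: measurable_funB.
  have u0 j t : Tpar t -> (0 <= u j t)%E by move=> _; rewrite lee_fin mulr_ge0.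
  have -> : (\int[mu]_(t in @Tpar R) (`|g k t - G0 t| * w t)%:E =
      \int[mu]_(t in @Tpar R) limn_einf (u ^~ t))%E.
    apply: eq_integral => t /set_mem Tt.
    have ugw : (fun j => u j t) @ \oo --> (`|g k t - G0 t| * w t)%:E.
      rewrite /u; apply: cvg_EFin; first exact: nearW.
      rewrite (_ : `|g k t - G0 t| * w t = `|g k t * w t - G0 t| * w t); last first.
        by case: (w01 t) => ->; rewrite ?mulr0// !mulr1.
      rewrite (_ : fine \o _ = fun j => `|g k t * w t - g (j + K)%N t * w t| * w t); last first.
        apply/funext => j /=.
        by case: (w01 t) => ->; rewrite ?mulr0// !mulr1.
      apply: cvgM; last exact: cvg_cst.
      apply: cvg_norm; apply: cvgB; first exact: cvg_cst.
      by have := gw t Tt; rewrite -(cvg_shiftn K).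
    by rewrite (cvg_limn_einf_sup ugw).
  apply: (le_trans (fatou mu mT mu_ u0)); apply: limn_einf_le_cst => j.
  have rj : r0 <= radius (j + K) < 1 by apply: rK; rewrite leq_addl.
  have h := hr _ _ (rK _ Kk) rj.
  apply: (@le_trans _ _ (\int[mu]_(t in @Tpar R) (cabs (f (polar (radius k) t) - f (polar (radius (j + K)) t)))%:E)%E).
    apply: ge0_integral_mono => t Tt; first exact: u0.
    rewrite lee_fin; apply: (@le_trans _ _ `|g k t - g (j + K)%N t|).
      by rewrite ler_piMr.
    exact: ler_dist_cabs.
  rewrite integral_TparE ?lee_fin//.
  by apply: continuous_cabs_polar_sub => //; exact: radius_bd.
have cpk : continuous (pker z).
  by apply: within_continuousT => a b; exact: cts_pker.
have main e : 0 < e -> exists K : nat, forall k, (K <= k)%N ->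
    pi * cabs (f (((radius k)%:C)%C * z)) <= 2 * q * e + 12 * pi * L.
  move=> e0; have [K hK] := dist e e0; exists K => k Kk.
  have := poisson_cabs_le 0 (radius_bd k) z1 hf; rewrite add0r => /le_trans; apply.
  rewrite -lee_fin -integral_TparE; last by move=> t; apply: cvgM; [exact: cpk|exact: cg].
  pose F1 t := ((2 * q)%:E * (`|g k t - G0 t| * w t)%:E)%E.
  pose F2 t := ((2 * L)%:E * (pker z t)%:E)%E.
  pose F3 t := ((4 * L)%:E * (Psi (G0 t / 2))%:E)%E.
  have F10 t : Tpar t -> (0 <= F1 t)%E.
    move=> _; rewrite /F1 -EFinM lee_fin; apply: mulr_ge0; first by rewrite mulr_ge0// ltW.
    exact: mulr_ge0.
  have F20 t : Tpar t -> (0 <= F2 t)%E.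
    move=> _; rewrite /F2 -EFinM lee_fin; apply: mulr_ge0; first by rewrite mulr_ge0// ltW.
    exact: pker_ge0.
  have F30 t : Tpar t -> (0 <= F3 t)%E.
    move=> _; rewrite /F3 -EFinM lee_fin; apply: mulr_ge0; first by rewrite mulr_ge0// ltW.
    by apply: (Orlicz_ge0 hPsi); rewrite divr_ge0.
  have md : measurable_fun (@Tpar R) (fun t => `|g k t - G0 t| * w t).
    apply: measurable_funM => //.
    by apply: measurableT_comp => //; exact: measurable_funB.
  have mp : measurable_fun (@Tpar R) (pker z).
    by apply: measurable_funTS; exact: continuous_measurable_fun.
  have mF1 : measurable_fun (@Tpar R) F1.
    by apply/measurable_EFinP; apply: measurable_funM.
  have mF2 : measurable_fun (@Tpar R) F2.
    by apply/measurable_EFinP; apply: measurable_funM.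
  have mF3 : measurable_fun (@Tpar R) F3.
    by apply/measurable_EFinP; apply: measurable_funM.
  have mF23 : measurable_fun (@Tpar R) (fun t => F2 t + F3 t)%E by exact: emeasurable_funD.
  have mF123 : measurable_fun (@Tpar R) (fun t => F1 t + (F2 t + F3 t))%E by exact: emeasurable_funD.
  have F230 t : Tpar t -> (0 <= F2 t + F3 t)%E by move=> Tt; exact: adde_ge0 (F20 t Tt) (F30 t Tt).
  have F1230 t : Tpar t -> (0 <= F1 t + (F2 t + F3 t))%E by move=> Tt; exact: adde_ge0 (F10 t Tt) (F230 t Tt).
  have pg0 t : Tpar t -> (0 <= (pker z t * g k t)%:E)%E.
    by move=> _; rewrite lee_fin mulr_ge0 ?pker_ge0 ?cabs_ge0.
  have mpg : measurable_fun (@Tpar R) (fun t => (pker z t * g k t)%:E).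
    by apply/measurable_EFinP; exact: measurable_funM.
  apply: (@le_trans _ _ (\int[mu]_(t in @Tpar R) (F1 t + (F2 t + F3 t)))%E).
    apply: (@ae_ge0_le_integral _ _ _ mu _ mT _ _ pg0 mpg F1230 mF123).
    exists N; split => // t /= ht; apply: contrapT => tN; apply: ht => Tt.
    rewrite /F1 /F2 /F3 -!EFinM -!EFinD lee_fin.
    have wt1 : w t = 1 by rewrite /w indicE mem_set.
    rewrite wt1 mulr1 -/(g k t).
    have a1 : g k t <= `|g k t - G0 t| + G0 t.
      by have := ler_norm (g k t - G0 t); lra.
    have a2 : G0 t / 2 <= L + L * (Psi (G0 t / 2) / q).
      by rewrite -PL; apply: Orlicz_split => //; rewrite divr_ge0.
    have a3 := pker_ub t z1; rewrite -/q in a3.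
    have a4 := pker_ge0 t z1.
    have p1 : 0 <= Psi (G0 t / 2) by apply: Orlicz_ge0 => //; rewrite divr_ge0.
    have b1 : pker z t * g k t <= pker z t * `|g k t - G0 t| + pker z t * G0 t.
      by rewrite -mulrDr ler_wpM2l.
    have b2 : pker z t * `|g k t - G0 t| <= 2 * q * `|g k t - G0 t| by rewrite ler_wpM2r.
    have b3 : pker z t * G0 t <= 2 * L * pker z t + pker z t * (2 * L * (Psi (G0 t / 2) / q)).
      rewrite (mulrC (2 * L)) -mulrDr ler_wpM2l//; lra.
    have b4 : pker z t * (2 * L * (Psi (G0 t / 2) / q)) <= 4 * L * Psi (G0 t / 2).
      apply: (@le_trans _ _ (2 * q * (2 * L * (Psi (G0 t / 2) / q)))).
        apply: ler_wpM2r => //; apply: mulr_ge0; first by rewrite mulr_ge0// ltW.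
        by rewrite divr_ge0// ltW.
      rewrite le_eqVlt; apply/orP; left; apply/eqP.
      by move: (Psi _) => x; field; rewrite gt_eqF.
    lra.
  rewrite (ge0_integralD mu mT F10 mF1 F230 mF23) (ge0_integralD mu mT F20 mF2 F30 mF3).
  have e1 : (\int[mu]_(t in @Tpar R) F1 t <= (2 * q * e)%:E)%E.
    rewrite (ge0_integralZl mu mT); [|exact/measurable_EFinP| |].
    - by rewrite [leRHS]EFinM; apply: lee_wpmul2l; [rewrite lee_fin mulr_ge0// ltW|exact: hK].
    - by move=> t _; rewrite lee_fin mulr_ge0.
    - by rewrite lee_fin mulr_ge0// ltW.
  have e2 : (\int[mu]_(t in @Tpar R) F2 t = (2 * L * (2 * pi))%:E)%E.
    rewrite (ge0_integralZl mu mT); [|exact/measurable_EFinP| |].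
    - by rewrite integral_TparE// -{1}(add0r (2 * pi)) rint_pker.
    - by move=> t _; rewrite lee_fin pker_ge0.
    - by rewrite lee_fin mulr_ge0// ltW.
  have e3 : (\int[mu]_(t in @Tpar R) F3 t <= (4 * L * (2 * pi))%:E)%E.
    rewrite (ge0_integralZl mu mT); [|exact/measurable_EFinP| |].
    - by rewrite [leRHS]EFinM; apply: lee_wpmul2l; [rewrite lee_fin mulr_ge0// ltW|].
    - by move=> t _; rewrite lee_fin; apply: Orlicz_ge0 => //; rewrite divr_ge0.
    - by rewrite lee_fin mulr_ge0// ltW.
  rewrite e2; apply: (le_trans (leeD e1 (leeD (lexx _) e3))).
  rewrite -!EFinD lee_fin le_eqVlt; apply/orP; left; apply/eqP; ring.
have pi1 : 1 <= pi :> R by have := pi_ge2 R; lra.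
apply/ler_addgt0Pr => e e0.
have e20 : 0 < e / 2 by rewrite divr_gt0.
have [|K1 hK1] := main (e / 2 / (2 * q)); first by rewrite divr_gt0// mulr_gt0.
have [dl dl0 hdl] := cdiff_continuous (hf z z1) e20.
have [K2 hK2] := radius_near dl0.
pose k := maxn K1 K2.
have /andP[k0 k1] := radius_bd k.
have h1 := hK1 k (leq_maxl _ _).
have h2 : cabs (f (((radius k)%:C)%C * z) - f z) < e / 2.
  apply: hdl; rewrite -{2}(mul1r z) -mulrBl cabsM.
  have -> : ((radius k)%:C)%C - 1 = ((radius k - 1)%:C)%C by apply/eqP; rewrite eq_complex /= subr0 !eqxx.
  rewrite cabs_real distrC ger0_norm ?subr_ge0 ?ltW//.
  apply: (@le_lt_trans _ _ (1 - radius k)); first by apply: ler_piMr; [rewrite subr_ge0 ltW|exact: ltW].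
  by have := hK2 k (leq_maxr _ _); lra.
have h3 := ler_dist_cabs (f (((radius k)%:C)%C * z)) (f z).
have h4 : cabs (f z) <= cabs (f (((radius k)%:C)%C * z)) + e / 2.
  by have := le_lt_trans h3 h2; rewrite ltr_norml => /andP[]; lra.
apply: (le_trans h4).
have h5 : cabs (f (((radius k)%:C)%C * z)) <= 12 * L + e / 2.
  have p0 : 0 < pi :> R by lra.
  rewrite -(ler_pM2l p0); apply: (le_trans h1).
  have -> : 2 * q * (e / 2 / (2 * q)) = e / 2 by field; rewrite gt_eqF.
  have : e / 2 <= pi * (e / 2) by rewrite ler_peMl// ltW.
  have -> : 12 * pi * L = pi * (12 * L) by ring.
  have -> : pi * (12 * L + e / 2) = pi * (12 * L) + pi * (e / 2) by ring.
  by move: (pi * (12 * L)) (pi * (e / 2)) => x y; lra.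
lra.
Qed.

End PointEvaluation.

(** * Inclusion of H^Psi in H^2 *)

Section HardyOrlicz.
Variables (R : realType) (Psi : R -> R).
Hypothesis hPsi : Orlicz Psi.
Notation mu := (@lebesgue_measure R).
Implicit Types (x y t C : R) (f : R[i] -> R[i]) (g : R -> R).

Lemma holo_on_holo f : holo_on disc f <-> holo f.
Proof.
by split=> hf w hw; apply/derivable_cdiff; apply: hf; apply/discE.
Qed.

(** For large [x] superlinearity gives [x <= Psi x], whence [x^2 <= x Psi x <= Psi (beta x)]; put
    [y = beta x]. Small [y] go into the additive constant. *)
Lemma Delta1_square : Delta1 Psi ->
  exists2 K, 0 <= K & forall y, 0 <= y -> y ^+ 2 <= K + K * Psi y.
Proof.
move=> [beta b1 [x0 [_ hx]]].
have [x1 x10 hx1] := Orlicz_superlinear hPsi 1.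
have b0 : 0 < beta by lra.
pose m := Num.max (Num.max 0 (x0 + 1)) x1.
have m0 : 0 <= m by rewrite !le_max lexx.
have mx0 : x0 < m by rewrite !lt_max ltrDl ltr01 orbT.
have mx1 : x1 <= m by rewrite !le_max lexx !orbT.
exists ((beta * m) ^+ 2 + beta ^+ 2); first by rewrite addr_ge0 ?sqr_ge0.
move=> y y0; have Py := Orlicz_ge0 hPsi y0.
have s1 := sqr_ge0 (beta * m); have s2 := sqr_ge0 beta.
have [yb|/ltW yb] := leP y (beta * m).
  apply: (@le_trans _ _ ((beta * m) ^+ 2)); last first.
    have : 0 <= ((beta * m) ^+ 2 + beta ^+ 2) * Psi y by rewrite mulr_ge0 ?addr_ge0.
    lra.
  by rewrite ler_pXn2r// nnegrE// mulr_ge0// ltW.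
have my : m <= y / beta by rewrite ler_pdivlMr// mulrC.
have h1 : y / beta * Psi (y / beta) <= Psi y.
  have := hx (y / beta) (lt_le_trans mx0 my).
  by rewrite [in X in _ <= X -> _]mulrC divfK// gt_eqF.
have h2 : y / beta <= Psi (y / beta).
  by have := hx1 _ (le_trans mx1 my); rewrite mul1r.
have h3 : (y / beta) ^+ 2 <= Psi y.
  apply: le_trans h1; rewrite expr2 ler_wpM2l//; exact: le_trans my.
have : y ^+ 2 <= beta ^+ 2 * Psi y.
  by rewrite -ler_pdivrMl ?exprn_gt0// mulrC -expr_div_n.
have : 0 <= (beta * m) ^+ 2 * Psi y by rewrite mulr_ge0.
rewrite mulrDl; lra.
Qed.

Lemma in_HPsi_square_mean_bounded f : Delta1 Psi -> in_HPsi Psi f -> square_mean_bounded f.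
Proof.
move=> /Delta1_square[K K0 hK] [/holo_on_holo hf [M hM]].
pose C := `|M| + 1.
have C0 : 0 < C by rewrite ltr_wpDl.
exists (C ^+ 2 * (K * (2 * pi) + K * (2 * pi))) => r r01.
pose v t := cabs (f (polar r t)).
have cv : continuous v by exact: continuous_cabs_polar.
have v0 t : 0 <= v t by exact: cabs_ge0.
have hm : (modular Psi v C <= 1)%E.
  apply: modular_of_norm_lt => //; apply: (le_lt_trans (hM r r01)).
  by rewrite lte_fin /C; have := ler_norm M; lra.
rewrite /modular (@intT_le_iff _ _ 1) in hm; last by move=> t; exact: modular_arg_ge0.
rewrite mulr1 in hm.
have mT := @Tpar_measurable R.
have mv : measurable_fun (@Tpar R) v.
  by apply: measurable_funTS; exact: continuous_measurable_fun.
have mP : measurable_fun (@Tpar R) (fun t => Psi (`|v t| / C)).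
  apply: (measurable_Orlicz hPsi) => //; last by move=> t; rewrite divr_ge0// ltW.
  by apply: measurable_funM => //; exact: measurableT_comp.
rewrite -lee_fin -integral_TparE; last by move=> x; apply: cvgM; exact: cv.
have Pge t : 0 <= Psi (`|v t| / C) by apply: (Orlicz_ge0 hPsi); rewrite divr_ge0// ltW.
have C20 : 0 <= C ^+ 2 * K by rewrite mulr_ge0 ?sqr_ge0.
apply: (@le_trans _ _ (\int[mu]_(t in @Tpar R) ((C ^+ 2 * K)%:E + (C ^+ 2 * K)%:E * (Psi (`|v t| / C))%:E))%E).
  apply: ge0_integral_mono => t _; first by rewrite lee_fin sqr_ge0.
  rewrite -EFinM -EFinD lee_fin.
  have := hK (`|v t| / C) (divr_ge0 (normr_ge0 _) (ltW C0)).
  rewrite ger0_norm// expr_div_n ler_pdivrMr ?exprn_gt0// => h.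
  by apply: (le_trans h); rewrite le_eqVlt; apply/orP; left; apply/eqP; rewrite /v; ring.
rewrite (ge0_integralD mu mT).
- have -> : (\int[mu]_(t in @Tpar R) (C ^+ 2 * K)%:E = (C ^+ 2 * K * (2 * pi))%:E)%E.
    by rewrite integral_cst// [RHS]EFinM; congr (_ * _)%E; exact: mu_Tpar.
  rewrite (ge0_integralZl mu mT); first last.
  + by rewrite lee_fin.
  + by move=> t _; rewrite lee_fin.
  + exact/measurable_EFinP.
  apply: (@le_trans _ _ ((C ^+ 2 * K * (2 * pi))%:E + (C ^+ 2 * K)%:E * (2 * pi)%:E)%E).
    by apply: leeD => //; apply: lee_wpmul2l => //; rewrite lee_fin.
  by rewrite -EFinM -EFinD lee_fin le_eqVlt; apply/orP; left; apply/eqP; ring.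
- by move=> t _; rewrite lee_fin.
- by apply/measurable_EFinP; exact: measurable_cst.
- by move=> t _; rewrite -EFinM lee_fin mulr_ge0.
- by apply/measurable_EFinP; exact: measurable_funM.
Qed.

Lemma bounded_square_mean f : (forall z, cabs z < 1 -> cabs (f z) < 1) -> holo f ->
  square_mean_bounded f.
Proof.
move=> f1 hf; exists (2 * pi) => r r01.
have cv : continuous (fun t => cabs (f (polar r t)) ^+ 2).
  by move=> x; apply: cvgM; exact: continuous_cabs_polar.
apply: (@le_trans _ _ (rint 0 (2 * pi) (fun _ : R => 1))); last first.
  by rewrite rint_cst ?mulr_ge0 ?pi_ge0// mul1r subr0.
apply: le_rint; [exact: continuous_subspaceT|by move=> x; exact: cvg_cst|].
move=> t _; rewrite expr_le1 ?cabs_ge0// ltW// f1// cabs_polar; by case/andP: r01.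
Qed.

(** By convexity, multiplying [C] by [k = 1 + V] divides the integral by at least [k], which brings
    the finite value [V] below 1. *)
Lemma modular_lty_norm g C : measurable_fun (@Tpar R) g -> 0 < C ->
  (modular Psi g C < +oo)%E -> (orlicz_norm Psi g < +oo)%E.
Proof.
move=> mg C0; have mT := @Tpar_measurable R.
have Pge t : 0 <= Psi (`|g t| / C) by apply: (Orlicz_ge0 hPsi); rewrite divr_ge0// ltW.
have P0 t : (0 <= (Psi (`|g t| / C))%:E)%E by rewrite lee_fin.
have mP : measurable_fun (@Tpar R) (fun t => (Psi (`|g t| / C))%:E).
  apply/measurable_EFinP; apply: (measurable_Orlicz hPsi) => //.
    by apply: measurable_funM => //; exact: measurableT_comp.
  by move=> t; rewrite divr_ge0// ltW.
rewrite /modular (intT_lty_iff P0) => hI.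
have I0 : (0 <= \int[mu]_(t in @Tpar R) (Psi (`|g t| / C))%:E)%E by exact: integral_ge0.
have [V hV] : exists V, (\int[mu]_(t in @Tpar R) (Psi (`|g t| / C))%:E)%E = V%:E.
  by exists (fine (\int[mu]_(t in @Tpar R) (Psi (`|g t| / C))%:E)); rewrite fineK// ge0_fin_numE.
have V0 : 0 <= V by rewrite hV lee_fin in I0.
pose k := 1 + V.
have k0 : 0 < k by rewrite ltr_pwDl.
have k1 : 1 <= k by rewrite /k lerDl.
have p1 : 1 <= 2 * pi :> R by have := pi_ge2 R; lra.
apply: (@le_lt_trans _ _ (C * k)%:E); last exact: ltry.
have Ck0 : 0 < C * k by exact: mulr_gt0.
apply: orlicz_norm_le => //.
rewrite /modular (@intT_le_iff _ _ 1); last by move=> t; exact: (@modular_arg_ge0 _ _ hPsi g _ _ Ck0).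
apply: (@le_trans _ _ (\int[mu]_(t in @Tpar R) ((k^-1)%:E * (Psi (`|g t| / C))%:E))%E).
  apply: ge0_integral_mono => t _; first exact: (@modular_arg_ge0 _ _ hPsi g _ _ Ck0).
  rewrite -EFinM lee_fin.
  rewrite (_ : `|g t| / (C * k) = k^-1 * (`|g t| / C)); last first.
    by rewrite invfM mulrA mulrC.
  apply: (Orlicz_scale_le hPsi); last by rewrite divr_ge0// ltW.
  by rewrite invr_ge0 (ltW k0) invf_le1.
rewrite (ge0_integralZl mu mT mP); [|by []|by rewrite lee_fin invr_ge0 ltW].
rewrite hV -EFinM lee_fin mulr1; apply: le_trans p1.
by rewrite ler_pdivrMl// mulr1 /k lerDr.
Qed.

End HardyOrlicz.

(** * Sufficiency of the tail estimate *)

Section LayerIntegral.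
Variables (R : realType) (Psi : R -> R).
Hypothesis hPsi : Orlicz Psi.
Notation mu := (@lebesgue_measure R).
Implicit Types (x y t : R).

Lemma dyadic_layer x0 x : 0 < x0 -> x0 < x -> exists k : nat, 2 ^+ k * x0 < x <= 2 ^+ k.+1 * x0.
Proof.
move=> x00 xx.
have ex : exists n : nat, x <= 2 ^+ n * x0.
  exists (Num.truncn (x / x0)).+1; rewrite -ler_pdivrMr//.
  apply/ltW; apply: (lt_le_trans (Num.Theory.truncnS_gt _)).
  by rewrite -natrX ler_nat ltnW// ltn_expl.
case: (ex_minnP ex) => -[|k] hk hmin.
  by move: hk; rewrite expr0 mul1r leNgt xx.
exists k; rewrite hk andbT ltNge; apply/negP => /hmin.
by rewrite ltnn.
Qed.

(** At the top of the layer [2^k x0 < X <= 2^(k+1) x0] the argument of [Psi] is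
    [y = A / beta * 2^k x0]. Hence [beta y = A 2^k x0], and [Delta1] gives
    [Psi y / Psi (A 2^k x0) <= 1 / y], of order [2^-k]. The dilation factor loses 2 for the width of
    the layer and [beta] for [Delta1]. *)
Lemma layer_integral_lty (X : R -> R) (beta A K : R) :
  1 < beta -> (\forall x \near +oo, x * Psi x <= Psi (beta * x)) -> 0 < A ->
  measurable_fun (@Tpar R) X -> (forall t, 0 <= X t) ->
  (\forall x \near +oo, (mu (@Tpar R `&` [set t | (x < X t)%R]) <= (K / Psi (A * x))%:E)%E) ->
  (\int[mu]_(t in @Tpar R) (Psi (A / (2 * beta) * X t))%:E < +oo)%E.
Proof.
move=> b1 [xd [_ hd]] A0 mX X0 [xm [_ hm]].
have mT := @Tpar_measurable R.
have b0 : 0 < beta by lra.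
pose ep := A / (2 * beta).
have ep0 : 0 < ep by rewrite divr_gt0// mulr_gt0.
(* Beyond [xm] for the tail bound, with [A / beta * x0] beyond [xd] for [Delta1], and at least 1. *)
pose x0 := Num.max (Num.max 1 (xm + 1)) ((`|xd| + 1) / (A / beta)).
have x01 : 1 <= x0 by rewrite !le_max lexx.
have x00 : 0 < x0 by lra.
have x0m : xm < x0 by rewrite !lt_max ltrDl ltr01 orbT.
have Ab0 : 0 < A / beta by rewrite divr_gt0.
have x0d : xd < A / beta * x0.
  have : (`|xd| + 1) / (A / beta) <= x0 by rewrite le_max lexx orbT.
  rewrite ler_pdivrMr// mulrC; have := ler_norm xd; lra.
have p2 k : 0 < 2 ^+ k :> R by rewrite exprn_gt0.
have p21 k : 1 <= 2 ^+ k :> R by rewrite exprn_ege1// ler1n.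
(* Whole superlevel sets stand in for the layers: a point of layer [k] belongs to [S k], and the
   further terms only enlarge the sum. *)
pose S k := @Tpar R `&` [set t | 2 ^+ k * x0 < X t].
have mS k : measurable (S k).
  rewrite (_ : S k = @Tpar R `&` X @^-1` `]2 ^+ k * x0, +oo[%classic); first exact: mX.
  by apply/seteqP; split => t [Tt /=]; rewrite ?in_itv/= ?andbT => h; split => //=; rewrite in_itv/= h.
pose c k := Psi (ep * (2 ^+ k.+1 * x0)).
have c0 k : 0 <= c k.
  by apply: (Orlicz_ge0 hPsi); rewrite mulr_ge0 ?ltW// mulr_gt0.
have muS k : (mu (S k) <= (K / Psi (A * (2 ^+ k * x0)))%:E)%E.
  by apply: hm; apply: (lt_le_trans x0m); apply: ler_peMl => //; exact: ltW.
have PA k : 0 < Psi (A * (2 ^+ k * x0)).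
  by apply: (Orlicz_gt0 hPsi); rewrite mulr_gt0// mulr_gt0.
have K0 : 0 <= K.
  have := le_trans (measure_ge0 mu (S 0%N)) (muS 0%N).
  by rewrite lee_fin pmulr_lge0// invr_gt0.
pose e := K / (ep * x0).
have e0 : 0 <= e by rewrite divr_ge0// ltW// mulr_gt0.
have cS k : ((c k)%:E * mu (S k) <= (e / (2 ^ k.+1)%:R)%:E)%E.
  apply: (@le_trans _ _ ((c k)%:E * (K / Psi (A * (2 ^+ k * x0)))%:E)%E).
    by apply: lee_wpmul2l; rewrite ?lee_fin.
  rewrite -EFinM lee_fin /c.
  set y := ep * (2 ^+ k.+1 * x0).
  have y0 : 0 < y by rewrite mulr_gt0// mulr_gt0.
  have yE : y = A / beta * (2 ^+ k * x0).
    by rewrite /y /ep exprS; move: (2 ^+ k : R) => p; field; rewrite gt_eqF.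
  have by_ : beta * y = A * (2 ^+ k * x0).
    by rewrite yE; move: (2 ^+ k : R) => p; field; rewrite gt_eqF.
  have hy : y * Psi y <= Psi (A * (2 ^+ k * x0)).
    rewrite -by_; apply: hd; apply: (lt_le_trans x0d); rewrite yE ler_pM2l//.
    by rewrite ler_peMl// ltW.
  rewrite mulrA ler_pdivrMr// natrX.
  have -> : e / 2 ^+ k.+1 = K / y.
    by rewrite /e /y; move: (2 ^+ k.+1 : R) (p2 k.+1) => p pp; field; rewrite !gt_eqF.
  rewrite mulrAC ler_pdivlMr// (mulrC (Psi y)) -mulrA; apply: ler_wpM2l => //.
  by rewrite mulrC.
pose F k t := ((c k)%:E * (\1_(S k) t)%:E)%E.
have F0 k t : @Tpar R t -> (0 <= F k t)%E.
  by move=> _; rewrite /F -EFinM lee_fin mulr_ge0// indicE.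
have mF k : measurable_fun (@Tpar R) (F k).
  by apply/measurable_EFinP; apply: measurable_funM => //; exact: measurable_indic.
have iF k : (\int[mu]_(t in @Tpar R) F k t <= (e / (2 ^ k.+1)%:R)%:E)%E.
  rewrite /F (ge0_integralZl mu mT); first last.
  - by rewrite lee_fin.
  - by move=> t _; rewrite lee_fin indicE.
  - by apply/measurable_EFinP; apply: measurable_indic; exact: mS.
  apply: le_trans (cS k); apply: lee_wpmul2l; first by rewrite lee_fin.
  rewrite (integral_indic mu mT (mS k)).
  exact: (@lebesgue_measure_le _ (S k `&` @Tpar R) (S k) (@subIsetl _ _ _)).
have sF0 t : @Tpar R t -> (0 <= \sum_(0 <= k <oo) F k t)%E.
  by move=> Tt; apply: nneseries_ge0 => n _ _; exact: F0.
have Pc : 0 <= Psi (ep * x0) by apply: (Orlicz_ge0 hPsi); rewrite mulr_ge0// ltW.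
apply: (@le_lt_trans _ _ (\int[mu]_(t in @Tpar R) ((Psi (ep * x0))%:E + \sum_(0 <= k <oo) F k t))%E).
  apply: ge0_integral_mono => t Tt.
    by rewrite lee_fin; apply: (Orlicz_ge0 hPsi); rewrite mulr_ge0// ltW.
  have [Xx|Xx] := leP (X t) x0.
    apply: (@le_trans _ _ (Psi (ep * x0))%:E); last by rewrite leeDl// sF0.
    rewrite lee_fin; apply: (Orlicz_le hPsi); first by rewrite mulr_ge0// ltW.
    by rewrite ler_pM2l.
  have [k /andP[k1 k2]] := dyadic_layer x00 Xx.
  apply: (@le_trans _ _ (F k t)).
    rewrite /F indicE mem_set ?mulr1/= ?mule1; last by split.
    rewrite lee_fin; apply: (Orlicz_le hPsi); first by rewrite mulr_ge0// ltW.
    by rewrite ler_pM2l.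
  apply: (@le_trans _ _ (\sum_(0 <= k <oo) F k t)%E); last by rewrite leeDr// lee_fin.
  apply: (@le_trans _ _ (\sum_(0 <= i < k.+1) F i t)%E); last first.
    by apply: nneseries_lim_ge => n _ _; exact: F0.
  by rewrite big_nat_recr//= leeDr//; apply: sume_ge0 => i _; exact: F0.
have msF : measurable_fun (@Tpar R) (fun t => \sum_(0 <= k <oo) F k t)%E.
  by apply: ge0_emeasurable_sum => // k t Tt _; exact: F0.
have mc : measurable_fun (@Tpar R) (fun _ => (Psi (ep * x0))%:E).
  by apply/measurable_EFinP; exact: measurable_cst.
have cc0 t : @Tpar R t -> (0 <= (Psi (ep * x0))%:E)%E by rewrite lee_fin.
rewrite (ge0_integralD mu mT cc0 mc sF0 msF).
rewrite (integral_nneseries mu mT mF F0).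
apply: (@le_lt_trans _ _ ((Psi (ep * x0) * (2 * pi))%:E + e%:E)%E); last by rewrite -EFinD ltry.
apply: leeD.
  by rewrite integral_cst// [leRHS]EFinM le_eqVlt; apply/orP; left; apply/eqP; congr (_ * _)%E; exact: mu_Tpar.
apply: le_trans (epsilon_trick0 xpredT e0).
apply: lee_nneseries => [k _ _|k _]; first by apply: integral_ge0 => t Tt; exact: F0.
exact: iF.
Qed.

End LayerIntegral.

(** * The majorant built from the boundary values of [phi] *)

Section Majorant.
Variables (R : realType) (Psi : R -> R) (phi : R[i] -> R[i]).
Hypothesis hPsi : Orlicz Psi.
Hypothesis hphi : holo phi.
Hypothesis phi1 : forall z, cabs z < 1 -> cabs (phi z) < 1.
Notation mu := (@lebesgue_measure R).
Implicit Types (x y t A : R) (f : R[i] -> R[i]).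

Lemma Psi_inv_Orlicz x : 0 <= x -> Psi_inv Psi (Psi x) = x.
Proof.
move=> x0; have P0 := Orlicz_ge0 hPsi x0.
apply/eqP; rewrite eq_le (Psi_inv_le hPsi)// lexx/= leNgt; apply/negP => h.
have := Orlicz_lt hPsi (Psi_inv_ge0 hPsi P0) h.
by rewrite (Psi_invK hPsi P0) ltxx.
Qed.

(** Substitute [l = 1 / Psi x], which turns [chi Psi A l^-1] into [Psi (A * x)]. The quantifier over
    [S] serves both the level sets of the majorant and the set where [|phi^*| >= 1]. *)
Lemma bigO_cond_tail A : 0 < A -> bigO_cond Psi phi A -> exists K, \forall x \near +oo,
  forall S : set R, S `<=` @Tpar R `&` [set t | 1 - cabs (bnd phi t) < (Psi x)^-1] ->
  (mu S <= (K / Psi (A * x))%:E)%E.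
Proof.
move=> A0 [K [dl /= dl0 hK]]; exists (2 * pi * K).
have [x0 x00 hx0] := Orlicz_superlinear hPsi 1.
exists (Num.max x0 dl^-1); split; first exact: num_real.
move=> x; rewrite gt_max => /andP[x1 x2] S hS.
have xp : 0 < x by apply: lt_trans x1.
have Px : 0 < Psi x by exact: Orlicz_gt0.
have xP : x <= Psi x by have := hx0 x (ltW x1); rewrite mul1r.
have l0 : 0 < (Psi x)^-1 by rewrite invr_gt0.
have ldl : (Psi x)^-1 < dl by rewrite invf_plt ?posrE// (lt_le_trans x2).
have := hK (Psi x)^-1; rewrite /ball /= sub0r normrN gtr0_norm// => /(_ ldl l0).
rewrite /mT lee_pdivrMl ?twopi_gt0// -EFinM invrK /chi Psi_inv_Orlicz ?(ltW xp)// mulrA.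
by apply: le_trans; apply: lebesgue_measure_le => t /hS; rewrite setIC.
Qed.

(* [X] is [Psi^-1 (1 / (1 - |phi^*|))], set to [0] where [|phi^*| = 1] and on
   the null set without radial limit; by [point_evaluation] it dominates the
   boundary values of the unit ball up to a factor. *)
Lemma majorant_exists : exists X : R -> R, [/\ measurable_fun (@Tpar R) X,
  forall t, 0 <= X t,
  forall A, 0 < A -> bigO_cond Psi phi A -> exists K, \forall x \near +oo,
    (mu (@Tpar R `&` [set t | (x < X t)%R]) <= (K / Psi (A * x))%:E)%E &
  forall A, 0 < A -> bigO_cond Psi phi A ->
    forall f, holo f -> square_mean_bounded f -> (HPsi_norm Psi f <= 1)%E ->
    {ae mu, forall t, Tpar t -> cabs (bnd (f \o phi) t) <= 12 * X t}].
Proof.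
have phiM : square_mean_bounded phi by exact: bounded_square_mean.
have [N [mN muN cN _ mG]] := boundary_modulus_measurable hphi phiM.
set G := fun t => cabs (bnd phi t) * \1_(~` N) t in mG.
have G0 t : 0 <= G t by rewrite /G mulr_ge0 ?cabs_ge0// indicE.
have Gle t : G t <= cabs (bnd phi t).
  by rewrite /G ler_piMr ?cabs_ge0// indicE; case: (_ \in _).
have mT := @Tpar_measurable R.
pose E := @Tpar R `&` G @^-1` `]-oo, 1[%classic.
have mE : measurable E by exact: mG.
have EP t : E t <-> Tpar t /\ G t < 1.
  by rewrite /E /= in_itv.
pose X t := Psi_inv Psi (1 - G t)^-1 * \1_E t.
have XE t : E t -> X t = Psi_inv Psi (1 - G t)^-1.
  by move=> Et; rewrite /X indicE mem_set// mulr1.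
have XNE t : ~ E t -> X t = 0.
  by move=> Et; rewrite /X indicE memNset// mulr0.
have X0 t : 0 <= X t.
  have [Et|Et] := pselect (E t); last by rewrite XNE.
  rewrite XE//; apply: Psi_inv_ge0 => //; rewrite invr_ge0 subr_ge0 ltW//.
  by case/EP: Et.
have mX : measurable_fun (@Tpar R) X.
  (* Cutting [1 - x] off below at [1 / (n + 1)] makes [v n] monotone on the whole line, hence
     measurable; at each point of [E] it eventually takes the exact value. *)
  pose v (n : nat) x := Psi_inv Psi (Num.max n.+1%:R^-1 (1 - x))^-1.
  have n0 (n : nat) x : 0 < Num.max n.+1%:R^-1 (1 - x) by rewrite lt_max invr_gt0 ltr0n.
  have mv n : measurable_fun [set: R] (v n).
    apply: nondecreasing_measurable => // x y xy.
    apply: Psi_inv_nd => //; first by rewrite invr_ge0 ltW.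
    rewrite lef_pV2 ?posrE// ge_max le_max lexx/= le_max lerD2l lerN2 xy orbT//.
  apply: (measurable_fun_cvg (h := fun n t => v n (G t) * \1_E t)).
    move=> n; apply: measurable_funM; last exact: measurable_indic.
    exact: measurableT_comp.
  move=> t Tt; have [Et|Et] := pselect (E t); last first.
    by rewrite XNE// indicE memNset//; under eq_fun do rewrite mulr0; exact: cvg_cst.
  rewrite XE// indicE mem_set//; under eq_fun do rewrite mulr1.
  have d0 : 0 < 1 - G t by rewrite subr_gt0; case/EP: Et.
  apply: cvg_near_cst; exists (Num.truncn (1 - G t)^-1) => // n /= hn.
  rewrite /v max_r// invf_ple ?posrE//.
  apply/ltW; apply: (lt_le_trans (Num.Theory.truncnS_gt _)).
  by rewrite ler_nat.
exists X; split => //.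
- move=> A A0 /(bigO_cond_tail A0)[K hK]; exists K.
  near=> x; have x0 : 0 < x by near: x; exact: nbhs_pinfty_gt.
  have : forall S : set R, S `<=` @Tpar R `&` [set t | 1 - cabs (bnd phi t) < (Psi x)^-1] ->
    (mu S <= (K / Psi (A * x))%:E)%E by near: x.
  apply => t /= [Tt xX]; split => //=.
  have Et : E t.
    by apply: contrapT => nE; move: xX; rewrite XNE// => /(lt_trans x0); rewrite ltxx.
  have G1 : G t < 1 by case/EP: Et.
  have d0 : 0 < 1 - G t by rewrite subr_gt0.
  have Px := Orlicz_gt0 hPsi x0.
  move: xX; rewrite XE// ltNge (Psi_inv_le hPsi) ?(ltW x0) ?invr_ge0 ?(ltW d0)// -ltNge => h.
  apply: (@le_lt_trans _ _ (1 - G t)); first by rewrite lerD2l lerN2.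
  by rewrite -[ltLHS]invrK ltf_pV2 ?posrE ?invr_gt0.
- move=> A A0 /(bigO_cond_tail A0)[K [xK [_ hK]]] f hf fM nf.
  pose Z := @Tpar R `&` G @^-1` `[1, +oo[%classic.
  have mZ : measurable Z by exact: mG.
  have ZP t : Z t <-> Tpar t /\ 1 <= G t by rewrite /Z /= in_itv/= andbT.
  (* [Z] lies in every tail set, so its measure is at most [K / Psi (A * x)] for all large [x], and
     superlinearity makes this smaller than any [e]. *)
  have muZ : mu Z = 0.
    apply/eqP; rewrite eq_le measure_ge0 andbT; apply/lee_addgt0Pr => e e0; rewrite add0e.
    have [x0 x00 hx0] := Orlicz_superlinear hPsi (`|K| / e).
    pose x := Num.max (xK + 1) (Num.max x0 1 / A + Num.max x0 1).
    have m1 : 1 <= Num.max x0 1 by rewrite le_max lexx orbT.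
    have m0 : 0 < Num.max x0 1 by apply: lt_le_trans m1.
    have xm : Num.max x0 1 / A + Num.max x0 1 <= x by rewrite le_max lexx orbT.
    have mA0 : 0 < Num.max x0 1 / A by exact: divr_gt0.
    have x1 : xK < x by rewrite lt_max ltrDl ltr01.
    have x2 : 0 < x by lra.
    have Ax : Num.max x0 1 <= A * x.
      rewrite mulrC -ler_pdivrMr//; lra.
    have Ax0 : x0 <= A * x by apply: le_trans Ax; rewrite le_max lexx.
    have Ax1 : 1 <= A * x by apply: le_trans Ax.
    have h : (mu Z <= (K / Psi (A * x))%:E)%E.
      apply: hK x1 _ _ => t /ZP[Tt Gt]; split => //=.
      have : 0 < (Psi x)^-1 by rewrite invr_gt0; exact: Orlicz_gt0.
      by have := Gle t; lra.
    apply: (le_trans h); rewrite lee_fin.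
    have Pp : 0 < Psi (A * x) by apply: Orlicz_gt0 => //; exact: lt_le_trans Ax1.
    rewrite ler_pdivrMr//; apply: (le_trans (ler_norm _)).
    rewrite -ler_pdivrMl// mulrC; apply: le_trans (hx0 _ Ax0).
    by rewrite ler_peMr// divr_ge0// ltW.
  exists (N `|` Z); split; first exact: measurableU.
    apply/eqP; rewrite eq_le measure_ge0 andbT.
    by apply: (le_trans (lebesgue_measureU_le N Z)); rewrite muN muZ adde0.
  move=> t /= ht; apply: contrapT => hNZ; apply: ht => Tt.
  have tN : ~ N t by move=> h; apply: hNZ; left.
  have GE : G t = cabs (bnd phi t) by rewrite /G indicE mem_set// mulr1.
  have G1 : G t < 1.
    by rewrite ltNge; apply/negP => h; apply: hNZ; right; apply/ZP.
  have Et : E t by apply/EP.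
  have l1 : cabs (bnd phi t) < 1 by rewrite -GE.
  (* As [|phi^*(t)| < 1], [f] is continuous at the limit point, and the composite has a genuine
     radial limit. *)
  have -> : bnd (f \o phi) t = f (bnd phi t).
    apply: cvg_lim => //; apply/cvg_cabsP => e e0.
    have [dl dl0 hdl] := cdiff_continuous (hf _ l1) e0.
    have /cvg_cabsP/(_ _ dl0) := cN t Tt tN.
    by apply: filterS => r /= hr; exact: hdl.
  by rewrite XE// GE; exact: point_evaluation.
Unshelve. all: by end_near. Qed.

Theorem bigO_cond_order_bounded : Delta1 Psi ->
  (exists2 A : R, 0 < A & bigO_cond Psi phi A) -> order_bounded Psi phi.
Proof.
move=> hD [A A0 hA]; have [X [mX X0 tX bX]] := majorant_exists.
have [beta b1 hb] := hD.
have [K hK] := tX A A0 hA.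
have hI := layer_integral_lty hPsi b1 hb A0 mX X0 hK.
have b0 : 0 < beta by lra.
have e0 : 0 < A / (2 * beta) by rewrite divr_gt0// mulr_gt0.
have mg : measurable_fun (@Tpar R) (fun t => 12 * X t) by exact: measurable_funM.
exists (fun t => 12 * X t); split.
(* With this [C] the quotient [12 * X t / C] is [A / (2 * beta) * X t], the argument treated by the
   layers. *)
- split => //; have C0 : 0 < 12 / (A / (2 * beta)) by rewrite divr_gt0.
  apply: (modular_lty_norm hPsi mg C0).
  rewrite /modular intT_lty_iff; last by move=> t; exact: (@modular_arg_ge0 _ _ hPsi (fun t => 12 * X t) _ _ C0).
  apply: le_lt_trans hI; apply: ge0_integral_mono => t _.
    exact: (@modular_arg_ge0 _ _ hPsi (fun t => 12 * X t) _ _ C0).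
  rewrite ger0_norm; last by rewrite mulr_ge0.
  rewrite (_ : 12 * X t / _ = A / (2 * beta) * X t)//.
  by move: (A / (2 * beta)) e0 => ep ep0; field; rewrite gt_eqF.
- by move=> t; rewrite mulr_ge0.
- move=> f hf nf; apply: (bX A) => //; first by case: hf => /holo_on_holo.
  exact: in_HPsi_square_mean_bounded hf.
Qed.

Theorem bigO_cond_order_bounded_M : Delta1 Psi ->
  (forall A : R, 0 < A -> bigO_cond Psi phi A) -> order_bounded_M Psi phi.
Proof.
move=> hD hA; have [X [mX X0 tX bX]] := majorant_exists.
have [beta b1 hb] := hD.
have b0 : 0 < beta by lra.
have mg : measurable_fun (@Tpar R) (fun t => 12 * X t) by exact: measurable_funM.
exists (fun t => 12 * X t); split.
- split => // C C0.
  (* Here [A] is adapted to [C]: it satisfies [A / (2 * beta) = 12 / C], so all [C] are reached when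
     all [A] are available. *)
  have A0 : 0 < 2 * beta * (12 / C) by rewrite !mulr_gt0// invr_gt0.
  have [K hK] := tX _ A0 (hA _ A0).
  have hI := layer_integral_lty hPsi b1 hb A0 mX X0 hK.
  rewrite /modular intT_lty_iff; last by move=> t; exact: (@modular_arg_ge0 _ _ hPsi (fun t => 12 * X t) _ _ C0).
  apply: le_lt_trans hI; apply: ge0_integral_mono => t _.
    exact: (@modular_arg_ge0 _ _ hPsi (fun t => 12 * X t) _ _ C0).
  rewrite ger0_norm; last by rewrite mulr_ge0.
  rewrite (_ : 12 * X t / C = 2 * beta * (12 / C) / (2 * beta) * X t)//.
  by field; rewrite !gt_eqF.
- by move=> t; rewrite mulr_ge0.
- move=> f hf nf; apply: (bX 1 ltr01) => //; [exact: hA|by case: hf => /holo_on_holo|].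
  exact: in_HPsi_square_mean_bounded hf.
Qed.

End Majorant.

(** * Necessity of the tail estimate *)

Section TestFunctions.
Variables (R : realType) (Psi : R -> R).
Hypothesis hPsi : Orlicz Psi.
Notation mu := (@lebesgue_measure R).
Implicit Types (l t r : R) (a w z : R[i]).

Lemma cvg_polar t : polar r t @[r --> (1 : R)^'-] --> expi t.
Proof.
apply/cvg_cabsP => e e0; exists e => //= r; rewrite /ball /= => r1 _.
by rewrite /polar -{2}(mul1r (expi t)) -mulrBl cabsM cabs_expi mulr1
  (_ : (r%:C)%C - 1 = ((r - 1)%:C)%C) ?cabs_real 1?distrC//; apply/eqP; rewrite eq_complex /= subr0 !eqxx.
Qed.

Lemma bnd_comp_cdiff (f psi : R[i] -> R[i]) w t : psi (polar r t) @[r --> (1 : R)^'-] --> w ->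
  cdiff f w -> bnd (f \o psi) t = f w.
Proof.
move=> /cvg_cabsP hw dfw; apply: cvg_lim => //; apply/cvg_cabsP => e e0.
have [dl dl0 hdl] := cdiff_continuous dfw e0.
by apply: filterS (hw dl dl0) => r /= hr; exact: hdl.
Qed.

(** On the unit circle the modulus of the squared kernel is proportional to the Poisson kernel of
    [a]. The factor [l^2 / 4] bounds the function by [Psi_inv Psi l^-1] on the closed disc when
    [1 - |a| >= l / 2]. *)
Definition test_fun l a w : R[i] :=
  ((Psi_inv Psi l^-1 * (l ^+ 2 / 4))%:C)%C * ((1 - (a^*)%C * w)^-1 * (1 - (a^*)%C * w)^-1).

Section OneTest.
Variables (l : R) (a : R[i]).
Hypotheses (l0 : 0 < l) (l1 : l < 1) (al : cabs a <= 1 - l / 2).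

Let V := Psi_inv Psi l^-1.

Let V0 : 0 < V.
Proof. by apply: Psi_inv_gt0 => //; rewrite invr_gt0. Qed.

Let a1 : cabs a < 1.
Proof. by apply: le_lt_trans al _; have := l0; lra. Qed.

Lemma cdiff_test_fun w : cabs w <= 1 -> cdiff (test_fun l a) w.
Proof.
move=> w1; apply: cdiffM; first exact: cdiff_cst.
by apply: cdiffM; exact: cdiff_kernel.
Qed.

Lemma cabs_test_fun w : cabs (test_fun l a w) = V * (l ^+ 2 / 4 / cabs (1 - (a^*)%C * w) ^+ 2).
Proof.
rewrite /test_fun !cabsM cabs_real !cabsV ger0_norm; last first.
  by rewrite mulr_ge0 ?(ltW V0)// divr_ge0// sqr_ge0.
by rewrite -/V expr2 invfM -!mulrA.
Qed.

Lemma test_fun_le w : cabs w <= 1 -> cabs (test_fun l a w) <= V.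
Proof.
move=> w1; rewrite cabs_test_fun; apply: ler_piMr; first exact: ltW.
have h : l / 2 <= cabs (1 - (a^*)%C * w).
  have := ler_cabsD (1 - (a^*)%C * w) ((a^*)%C * w); rewrite subrK cabs1 cabsM cabsJ.
  have : cabs a * cabs w <= cabs a by rewrite ler_piMr// cabs_ge0.
  have := al; lra.
have h0 : 0 < l / 2 by rewrite divr_gt0.
have hp : 0 < cabs (1 - (a^*)%C * w) by apply: lt_le_trans h.
rewrite ler_pdivrMr ?exprn_gt0// mul1r.
have := ler_pM (ltW h0) (ltW h0) h h.
by rewrite -!expr2 expr_div_n (_ : 2 ^+ 2 = 4 :> R)//; ring.
Qed.

Lemma cabs_kernel_circle t : cabs (1 - (a^*)%C * expi t) = cabs (gam a t).
Proof.
have -> : 1 - (a^*)%C * expi t = ((gam a t)^*)%C * expi t.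
  by rewrite /gam conjcB conj_expi mulrBl mulVf ?expi_neq0.
by rewrite cabsM cabsJ cabs_expi mulr1.
Qed.

Lemma in_HPsi_test_fun : in_HPsi Psi (test_fun l a).
Proof.
split; first by apply/holo_on_holo => w w1; apply: cdiff_test_fun; exact: ltW.
pose y := Psi_inv Psi 1; have y0 : 0 < y by apply: Psi_inv_gt0.
have C0 : 0 < V / y by exact: divr_gt0.
exists (V / y) => r /andP[r0 r1]; apply: orlicz_norm_le => //.
rewrite /modular (@intT_le_iff _ _ 1); last by move=> t; exact: (@modular_arg_ge0 _ _ hPsi (fun t => cabs (test_fun l a (polar r t))) _ _ C0).
apply: (@le_trans _ _ (\int[mu]_(t in @Tpar R) (cst 1%:E t))%E).
  apply: ge0_integral_mono => t _; first exact: (@modular_arg_ge0 _ _ hPsi (fun t => cabs (test_fun l a (polar r t))) _ _ C0).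
  rewrite lee_fin -[leRHS](Psi_invK hPsi ler01); apply: (Orlicz_le hPsi).
    by rewrite divr_ge0// ltW.
  rewrite ger0_norm ?cabs_ge0// ler_pdivrMr// -/y mulrCA divff ?gt_eqF// mulr1.
  by apply: test_fun_le; rewrite cabs_polar// ltW.
rewrite integral_cst; last exact: Tpar_measurable.
by rewrite mul1e mulr1 le_eqVlt; apply/orP; left; apply/eqP; exact: mu_Tpar.
Qed.

Lemma bnd_test_fun t : bnd (test_fun l a) t = test_fun l a (expi t).
Proof.
apply: (@bnd_comp_cdiff (test_fun l a) id); first exact: cvg_polar.
by apply: cdiff_test_fun; rewrite cabs_expi.
Qed.

(** Convexity gives [Psi |f| <= (|f| / V) Psi V], where [Psi V = 1 / l] and [|f| / V] is a multiple
    of the Poisson kernel. The kernel has mean 1, so the modular is at most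
    [(l / 4) / (1 - |a|^2) <= 1 / 2]. *)
Lemma HPsi_norm_test_fun : (HPsi_norm Psi (test_fun l a) <= 1)%E.
Proof.
apply: orlicz_norm_le => //.
rewrite /modular (@intT_le_iff _ _ 1); last by move=> t; exact: (@modular_arg_ge0 _ _ hPsi (fun t => cabs (bnd (test_fun l a) t)) _ _ ltr01).
have k0 : 0 < 1 - cabs a ^+ 2.
  by rewrite subr_gt0 expr_lt1// cabs_ge0.
have kl : l / 2 <= 1 - cabs a ^+ 2.
  have : cabs a ^+ 2 <= cabs a by rewrite expr2 ler_piMr ?cabs_ge0// ltW.
  have := al; lra.
pose c := l / 4 / (1 - cabs a ^+ 2).
have c0 : 0 <= c by rewrite !divr_ge0// ltW.
have cp : continuous (pker a) by apply: within_continuousT => p q; exact: cts_pker.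
apply: (@le_trans _ _ (\int[mu]_(t in @Tpar R) (c%:E * (pker a t)%:E))%E).
  apply: ge0_integral_mono => t _; first exact: (@modular_arg_ge0 _ _ hPsi (fun t => cabs (bnd (test_fun l a) t)) _ _ ltr01).
  rewrite -EFinM lee_fin divr1 ger0_norm ?cabs_ge0// bnd_test_fun.
  have tV : cabs (test_fun l a (expi t)) / V <= 1.
    by rewrite ler_pdivrMr// mul1r test_fun_le// cabs_expi.
  have tV0 : 0 <= cabs (test_fun l a (expi t)) / V by rewrite divr_ge0 ?cabs_ge0// ltW.
  have t01 : 0 <= cabs (test_fun l a (expi t)) / V <= 1 by rewrite tV0.
  have := Orlicz_scale_le hPsi t01 (ltW V0); rewrite divfK ?gt_eqF// => /le_trans; apply.
  have li0 : 0 <= l^-1 by rewrite invr_ge0 ltW.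
  rewrite /V (Psi_invK hPsi li0) cabs_test_fun cabs_kernel_circle /c /pker /V.
  have Vn : Psi_inv Psi l^-1 != 0 by rewrite gt_eqF.
  have ln : l != 0 by rewrite gt_eqF.
  have kn : 1 - cabs a ^+ 2 != 0 by rewrite gt_eqF.
  have g0 : cabs (gam a t) != 0 by rewrite cabs_eq0 gam_neq0.
  rewrite le_eqVlt; apply/orP; left; apply/eqP; field.
  by rewrite ?g0 ?Vn ?ln ?kn.
rewrite (ge0_integralZl mu (@Tpar_measurable R)); first last.
- by rewrite lee_fin.
- by move=> t _; rewrite lee_fin pker_ge0.
- by apply/measurable_EFinP; apply: measurable_funTS; exact: continuous_measurable_fun.
rewrite integral_TparE// -{1}(add0r (2 * pi)) rint_pker// -EFinM lee_fin mulr1.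
apply: ler_piMl; first exact/ltW/twopi_gt0.
rewrite /c ler_pdivrMr// mul1r.
by apply: le_trans kl; have := l0; lra.
Qed.

End OneTest.

(** For [b = (1 - 3 l / 4) w] the number [1 - conj b w] is real of size at most [11 l / 4]; passing
    from [b] to [a] costs [l / 4]. The denominator is thus at most [3 l], and
    [(l^2 / 4) / (3 l)^2 = 1 / 36]. The factor [3 / 4] leaves an approximation [a] of [b] within
    [|a| <= 1 - l / 2]. *)
Lemma test_fun_lower l a w : 0 < l -> l < 1 -> 1 - l < cabs w -> cabs w <= 1 ->
  cabs (a - ((1 - 3 / 4 * l)%:C)%C * w) <= l / 4 -> cabs a <= 1 - l / 2 ->
  Psi_inv Psi l^-1 / 36 <= cabs (test_fun l a w).
Proof.
move=> l0 l1 w0 w1 aw al; rewrite cabs_test_fun//.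
have V0 : 0 < Psi_inv Psi l^-1 by apply: Psi_inv_gt0 => //; rewrite invr_gt0.
rewrite ler_pM2l//.
have a1 : cabs a < 1 by apply: le_lt_trans al _; lra.
have k0 : 0 < cabs (1 - (a^*)%C * w).
  have := ler_cabsD (1 - (a^*)%C * w) ((a^*)%C * w); rewrite subrK cabs1 cabsM cabsJ.
  have : cabs a * cabs w <= cabs a by rewrite ler_piMr// cabs_ge0.
  have := al; lra.
have k1 : cabs (1 - (a^*)%C * w) <= 3 * l.
  set b := ((1 - 3 / 4 * l)%:C)%C * w in aw.
  have -> : 1 - (a^*)%C * w = (1 - (b^*)%C * w) - ((a - b)^*)%C * w.
    by rewrite conjcB; ring.
  apply: (le_trans (ler_cabsB _ _)).
  have h1 : cabs (((a - b)^*)%C * w) <= l / 4.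
    by rewrite cabsM cabsJ; apply: le_trans aw; rewrite ler_piMr ?cabs_ge0.
  have -> : 1 - (b^*)%C * w = ((1 - (1 - 3 / 4 * l) * cabs w ^+ 2)%:C)%C.
    rewrite /b conjcM conjc_real -mulrA (mulrC (w^*)%C) mulcJ.
    by apply/eqP; rewrite eq_complex /=; apply/andP; split; apply/eqP; ring.
  rewrite cabs_real.
  have s1 : cabs w ^+ 2 <= 1 by rewrite expr_le1// cabs_ge0.
  have s2 : 1 - 2 * l <= cabs w ^+ 2 by rewrite expr2; nra.
  have h2 : `|1 - (1 - 3 / 4 * l) * cabs w ^+ 2| <= 11 / 4 * l.
    by rewrite ler_norml; apply/andP; split; nra.
  lra.
rewrite ler_pdivlMr ?exprn_gt0//.
have : cabs (1 - (a^*)%C * w) ^+ 2 <= (3 * l) ^+ 2.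
  by rewrite ler_pXn2r// nnegrE ?cabs_ge0// mulr_ge0// ltW.
rewrite exprMn (_ : 3 ^+ 2 = 9 :> R); [lra|ring].
Qed.

Variable phi : R[i] -> R[i].
Hypothesis hphi : holo phi.
Hypothesis phi1 : forall z, cabs z < 1 -> cabs (phi z) < 1.

(** Mesh [l / 8] in each coordinate yields the precision [l / 4] of [test_fun_lower]; integer
    indices make the family countable. *)
Definition grid l (pq : int * int) : R[i] := ((pq.1%:~R * (l / 8)) +i* (pq.2%:~R * (l / 8)))%C.

Lemma grid_dense l w : 0 < l -> exists pq, cabs (grid l pq - w) <= l / 4.
Proof.
move=> l0; have h0 : 0 < l / 8 by rewrite divr_gt0.
have fl x : `|(Num.floor (x / (l / 8)))%:~R * (l / 8) - x| <= l / 8.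
  have /andP[f1 f2] := Num.Theory.floor_itv (x / (l / 8)).
  move: f1 f2; rewrite ler_pdivlMr// ltr_pdivrMr// intrD mulrDl mul1r => f1 f2.
  by rewrite ler_norml; apply/andP; split; lra.
exists (Num.floor (complex.Re w / (l / 8)), Num.floor (complex.Im w / (l / 8))).
apply: (le_trans (ler_cabs_ReIm _)).
have -> : l / 4 = l / 8 + l / 8 by lra.
apply: lerD.
  by have := fl (complex.Re w); rewrite /grid; case: (w).
by have := fl (complex.Im w); rewrite /grid; case: (w).
Qed.

(** Where [1 - |phi^*(t)| < l], the test function of a grid point near [(1 - 3 l / 4) phi^*(t)]
    forces [g t >= V / 36], off countably many null sets. Markov's inequality for [Psi (g / C)] at
    that level produces [chi] with [A = 1 / (36 C)]. *)
Lemma tail_le_modular (g : R -> R) C W : measurable_fun (@Tpar R) g -> (forall t, 0 <= g t) ->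
  (forall f, in_HPsi Psi f -> (HPsi_norm Psi f <= 1)%E ->
      {ae mu, forall t, Tpar t -> cabs (bnd (f \o phi) t) <= g t}) ->
  0 < C -> (modular Psi g C <= W%:E)%E -> bigO_cond Psi phi (36 * C)^-1.
Proof.
move=> mg g0 hg C0 gW; exists W; exists 1 => //= l; rewrite /ball /= sub0r normrN => l1 l0.
rewrite gtr0_norm// in l1.
have V0 : 0 < Psi_inv Psi l^-1 by apply: Psi_inv_gt0 => //; rewrite invr_gt0.
set V := Psi_inv Psi l^-1 in V0.
have mT := @Tpar_measurable R.
have phiM : square_mean_bounded phi by exact: bounded_square_mean.
have [N [mN muN cN _ _]] := boundary_modulus_measurable hphi phiM.
(* Codes of no grid point and grid points too close to the circle give the empty set; every other
   code gives the exceptional set of one test function. *)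
pose bad (n : nat) : set R := if unpickle n is Some pq then
  [set t | cabs (grid l pq) <= 1 - l / 2 /\
    ~ (Tpar t -> cabs (bnd (test_fun l (grid l pq) \o phi) t) <= g t)] else set0.
have nbad n : mu.-negligible (bad n).
  rewrite /bad; case: unpickle => [pq|]; last exact: negligible_set0.
  have [al|al] := leP (cabs (grid l pq)) (1 - l / 2).
    have := hg _ (in_HPsi_test_fun l0 al) (HPsi_norm_test_fun l0 al).
    by apply: negligibleS => t /= [_].
  by apply: negligibleS (@negligible_set0 _ _ _ mu) => t /= [].
have [M [mM muM hM]] : mu.-negligible (\bigcup_n bad n) by exact: negligible_bigcup.
pose B := @Tpar R `&` g @^-1` `[V / 36, +oo[%classic.
have mB : measurable B by exact: mg.
have incl : [set t | 1 - cabs (bnd phi t) < l] `&` @Tpar R `<=` (N `|` M) `|` B.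
  move=> t /= [tl Tt].
  have [tN|tN] := pselect (N t); first by left; left.
  have [tM|tM] := pselect (M t); first by left; right.
  right; split => //=; rewrite in_itv/= andbT.
  set w := bnd phi t in tl.
  have cw : phi (polar r t) @[r --> (1 : R)^'-] --> w by exact: cN.
  have w1 : cabs w <= 1.
    apply/ler_addgt0Pr => e e0; have /cvg_cabsP/(_ _ e0) cwe := cw.
    have [r [r1 r2]] : exists r : R, 0 <= r < 1 /\ cabs (phi (polar r t) - w) < e.
      near (1 : R)^'- => r; exists r; split; last by near: r.
      by apply/andP; split; [apply/ltW|]; near: r; [exact: nbhs_left_gt|exact: nbhs_left_lt].
    have p1 : cabs (phi (polar r t)) < 1.
      by apply: phi1; case/andP: r1 => r0 r1; rewrite cabs_polar.
    have := ler_dist_cabs (phi (polar r t)) w; rewrite ler_norml => /andP[]; lra.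
  have [pq hpq] := grid_dense (((1 - 3 / 4 * l)%:C)%C * w) l0.
  have al : cabs (grid l pq) <= 1 - l / 2.
    have := ler_cabsD (grid l pq - ((1 - 3 / 4 * l)%:C)%C * w) (((1 - 3 / 4 * l)%:C)%C * w).
    rewrite subrK cabsM cabs_real ger0_norm; last by lra.
    have : (1 - 3 / 4 * l) * cabs w <= 1 - 3 / 4 * l by rewrite ler_piMr//; lra.
    lra.
  have wl : 1 - l < cabs w by lra.
  have low := test_fun_lower l0 l1 wl w1 hpq al.
  apply: (le_trans low).
  have -> : test_fun l (grid l pq) w = bnd (test_fun l (grid l pq) \o phi) t.
    by apply/esym; apply: bnd_comp_cdiff cw _; exact: cdiff_test_fun.
  apply: contrapT => hn; apply: tM; apply: hM; exists (pickle pq) => //.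
  by rewrite /bad pickleK /=; split => // h; apply: hn; exact: h.
have muS : (mu ([set t | (1 - cabs (bnd phi t) < l)%R] `&` @Tpar R) <= mu B)%E.
  apply: (le_trans (lebesgue_measure_le incl)).
  apply: (le_trans (lebesgue_measureU_le _ _)).
  have : (mu (N `|` M) <= 0)%E by apply: (le_trans (lebesgue_measureU_le N M)); rewrite muN muM adde0.
  by move=> h; rewrite -[leRHS]add0e leeD2r.
have p0 : 0 < (36 * C)^-1 * V by rewrite mulr_gt0// invr_gt0 mulr_gt0.
have Pp : 0 < Psi ((36 * C)^-1 * V) by exact: Orlicz_gt0.
rewrite /modular (@intT_le_iff _ _ W) in gW; last by move=> t; exact: (@modular_arg_ge0 _ _ hPsi g _ _ C0).
have markov : ((Psi ((36 * C)^-1 * V))%:E * mu B <= (2 * pi * W)%:E)%E.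
  apply: le_trans gW.
  apply: (@le_trans _ _ (\int[mu]_(t in @Tpar R) ((Psi ((36 * C)^-1 * V))%:E * (\1_B t)%:E))%E).
    rewrite (ge0_integralZl mu mT); first last.
    - by rewrite lee_fin ltW.
    - by move=> t _; rewrite lee_fin indicE.
    - by apply/measurable_EFinP; apply: measurable_indic; exact: mB.
    apply: lee_wpmul2l; first by rewrite lee_fin ltW.
    rewrite (integral_indic mu mT mB).
    by apply: lebesgue_measure_le => t Bt; split => //; case: Bt.
  apply: ge0_integral_mono => t Tt.
    by rewrite -EFinM lee_fin mulr_ge0 ?(ltW Pp)// indicE.
  rewrite -EFinM lee_fin indicE; have [Bt|Bt] := pselect (B t); last first.
    by rewrite memNset// mulr0; apply: (Orlicz_ge0 hPsi); rewrite divr_ge0// ltW.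
  rewrite mem_set// mulr1; apply: (Orlicz_le hPsi); first exact: ltW.
  case: Bt => _ /=; rewrite in_itv/= andbT => h.
  by rewrite ger0_norm// ler_pdivlMr// (_ : (36 * C)^-1 * V * C = V / 36)//; field; rewrite gt_eqF.
rewrite /mT lee_pdivrMl ?twopi_gt0// -EFinM /chi -/V.
apply: (le_trans muS).
by rewrite mulrA EFinM lee_pdivlMr// muleC.
Unshelve. all: by end_near. Qed.

End TestFunctions.

Theorem mainTheorem8 (R : realType) (Psi : R -> R) (phi : R[i] -> R[i]) :
  Orlicz Psi -> holo_on disc phi -> (forall z, disc z -> disc (phi z)) ->
  [/\ (order_bounded Psi phi -> exists2 A : R, 0 < A & bigO_cond Psi phi A),
      (order_bounded_M Psi phi -> forall A : R, 0 < A -> bigO_cond Psi phi A),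
      (Delta1 Psi -> (exists2 A : R, 0 < A & bigO_cond Psi phi A) ->
         order_bounded Psi phi)
    & (Delta1 Psi -> (forall A : R, 0 < A -> bigO_cond Psi phi A) ->
         order_bounded_M Psi phi)].
Proof.
move=> hPsi /holo_on_holo hphi hdisc.
have phi1 z : cabs z < 1 -> cabs (phi z) < 1 by move=> /discE /hdisc /discE.
split.
- move=> [g [[mg /norm_lty_modular[C C0 hC]] g0 hg]]; exists (36 * C)^-1.
    by rewrite invr_gt0 mulr_gt0.
  exact: tail_le_modular hC.
- move=> [g [[mg hM] g0 hg]] A A0.
  (* This scale inverts [A = 1 / (36 C)], so finiteness of the modular at every scale reaches every
     [A]. *)
  have C0 : 0 < (36 * A)^-1 by rewrite invr_gt0 mulr_gt0.
  have -> : A = (36 * (36 * A)^-1)^-1 by field; rewrite gt_eqF.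
  have hm := hM _ C0.
  have m0 : (0 <= modular Psi g (36 * A)^-1)%E.
    rewrite /modular /intT mule_ge0 ?lee_fin ?invr_ge0 ?(ltW (twopi_gt0 R))//.
    by apply: integral_ge0 => t _; exact: (@modular_arg_ge0 _ _ hPsi g _ _ C0).
  apply: (tail_le_modular (W := fine (modular Psi g (36 * A)^-1)) hPsi hphi phi1 mg g0 hg C0).
  by rewrite fineK// ge0_fin_numE.
- exact: bigO_cond_order_bounded.
- exact: bigO_cond_order_bounded_M.
Qed.
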